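(* Assume $\gamma>0$ and $\int^{\infty}\frac{\mathrm{d}x}{x\Psi(1/x)R(x)}<\infty$. Let $\varphi(b)=\frac{1}{\gamma}\int_b^\infty\frac{\mathrm{d}x}{R(x)}$ for $b>0$, and suppose: (H1) $\limsup_{h\to1+}\liminf_{x\to\infty}\frac{\varphi(hx)}{\varphi(x)}=1$; (H2) for every $h>1$, $\liminf_{x\to\infty}\frac{\varphi(x)}{\varphi(hx)}>1$; (H3) $\limsup_{\rho\to0+}\lim_{z\to\infty}V(z,\rho)=0$, where $V(z,\rho)=\sup_{x\ge z}\left(\frac{R(x)}{R(x+\rho z)}-1\right)_+$ and $(y)_+=\max(y,0)$. Then $\frac{X_t}{\varphi^{-1}(t)}\to1$ in $\mathbb{P}_\infty$-probability as $t\to0+$.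
   Context: Let $\Psi(\lambda)=\gamma\lambda+\frac{\sigma^2}{2}\lambda^2+\int_0^\infty(e^{-\lambda z}-1+\lambda z)\,\pi(\mathrm{d}z)$ for $\lambda\ge0$, where $\gamma\in\mathbb{R}$, $\sigma\ge0$ and $\pi$ is a measure on $(0,\infty)$ with $\int_0^\infty (z\wedge z^2)\pi(\mathrm{d}z)<\infty$. Let $Z$ be a spectrally positive Lévy process with $\mathbb{E}[e^{-\lambda Z_1}\mid Z_0=x]=e^{-\lambda x+\Psi(\lambda)}$ for $\lambda\ge0$. Let $R$ be continuous on $[0,\infty)$ and strictly positive on $(0,\infty)$. Let $\tau_0^-=\inf\{t\ge0:Z_t<0\}$, $\eta(s)=\int_0^{s\wedge\tau_0^-}\frac{\mathrm{d}r}{R(Z_r)}$, $\eta^{-1}(t)=\inf\{s\ge0:\eta(s)>t\}$, and $X_t=Z_{\eta^{-1}(t)\wedge\tau_0^-}$. Under the stated integral condition (with $\gamma\ge0$), $\infty$ is an instantaneous entrance boundary for $X$, i.e. $X$ does not explode and for every $t>0$, $\lim_{b\to\infty}\liminf_{x\to\infty}\mathbb{P}_x(T_b\le t)=1$ where $T_b=\inf\{t\ge0:X_t<b\}$ and $\mathbb{P}_x$ is the law of $X$ started at $x$; $\mathbb{P}_\infty$ denotes the law of the càdlàg strong Markov process on $[0,\infty]$ started at $\infty$, leaving $\infty$ instantaneously, and evolving from finite states as $X$. $\varphi^{-1}$ is the inverse of the strictly decreasing function $\varphi$. *)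

(* Defs.v *)
From mathcomp Require Import all_boot all_order all_algebra.
From mathcomp Require Import all_classical all_reals all_analysis measurable_realfun.
Import Order.TTheory GRing.Theory Num.Theory.
Import numFieldNormedType.Exports.

Set Implicit Arguments.
Unset Strict Implicit.
Unset Printing Implicit Defensive.

Local Open Scope classical_set_scope.
Local Open Scope ring_scope.

Section Defs.
Variable R : realType.

Definition cadlag (T : topologicalType) (f : R -> T) : Prop :=
  forall t : R, 0 <= t ->
    (f x @[x --> t^'+] --> f t) /\ (0 < t -> exists l : T, f x @[x --> t^'-] --> l).

Definition lapexp (gam sig : R) (pi : {measure set R -> \bar R}) (lam : R) : R :=
  gam * lam + sig ^+ 2 / 2 * lam ^+ 2
  + fine (\int[pi]_(z in `]0%R, +oo[) (expR (- (lam * z)) - 1 + lam * z)%:E)%E.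

Definition levy_measure_cond (pi : {measure set R -> \bar R}) : Prop :=
  pi [set z : R | z <= 0] = 0%E /\
  (\int[pi]_(z in `]0%R, +oo[) (Num.min z (z ^+ 2))%:E < +oo)%E.

Section Prob.
Context d (Om : measurableType d) (Q : probability Om R).

Definition mutual_indep n (f : 'I_n -> Om -> R) : Prop :=
  forall B : 'I_n -> set R, (forall i, measurable (B i)) ->
    Q (\bigcap_(i in [set: 'I_n]) (f i @^-1` B i)) = (\prod_(i < n) Q (f i @^-1` B i))%E.

Definition is_levy (L : R -> Om -> R) (Psi : R -> R) : Prop :=
  (forall t, 0 <= t -> measurable_fun setT (L t)) /\
  (forall w, L 0 w = 0) /\
  (forall w, cadlag (fun t => L t w)) /\
  (forall n (ts : nat -> R), 0 <= ts 0%N -> (forall i, ts i <= ts i.+1) ->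
     mutual_indep (fun (i : 'I_n) w => L (ts i.+1) w - L (ts i) w)) /\
  (forall s t, 0 <= s -> 0 <= t -> forall B : set R, measurable B ->
     Q ((fun w => L (s + t) w - L s w) @^-1` B) = Q (L t @^-1` B)) /\
  (forall lam, 0 <= lam ->
     (\int[Q]_w (expR (- (lam * L 1 w)))%:E = (expR (Psi lam))%:E)%E).

Definition tau0 (L : R -> Om -> R) (x : R) (w : Om) : \bar R :=
  ereal_inf [set t%:E | t in [set t | 0 <= t /\ x + L t w < 0]].

Definition einv (y : R) : \bar R := if y == 0 then +oo%E else (y^-1)%:E.

Definition eta (Rr : R -> R) (L : R -> Om -> R) (x s : R) (w : Om) : \bar R :=
  (\int[lebesgue_measure]_(r in [set r : R | (0 <= r <= s)%R /\ (r%:E < tau0 L x w)%E])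
     einv (Rr (x + L r w)%R))%E.

Definition etainv (Rr : R -> R) (L : R -> Om -> R) (x t : R) (w : Om) : \bar R :=
  ereal_inf [set s%:E | s in [set s | 0 <= s /\ (t%:E < eta Rr L x s w)%E]].

Definition Xtc (Rr : R -> R) (L : R -> Om -> R) (x t : R) (w : Om) : \bar R :=
  match Order.min (etainv Rr L x t w) (tau0 L x w) with
  | EFin u => (x + L u w)%:E
  | _ => +oo%E
  end.

Definition Xlaw (Rr : R -> R) (L : R -> Om -> R) (x : R) n
    (ts : 'I_n -> R) (Bs : 'I_n -> set \bar R) : \bar R :=
  Q [set w | forall i, Bs i (Xtc Rr L x (ts i) w)].

End Prob.

Section Entrance.
Context d (Om : measurableType d) (P : probability Om R).
Variable Y : R -> Om -> \bar R.

Definition natF (t : R) : set (set Om) :=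
  <<s [set A | exists (s : R) (B : set \bar R), 0 <= s <= t /\ measurable B /\ A = Y s @^-1` B] >>.
Definition natFplus (t : R) : set (set Om) := fun A => forall u, t < u -> natF u A.
Definition natFinf : set (set Om) :=
  <<s [set A | exists (s : R) (B : set \bar R), 0 <= s /\ measurable B /\ A = Y s @^-1` B] >>.

Definition stopping_time (T : Om -> \bar R) : Prop :=
  (forall w, 0 <= T w)%E /\
  forall t, 0 <= t -> natFplus t [set w | (T w <= t%:E)%E].

Definition stopped_sigma (T : Om -> \bar R) (A : set Om) : Prop :=
  natFinf A /\ forall t, 0 <= t -> natFplus t (A `&` [set w | (T w <= t%:E)%E]).

Definition strong_markov
    (K : R -> forall n, ('I_n -> R) -> ('I_n -> set \bar R) -> \bar R) : Prop :=
  forall T, stopping_time T ->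
  forall A, stopped_sigma T A ->
  A `<=` [set w | (T w < +oo)%E /\ (Y (fine (T w)) w < +oo)%E] ->
  forall n (ts : 'I_n -> R) (Bs : 'I_n -> set \bar R),
    (forall i, 0 <= ts i) -> (forall i, measurable (Bs i)) ->
    P (A `&` [set w | forall i, Bs i (Y (fine (T w) + ts i) w)])
    = (\int[P]_(w in A) K (fine (Y (fine (T w)) w)) n ts Bs)%E.

Definition entrance_process
    (K : R -> forall n, ('I_n -> R) -> ('I_n -> set \bar R) -> \bar R) : Prop :=
  (forall t, 0 <= t -> measurable_fun setT (Y t)) /\
  (forall t w, 0 <= t -> (0 <= Y t w)%E) /\
  (forall w, Y 0 w = +oo%E) /\
  (forall w, cadlag (fun t => Y t w)) /\
  (forall w e, 0 < e -> exists t, 0 < t < e /\ (Y t w < +oo)%E) /\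
  strong_markov K.

End Entrance.

Definition phi (gam : R) (Rr : R -> R) (b : R) : R :=
  fine (\int[lebesgue_measure]_(x in `[b, +oo[) ((Rr x)^-1)%:E)%E / gam.

Definition phiinv (ph : R -> R) (t : R) : R := xget 0 [set b | 0 < b /\ ph b = t].

Definition H1 (ph : R -> R) : Prop :=
  limf_esup (fun h : R => limf_einf (fun x : R => (ph (h * x) / ph x)%:E) (pinfty_nbhs R))
            (1^'+) = 1%E.

Definition H2 (ph : R -> R) : Prop :=
  forall h, 1 < h -> (1%E < limf_einf (fun x : R => (ph x / ph (h * x))%:E) (pinfty_nbhs R))%E.

Definition Vfun (Rr : R -> R) (z rho : R) : \bar R :=
  ereal_sup [set (Num.max (Rr x / Rr (x + rho * z) - 1) 0)%:E | x in [set x | z <= x]].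

Definition H3 (Rr : R -> R) : Prop :=
  exists delta, 0 < delta /\
    (forall rho, 0 < rho < delta -> cvg (Vfun Rr z rho @[z --> pinfty_nbhs R])) /\
    limf_esup (fun rho : R => lim (Vfun Rr z rho @[z --> pinfty_nbhs R])) (0^'+) = 0%E.

End Defs.

(* Main.v *)
(** Write [Z = x + L].  Since [Psi l = gam l + o(l)] at [0], [Z] drifts down at
    speed [gam] on large scales: Chebyshev's inequality for [exp (- L_s / m)]
    gives a law of large numbers for the marginals, and Ottaviani's inequality,
    used conditionally on the past, upgrades it to a maximal inequality.  Hence
    the mean occupation time of [[c, h c)] is at most about [(h - 1) c / gam],
    while after first passing below [h c] the path stays above [c] for about
    that long with high probability.  By (H3), [1 / R] is nearly constant on the
    blocks [[h^n b, h^(n+1) b)], so summing over blocks (with (H1) absorbing the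
    factors [h]) bounds the time spent by [X] above [b] from above in mean and
    from below pathwise, both by [(1 + o(1)) phi b]; thus it concentrates at
    [phi b], uniformly in large starting points.  The Markov property of [Y] at
    a deterministic time [s] much smaller than [t], when [Y_s] is finite and
    large, reduces the theorem to this, and (H2) turns the comparison of [t]
    with [phi b] into one of [phi^-1 t] with [b]. *)

Require Import Defs.
From HB Require Import structures.
From mathcomp Require Import all_boot all_order all_algebra.
From mathcomp Require Import all_classical all_reals all_analysis measurable_realfun.
From mathcomp Require Import ring lra zify.
Import Order.TTheory GRing.Theory Num.Theory.
Import numFieldNormedType.Exports.
Local Open Scope classical_set_scope.
Local Open Scope ring_scope.
Set Implicit Arguments.
Unset Strict Implicit.
Unset Printing Implicit Defensive.

(** * The past of a process with independent increments *)

(** Two obstacles shape the proof. [is_levy] gives the Laplace transform at time 1 only, so marginal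
    estimates are proved at rational times; paths are examined on dyadic grids or at integer steps,
    and right-continuity does the rest. Restarting at a random time is replaced by splitting over
    discrete times [k]: an event such as a first passage at [k] lies in the past of [k], and each
    maximal inequality is proved relative to an arbitrary past event. The absence of negative jumps
    enters through the finite moments of [expR (- (lam * L 1 w))], which keep the path from falling
    far between integer times. Concentration costs no second moment of the clock: if [S <= A]
    pathwise, the means of [S] and [A] nearly agree and [S] is nearly its own maximum, Markov's
    inequality alone puts [A] near that maximum. (H3) compares [Rr x] with [Rr y] only when [y - x]
    is not too small, so a block is compared with a shifted block and never with itself; this is the
    origin of the powers [h ^+ 2], [h ^+ 3] and [h ^+ 4]. *)

Lemma pi_lambda_indep (R : realType) d (Om : measurableType d) (Q : probability Om R)
    (G : set (set Om)) (D : set Om) :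
  setI_closed G -> G `<=` measurable -> measurable D ->
  (forall A, G A -> Q (A `&` D) = (Q A * Q D)%E) ->
  forall A, <<s G>> A -> Q (A `&` D) = (Q A * Q D)%E.
Proof.
move=> GI Gm mD GD.
pose H := [set A | measurable A /\ Q (A `&` D) = (Q A * Q D)%E].
suff: <<s G>> `<=` H by move=> h A /h[].
apply: lambda_system_subset => //; last by move=> A GA; split; [exact: Gm|exact: GD].
have finQ A : measurable A -> Q A \is a fin_num by move=> mA; exact: fin_num_measure.
split => //.
- by split => //; rewrite setTI probability_setT mul1e.
- move=> A B BA [mA QA] [mB QB]; split; first exact: measurableD.
  have -> : (A `\` B) `&` D = (A `&` D) `\` (B `&` D).
    apply/seteqP; split => w /=; first by move=> [[? nB] ?]; split=> // -[].
    by move=> [[? ?] nBD]; split => //; split => // ?; apply: nBD.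
  have mAD : measurable (A `&` D) by exact: measurableI.
  have mBD : measurable (B `&` D) by exact: measurableI.
  have -> : Q ((A `&` D) `\` (B `&` D)) = (Q (A `&` D) - Q (B `&` D))%E.
    by rewrite measureD//; [rewrite (setIidr (setSI BA))|rewrite ltey_eq finQ].
  have -> : Q (A `\` B) = (Q A - Q B)%E.
    by rewrite measureD//; [rewrite (setIidr BA)|rewrite ltey_eq finQ].
  by rewrite QA QB muleBl ?finQ// fin_num_adde_defl// fin_numN finQ.
- move=> F ndF HF; have mF i : measurable (F i) by have [] := HF i.
  have mU : measurable (\bigcup_i F i) by exact: bigcup_measurable.
  split => //.
  have c1 : Q \o (fun n => F n `&` D) @ \oo --> Q ((\bigcup_i F i) `&` D).
    rewrite setI_bigcupl; apply: nondecreasing_cvg_mu.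
    - by move=> i; exact: measurableI.
    - by apply: bigcup_measurable => i _; exact: measurableI.
    - move=> m n mn; apply/subsetPset; apply: setSI; apply/subsetPset; exact: ndF.
  have c2 : (fun n => Q (F n) * Q D)%E @ \oo --> (Q (\bigcup_i F i) * Q D)%E.
    by apply: cvgeZr; [exact: finQ|exact: nondecreasing_cvg_mu].
  apply: cvg_unique c1 _ => //.
  rewrite (_ : _ \o _ = (fun n => Q (F n) * Q D)%E)//.
  by apply/funext => n /=; have [] := HF n.
Qed.

Section past.
Context (R : realType) d (Om : measurableType d) (Q : probability Om R).
Context (L : R -> Om -> R) (Psi : R -> R).
Hypothesis HL : is_levy Q L Psi.

Definition past (a : R) : set (set Om) :=
  <<s [set A | exists (s : R) (B : set R),
        0 <= s <= a /\ measurable B /\ A = L s @^-1` B] >>.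

Lemma levy_measurable t : 0 <= t -> measurable_fun setT (L t).
Proof. by have [+ _] := HL; apply. Qed.

Lemma levy0 w : L 0 w = 0.
Proof. by have [_ [+ _]] := HL; apply. Qed.

Lemma measurable_incr a b : 0 <= a -> 0 <= b ->
  measurable_fun setT (fun w => L b w - L a w).
Proof.
by move=> a0 b0; apply: measurable_funB; exact: levy_measurable.
Qed.

Lemma measurable_incr_pre a b B : 0 <= a -> 0 <= b -> measurable B ->
  measurable ((fun w => L b w - L a w) @^-1` B).
Proof.
move=> a0 b0 mB; rewrite -[X in measurable X]setTI.
exact: measurable_incr.
Qed.

Lemma past_measurable a : past a `<=` measurable.
Proof.
apply: smallest_sub; first exact: sigma_algebra_measurable.
move=> _ [s [B [/andP[s0 _] [mB ->]]]].
by rewrite -[X in measurable X]setTI; apply: levy_measurable.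
Qed.

Lemma past_le a b : a <= b -> past a `<=` past b.
Proof.
move=> ab; rewrite /past; apply: smallest_sub; first exact: smallest_sigma_algebra.
move=> _ [s [B [/andP[s0 sa] [mB ->]]]]; apply: sub_sigma_algebra.
by exists s, B; split => //; rewrite s0 (le_trans sa).
Qed.

Lemma past_preimage a s B : 0 <= s <= a -> measurable B -> past a (L s @^-1` B).
Proof. by move=> sa mB; apply: sub_sigma_algebra; exists s, B. Qed.

Lemma past_sigma a : sigma_algebra setT (past a).
Proof. exact: smallest_sigma_algebra. Qed.

Lemma past0 a : past a set0. Proof. by have [] := past_sigma a. Qed.

Lemma pastC a A : past a A -> past a (~` A).
Proof. by have [_ + _] := past_sigma a; rewrite -setTD; apply. Qed.

Lemma pastT a : past a setT.
Proof. by rewrite -setC0; apply: pastC; exact: past0. Qed.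

Lemma past_bigcup a F : (forall i : nat, past a (F i)) -> past a (\bigcup_i F i).
Proof. by have [_ _ +] := past_sigma a; apply. Qed.

Lemma past_bigcap a F : (forall i : nat, past a (F i)) -> past a (\bigcap_i F i).
Proof.
by move=> h; rewrite -[X in past _ X]setCK setC_bigcap; apply: pastC; apply: past_bigcup => i; exact: pastC.
Qed.

Lemma pastU a A B : past a A -> past a B -> past a (A `|` B).
Proof.
move=> pA pB; rewrite -bigcup2E; apply: past_bigcup => -[|[|n]] //=; exact: past0.
Qed.

Lemma pastI a A B : past a A -> past a B -> past a (A `&` B).
Proof.
by move=> pA pB; rewrite -[X in past _ X]setCK setCI; apply: pastC; apply: pastU; exact: pastC.
Qed.

Lemma pastD a A B : past a A -> past a B -> past a (A `\` B).
Proof. by move=> pA pB; rewrite setDE; apply: pastI => //; exact: pastC. Qed.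

(** Definitional, but it presents [past a] as the measurable sets of a type, so that closure lemmas
    for measurable functions apply relative to the past. *)
Lemma measurable_past a (A : set Om) :
  past a A = @measurable _ (g_sigma_algebraType
    [set A : set Om | exists (s : R) (B : set R),
        0 <= s <= a /\ measurable B /\ A = L s @^-1` B]) A.
Proof. by []. Qed.

Lemma past_incr a s t B : 0 <= s <= a -> 0 <= t <= a -> measurable B ->
  past a ((fun w => L s w - L t w) @^-1` B).
Proof.
move=> sa ta mB; rewrite measurable_past -[X in measurable X]setTI.
apply: measurable_funB => //.
- by move=> _ C mC; rewrite setTI; exact: past_preimage.
- by move=> _ C mC; rewrite setTI; exact: past_preimage.
Qed.

Lemma incr_law a t B : 0 <= a -> 0 <= t -> measurable B ->
  Q ((fun w => L (a + t) w - L a w) @^-1` B) = Q (L t @^-1` B).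
Proof. by have [_ [_ [_ [_ [+ _]]]]] := HL; move=> h a0 t0 mB; exact: h. Qed.

Lemma bigcap_ord_recr n (F : nat -> set Om) :
  \bigcap_(i in [set: 'I_n.+1]) F i = \bigcap_(i in [set: 'I_n]) F i `&` F n.
Proof.
apply/seteqP; split => w.
  move=> h; split; last by apply: (h ord_max).
  by move=> i _; apply: (h (widen_ord (leqnSn n) i)).
move=> [h Fn] i _; have [ni|] := ltnP i n; first exact: (h (Ordinal ni)).
by move=> ni; have -> : nat_of_ord i = n by apply/eqP; rewrite eqn_leq ni -ltnS ltn_ord.
Qed.

Lemma indep_incr n (ts : nat -> R) (B : nat -> set R) :
  0 <= ts 0%N -> (forall i, ts i <= ts i.+1) -> (forall i, measurable (B i)) ->
  let X := fun i w => L (ts i.+1) w - L (ts i) w in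
  Q (\bigcap_(i in [set: 'I_n]) (X i @^-1` B i)) = (\prod_(i < n) Q (X i @^-1` B i))%E.
Proof.
move=> ts0 tsS mB X; have [_ [_ [_ [+ _]]]] := HL.
by move=> /(_ n ts ts0 tsS (fun i : 'I_n => B i)); apply => i; exact: mB.
Qed.

(** Because [ts 0 = 0] and [L 0 = 0], each [L (ts i)] is a sum of earlier increments, hence
    measurable for the sigma-algebra generated by the increment cylinders [G]. On [G] independence
    is the hypothesis on increments, and the pi-lambda theorem extends it. *)
Lemma indep_mono_grid n (ts : nat -> R) (B : nat -> set R) (C : set R) :
  ts 0%N = 0 -> (forall i, ts i <= ts i.+1) -> (forall i, measurable (B i)) ->
  measurable C ->
  let D := (fun w => L (ts n.+1) w - L (ts n) w) @^-1` C in
  Q ((\bigcap_(i in [set: 'I_n.+1]) (L (ts i) @^-1` B i)) `&` D) =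
  (Q (\bigcap_(i in [set: 'I_n.+1]) (L (ts i) @^-1` B i)) * Q D)%E.
Proof.
move=> ts0 tsS mB mC D.
have tsge0 i : 0 <= ts i by elim: i => [|i IH]; rewrite ?ts0// (le_trans IH).
pose X i w := L (ts i.+1) w - L (ts i) w.
have mX i E : measurable E -> measurable (X i @^-1` E).
  by move=> mE; exact: measurable_incr_pre.
have mcap (E : nat -> set R) : (forall i, measurable (E i)) ->
    measurable (\bigcap_(i in [set: 'I_n]) (X i @^-1` E i)).
  by move=> mE; apply: fin_bigcap_measurable => // i _; exact: mX.
pose G := [set A | exists E : nat -> set R, (forall i, measurable (E i)) /\
   A = \bigcap_(i in [set: 'I_n]) (X i @^-1` E i)].
apply: (@pi_lambda_indep _ _ _ _ G).
- move=> _ _ [E [mE ->]] [E' [mE' ->]].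
  exists (fun i => E i `&` E' i); split; first by move=> i; exact: measurableI.
  apply/seteqP; split => w /=.
    by move=> [h h'] i _; split; [exact: h|exact: h'].
  by move=> h; split => i _; have [] := h i I.
- by move=> _ [E [mE ->]]; exact: mcap.
- exact: measurable_incr_pre.
- move=> _ [E [mE ->]].
  (* [C] takes the last slot, so that independence of [n.+1] increments yields the product of the
     cylinder and [D]. *)
  pose E' i := if (i < n)%N then E i else C.
  pose E'' i := if (i < n)%N then E i else setT.
  have mE' i : measurable (E' i) by rewrite /E'; case: ifP.
  have mE'' i : measurable (E'' i) by rewrite /E''; case: ifP.
  have h1 F : (forall i : 'I_n, F i = E i) ->
     \bigcap_(i in [set: 'I_n]) (X i @^-1` F i) = \bigcap_(i in [set: 'I_n]) (X i @^-1` E i).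
    by move=> FE; apply: eq_bigcapr => i _; rewrite FE.
  have e' (i : 'I_n) : E' i = E i by rewrite /E' ltn_ord.
  have := @indep_incr n.+1 ts E' _ tsS mE'; rewrite ts0 => /(_ (lexx _)) /=.
  rewrite (bigcap_ord_recr _ (fun i => X i @^-1` E' i)) h1//.
  have -> : E' n = C by rewrite /E' ltnn.
  rewrite -/D => ->; rewrite big_ord_recr/=; congr (_ * _)%E; last first.
    by rewrite /E' ltnn.
  have := @indep_incr n ts E _ tsS mE; rewrite ts0 => /(_ (lexx _)) /= ->.
  by apply: eq_bigr => i _; rewrite e'.
- have pG i : (i <= n)%N -> measurable_fun setT (L (ts i) : g_sigma_algebraType G -> R).
    elim: i => [|i IH] lein.
      rewrite ts0 (_ : L 0 = cst 0); first exact: measurable_cst.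
      by apply/funext => w; exact: levy0.
    rewrite (_ : L _ = (L (ts i) \+ X i)); last by apply/funext => w; rewrite /X /= addrC subrK.
    apply: measurable_funD; first by apply: IH; exact: ltnW.
    move=> _ E mE; rewrite setTI; apply: sub_sigma_algebra.
    exists (fun j => if j == i then E else setT); split; first by move=> j; case: ifP.
    apply/seteqP; split => w /=.
      by move=> XE j _ /=; case: ifP => // /eqP ->.
    by move=> /(_ (Ordinal lein) I) /=; rewrite eqxx.
  have : @measurable _ (g_sigma_algebraType G) (\bigcap_(i in [set: 'I_n.+1]) (L (ts i) @^-1` B i)).
    apply: fin_bigcap_measurable => // i _; rewrite -[X in measurable X]setTI.
    by apply: pG => //; rewrite -ltnS.
  exact.
Qed.

(** Single-time preimages are not stable under intersection; finite cylinders are, so a pi-lambda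
    argument can start from them. *)
Lemma past_pi a : past a = <<s [set A | exists n (s : nat -> R) (B : nat -> set R),
   [/\ (forall i, 0 <= s i <= a), (forall i, measurable (B i)) &
       A = \bigcap_(i in [set: 'I_n]) (L (s i) @^-1` B i)]] >>.
Proof.
apply/seteqP; split; apply: smallest_sub; do ?exact: smallest_sigma_algebra.
- move=> _ [s [B [sa [mB ->]]]]; apply: sub_sigma_algebra.
  exists 1%N, (fun=> s), (fun=> B); split => //.
  apply/seteqP; split => w /=; first by move=> h i _.
  by move=> /(_ ord0 I).
- move=> _ [n [s [B [sa mB ->]]]].
  elim: n => [|n IH].
    rewrite (_ : \bigcap_(_ in _) _ = setT); first exact: pastT.
    by apply/seteqP; split => // w _ [].
  rewrite (bigcap_ord_recr _ (fun i => L (s i) @^-1` B i)); apply: pastI => //.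
  exact: past_preimage.
Qed.

Lemma past_indep (a b : R) (E : set Om) (C : set R) : 0 <= a <= b -> past a E -> measurable C ->
  Q (E `&` (fun w => L b w - L a w) @^-1` C) = (Q E * Q (L (b - a) @^-1` C))%E.
Proof.
move=> /andP[a0 ab] pE mC.
have -> : Q (L (b - a) @^-1` C) = Q ((fun w => L b w - L a w) @^-1` C).
  by rewrite -[in RHS](subrK a b) [b - a + a]addrC incr_law// subr_ge0.
have b0 : 0 <= b := le_trans a0 ab.
move: pE; rewrite past_pi; move: E; apply: pi_lambda_indep.
- move=> _ _ [n [s [B [sa mB ->]]]] [n' [s' [B' [sa' mB' ->]]]].
  exists (n + n')%N, (fun i => if (i < n)%N then s i else s' (i - n)%N),
    (fun i => if (i < n)%N then B i else B' (i - n)%N); split.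
  + by move=> i; case: ifP.
  + by move=> i; case: ifP.
  apply/seteqP; split => w /=.
    move=> [h h'] i _ /=; case: ifPn => [ni|]; first exact: (h (Ordinal ni) I).
    rewrite -leqNgt => ni; have hi : (i - n < n')%N by rewrite ltn_subLR// ltn_ord.
    exact: (h' (Ordinal hi) I).
  move=> h; split => i _.
    by have := h (lshift n' i) I; rewrite /= ltn_ord.
  by have := h (rshift n i) I; rewrite /= ltnNge leq_addr/= addKn.
- move=> _ [n [s [B [sa mB ->]]]]; apply: fin_bigcap_measurable => // i _.
  rewrite -[X in measurable X]setTI; apply: levy_measurable => //.
  by have /andP[] := sa i.
- exact: measurable_incr_pre.
- move=> _ [n [s [B [sa mB ->]]]].
  (* Time 0 is added because the increments are summed from [L 0 = 0]; sorting makes the grid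
     monotone. *)
  pose l : seq R := sort <=%R (0 :: mkseq s n).
  have sl : size l = n.+1 by rewrite size_sort/= size_mkseq.
  have la x : x \in l -> 0 <= x <= a.
    rewrite mem_sort in_cons => /orP[/eqP ->|/mapP[i _ ->]]; last exact: sa.
    by rewrite lexx a0.
  have sorted_l : sorted <=%R l by exact: sort_sorted (@le_total _ R) _.
  have l0 : 0 \in l by rewrite mem_sort inE eqxx.
  have ls (i : 'I_n) : s i \in l.
    rewrite mem_sort inE; apply/orP; right.
    by apply/mapP; exists (val i); rewrite ?mem_iota ?ltn_ord.
  clearbody l.
  pose t : seq R := l ++ [:: a].
  (* The default value [b] does double duty: [ts n.+2 = b] ends the last increment, and the sequence
     stays monotone beyond it. *)
  pose ts i := nth b t i.
  have st : size t = n.+2 by rewrite size_cat sl addn1.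
  have sorted_t : sorted <=%R t.
    rewrite /t; case: l sl la sorted_l l0 {ls t ts st} => [//|x l'] _ la /= pl _.
    rewrite cat_path pl /= andbT.
    by have /la/andP[] := mem_last x l'.
  have tb x : x \in t -> x <= b.
    rewrite mem_cat => /orP[/la/andP[_ xa]|]; first exact: le_trans xa ab.
    by rewrite inE => /eqP ->.
  have ts0 : ts 0%N = 0.
    rewrite /ts /t nth_cat sl /=.
    apply/eqP; rewrite eq_le; apply/andP; split; last first.
      by have /la/andP[] : nth b l 0 \in l by rewrite mem_nth ?sl.
    have /(nthP b)[j jl <-] := l0.
    by apply: (sorted_leq_nth le_trans lexx _ sorted_l) => //; rewrite inE sl.
  have tsS i : ts i <= ts i.+1.
    rewrite /ts; have [h|h] := ltnP i.+1 (size t).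
      by apply: (sorted_leq_nth le_trans lexx _ sorted_t) => //; rewrite inE// ltnW.
    rewrite (nth_default _ h); have [h'|h'] := ltnP i (size t).
      by apply: tb; rewrite mem_nth.
    by rewrite nth_default.
  have tsn : ts n.+1 = a by rewrite /ts /t nth_cat sl ltnn subnn.
  have tsn1 : ts n.+2 = b by rewrite /ts nth_default ?st.
  pose idx (i : 'I_n) := index (s i) t.
  have idxP (i : 'I_n) : (idx i < n.+2)%N /\ ts (idx i) = s i.
    have st' : s i \in t by rewrite mem_cat ls.
    by split; [rewrite -st index_mem|rewrite /ts nth_index].
  (* Equal times share an index, so their constraints are intersected; a grid time without
     constraint gets the full set. *)
  pose B' k := \bigcap_(i in [set i : 'I_n | idx i = k]) B i.
  have mB' k : measurable (B' k).
    by apply: fin_bigcap_measurable => // i _; exact: mB.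
  have -> : \bigcap_(i in [set: 'I_n]) (L (s i) @^-1` B i) =
       \bigcap_(k in [set: 'I_n.+2]) (L (ts k) @^-1` B' k).
    apply/seteqP; split => w /=.
      by move=> h k _ i /= ik; rewrite -ik (idxP i).2; exact: (h i I).
    move=> h i _; have [ik e] := idxP i.
    by have := h (Ordinal ik) I i erefl; rewrite /= e.
  have := @indep_mono_grid n.+1 ts B' C ts0 tsS mB' mC; rewrite /= tsn tsn1; exact.
Qed.

End past.

(** * Laplace transforms and the law of large numbers for the marginals *)

Section expectation.
Context (R : realType) d (Om : measurableType d) (Q : probability Om R).

Lemma markov_ge0 (f : Om -> \bar R) (a : R) : measurable_fun setT f ->
  (forall w, 0 <= f w)%E -> 0 <= a ->
  (a%:E * Q [set w | a%:E <= f w] <= \int[Q]_w f w)%E.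
Proof.
move=> mf f0 a0; set A := [set w | _].
have mA : measurable A.
  by rewrite /A -[X in measurable X]setTI; apply: emeasurable_fun_c_infty.
rewrite -(setIT A) -integral_indic// -ge0_integralZl_EFin//; last first.
  by apply/measurable_EFinP; exact: measurable_indic.
apply: ge0_le_integral => //.
- by move=> w _; rewrite mule_ge0// lee_fin.
- by apply: measurable_funeM; apply/measurable_EFinP; exact: measurable_indic.
- move=> w _; rewrite indicE; case: (boolP (w \in A)); rewrite ?mule1 ?mule0//.
  by rewrite inE.
Qed.

(** By uniqueness of the product measure, the hypothesis on rectangles says that the joint law is
    the product of the marginals; Tonelli's theorem then applies. *)
Lemma ge0_expectation_indepM (X Y : Om -> R) (f g : R -> R) :
  measurable_fun setT X -> measurable_fun setT Y ->
  (forall A B, measurable A -> measurable B ->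
    Q ((X @^-1` A) `&` (Y @^-1` B)) = (Q (X @^-1` A) * Q (Y @^-1` B))%E) ->
  measurable_fun setT f -> measurable_fun setT g ->
  (forall x, 0 <= f x) -> (forall x, 0 <= g x) ->
  (\int[Q]_w (f (X w) * g (Y w))%:E =
   \int[Q]_w (f (X w))%:E * \int[Q]_w (g (Y w))%:E)%E.
Proof.
move=> mX mY XY mf mg f0 g0.
pose X' : {mfun Om >-> R} := HB.pack X (isMeasurableFun.Build _ _ _ _ X mX).
pose Y' : {mfun Om >-> R} := HB.pack Y (isMeasurableFun.Build _ _ _ _ Y mY).
have mXY : measurable_fun setT (fun w => (X w, Y w)) by exact: measurable_fun_pair.
pose XY' : {mfun Om >-> (R * R)%type} := HB.pack (fun w => (X w, Y w))
  (isMeasurableFun.Build _ _ _ _ _ mXY).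
pose h (z : R * R) : \bar R := (f z.1 * g z.2)%:E.
have mh : measurable_fun setT h.
  apply/measurable_EFinP; apply: measurable_funM.
    by apply: measurableT_comp => //; exact: measurable_fst.
  by apply: measurableT_comp => //; exact: measurable_snd.
have h0 z : (0 <= h z)%E by rewrite lee_fin mulr_ge0.
have <- : (\int[distribution Q XY']_z h z = \int[Q]_w (f (X w) * g (Y w))%:E)%E.
  by rewrite ge0_integral_distribution.
have mef : measurable_fun setT (EFin \o f) by exact/measurable_EFinP.
have meg : measurable_fun setT (EFin \o g) by exact/measurable_EFinP.
have -> : (\int[Q]_w (f (X w))%:E = \int[distribution Q X']_x (f x)%:E)%E.
  by rewrite ge0_integral_distribution// => y; rewrite lee_fin.
have -> : (\int[Q]_w (g (Y w))%:E = \int[distribution Q Y']_x (g x)%:E)%E.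
  by rewrite ge0_integral_distribution// => y; rewrite lee_fin.
transitivity (\int[distribution Q X' \x distribution Q Y']_z h z)%E.
  apply: eq_measure_integral => A mA _; apply/esym.
  by apply: product_measure_unique => // B C mB mC; rewrite -XY.
rewrite fubini_tonelli1// /fubini_F/=.
under eq_integral => x _.
  rewrite (_ : (\int[_]_y _) = (f x)%:E * \int[distribution Q Y']_y (g y)%:E)%E; last first.
    rewrite -ge0_integralZl_EFin//.
    by move=> y _; rewrite lee_fin.
  rewrite muleC; over.
rewrite ge0_integralZl//; last 2 first.
- by move=> x _; rewrite lee_fin.
- by apply: integral_ge0 => y _; rewrite lee_fin.
by rewrite muleC.
Qed.

End expectation.

Lemma expey (R : realType) n : (+oo ^+ n.+1 = +oo :> \bar R)%E.
Proof. by elim: n => [|n IH]; rewrite ?expe1// expeS IH mulyy. Qed.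

Section measurable_sets.
Context (R : realType) d (Om : measurableType d) (f : Om -> R).
Hypothesis mf : measurable_fun setT f.

Let mpre (i : interval R) : measurable (f @^-1` [set` i]).
Proof. by rewrite -[X in measurable X]setTI; apply: mf => //; exact: measurable_itv. Qed.

Lemma measurable_set_lt (c : R) : measurable [set w | f w < c].
Proof. by have := mpre `]-oo, c[; rewrite set_itvE. Qed.

Lemma measurable_set_le (c : R) : measurable [set w | f w <= c].
Proof. by have := mpre `]-oo, c]; rewrite set_itvE. Qed.

Lemma measurable_set_gt (c : R) : measurable [set w | c < f w].
Proof. by have := mpre `]c, +oo[; rewrite set_itvE. Qed.

Lemma measurable_set_ge (c : R) : measurable [set w | c <= f w].
Proof. by have := mpre `[c, +oo[; rewrite set_itvE. Qed.

End measurable_sets.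

(** The logarithm has slope at most 2 on [[1/2, 3/2]]. This turns a relative deviation of an
    exponential into a deviation of its exponent. *)
Lemma expR_sub1_small (R : realType) (x e : R) :
  0 <= e <= 2^-1 -> `|expR x - 1| < e -> `|x| <= 2 * e.
Proof.
move=> /andP[e0 e2]; rewrite ltr_norml => /andP[h1 h2].
have := expR_ge1Dx x; have := expR_ge1Dx (- x); have := expR_gt0 x.
have := expR_gt0 (- x).
have : expR (- x) * expR x = 1 by rewrite expRN mulVf// gt_eqF// expR_gt0.
rewrite ler_norml; set a := expR x in h1 h2 *; set b := expR (- x).
move=> ab b0 a0 hb ha; apply/andP; split; last by lra.
suff : b <= 1 + 2 * e by lra.
suff : b * (1 - e) <= (1 + 2 * e) * (1 - e) by rewrite ler_pM2r//; lra.
have : b * (1 - e) <= b * a by rewrite ler_pM2l//; lra.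
rewrite ab; move/le_trans; apply; nra.
Qed.

(** What the law of large numbers uses of the Laplace exponent: it lies above its tangent at 0, and
    [Psi lam - gam * lam = o(lam)], written along [th / m]. The range [th <= 2] covers the arguments
    [1 / m] and [2 / m] of a second-moment bound. *)
Definition asymptotic_slope (R : realType) (Psi : R -> R) (gam : R) : Prop :=
  (forall lam, 0 <= lam -> 0 <= Psi lam - gam * lam) /\
  (forall th, 0 <= th <= 2 -> forall eps, 0 < eps -> exists m0, forall m, (m0 <= m)%N ->
    m%:R * (Psi (th / m%:R) - gam * (th / m%:R)) <= eps).

Section laplace.
Context (R : realType) d (Om : measurableType d) (Q : probability Om R).
Context (L : R -> Om -> R) (Psi : R -> R) (gam : R).
Hypothesis HL : is_levy Q L Psi.

Definition lap (lam t : R) : \bar R := (\int[Q]_w (expR (- (lam * L t w)))%:E)%E.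

Lemma measurable_expL lam : measurable_fun setT (fun x : R => expR (- (lam * x))).
Proof.
apply: measurableT_comp => //; apply: measurableT_comp => //.
Qed.

Lemma lap_ge0 lam t : (0 <= lap lam t)%E.
Proof. by apply: integral_ge0 => w _; rewrite lee_fin expR_ge0. Qed.

Lemma lapD (lam s t : R) : 0 <= s -> 0 <= t ->
  lap lam (s + t) = (lap lam s * lap lam t)%E.
Proof.
move=> s0 t0.
have mLs := levy_measurable HL s0; have mLt := levy_measurable HL t0.
have mD := measurable_incr HL s0 (addr_ge0 s0 t0).
have me := measurable_expL lam.
have e0 x : 0 <= expR (- (lam * x)) by exact: expR_ge0.
have -> : lap lam t = (\int[Q]_w (expR (- (lam * (L (s + t) w - L s w))))%:E)%E.
  pose X' : {mfun Om >-> R} := HB.pack (L t) (isMeasurableFun.Build _ _ _ _ _ mLt).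
  pose Y' : {mfun Om >-> R} := HB.pack (fun w => L (s + t) w - L s w) (isMeasurableFun.Build _ _ _ _ _ mD).
  pose f (x : R) : \bar R := (expR (- (lam * x)))%:E.
  have mf : measurable_fun setT f by exact/measurable_EFinP.
  transitivity (\int[distribution Q X']_x f x)%E.
    by rewrite ge0_integral_distribution// => y; rewrite lee_fin.
  transitivity (\int[distribution Q Y']_x f x)%E.
    by apply: eq_measure_integral => A mA _; rewrite /= /distribution /pushforward /= (incr_law HL).
  by rewrite ge0_integral_distribution// => y; rewrite lee_fin.
rewrite -(@ge0_expectation_indepM _ _ _ Q (L s) (fun w => L (s + t) w - L s w)
  (fun x => expR (- (lam * x))) (fun x => expR (- (lam * x))))//.
  by apply: eq_integral => w _; rewrite -expRD -opprD -mulrDr addrCA subrr addr0.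
move=> A B mA mB.
have pA : past L s (L s @^-1` A) by apply: past_preimage => //; rewrite s0 lexx.
have sst : 0 <= s <= s + t by rewrite s0 lerDl.
by rewrite (past_indep HL sst)// addrAC subrr add0r (incr_law HL).
Qed.

Lemma lapM (lam t : R) n : 0 <= t -> lap lam (n%:R * t) = (lap lam t ^+ n)%E.
Proof.
move=> t0; elim: n => [|n IH].
  rewrite mul0r /lap; under eq_integral do rewrite (levy0 HL) mulr0 oppr0 expR0.
  rewrite expe0 (integral_cst _ measurableT) mul1e; exact: probability_setT.
rewrite -natr1 mulrDl mul1r lapD//; last by rewrite mulr_ge0.
by rewrite IH expeS muleC.
Qed.

Lemma lap1 lam : 0 <= lam -> lap lam 1 = (expR (Psi lam))%:E.
Proof. by have [_ [_ [_ [_ [_ +]]]]] := HL; apply. Qed.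

(** The transform is known at time 1; multiplicativity and uniqueness of nonnegative roots give it
    at [1 / N], then at [k / N]. An infinite value at [1 / N] is excluded because its powers would
    be infinite. *)
Lemma lap_rat (lam : R) k N : 0 <= lam ->
  lap lam (k%:R / N.+1%:R) = (expR (k%:R / N.+1%:R * Psi lam))%:E.
Proof.
move=> l0; have N0 : 0 < N.+1%:R :> R by [].
have iN0 : 0 <= N.+1%:R^-1 :> R by rewrite invr_ge0.
have e1 : lap lam (N.+1%:R^-1) = (expR (N.+1%:R^-1 * Psi lam))%:E.
  have := lap1 l0; rewrite -[X in lap _ X](@mulfV _ N.+1%:R) ?gt_eqF//.
  rewrite lapM//; have := lap_ge0 lam N.+1%:R^-1.
  case: (lap lam _) => [r r0|_|//]; last by rewrite expey.
  rewrite -EFin_expe => -[] h; congr EFin.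
  apply/(@pexpIrn _ N.+1) => //; rewrite ?nnegrE ?expR_ge0//.
  by rewrite h -expRM_natl mulrA mulfV ?mul1r// gt_eqF.
by rewrite lapM// e1 -EFin_expe -expRM_natl mulrA.
Qed.

(** Chebyshev's inequality for the exponential martingale [expR (- lam * L s - s * Psi lam)], which
    has mean 1 and variance [expR (s * (Psi (2 * lam) - 2 * Psi lam)) - 1]. *)
Lemma chebyshev_exp (lam : R) k N (eta s : R) : 0 <= lam -> 0 < eta ->
  s = k%:R / N.+1%:R ->
  (Q [set w | (eta <= `|expR (- (lam * L s w) - s * Psi lam) - 1|)%R] <=
   ((expR (s * (Psi (2 * lam) - 2 * Psi lam)) - 1) / eta ^+ 2)%:E)%E.
Proof.
move=> l0 eta0 sE; have s0 : 0 <= s by rewrite sE divr_ge0.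
have mLs := levy_measurable HL s0.
pose N1 w := expR (- (lam * L s w) - s * Psi lam).
have mN1 : measurable_fun setT N1.
  rewrite (_ : N1 = (fun w => expR (- (lam * L s w)) * expR (- (s * Psi lam)))).
    apply: measurable_funM => //.
    exact: (measurableT_comp (measurable_expL lam)).
  by apply/funext => w; rewrite -expRD.
have EN1 : (\int[Q]_w (N1 w)%:E = 1)%E.
  under eq_integral do rewrite /N1 expRD mulrC EFinM.
  rewrite ge0_integralZl_EFin ?expR_ge0//; last first.
    by apply/measurable_EFinP; exact: (measurableT_comp (measurable_expL lam)).
  by have := lap_rat k N l0; rewrite /lap -sE => ->; rewrite -EFinM -expRD addNr expR0.
have EN2 : (\int[Q]_w (N1 w ^+ 2)%:E = (expR (s * (Psi (2 * lam) - 2 * Psi lam)))%:E)%E.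
  under eq_integral => w _.
    rewrite /N1 -expRM_natl (_ : 2 * _ = - (s * (2 * Psi lam)) + (- ((2 * lam) * L s w))); last by ring.
    rewrite expRD EFinM; over.
  rewrite ge0_integralZl_EFin ?expR_ge0//; last first.
    by apply/measurable_EFinP; exact: (measurableT_comp (measurable_expL (2 * lam))).
  have l20 : 0 <= 2 * lam by rewrite mulr_ge0.
  have := lap_rat k N l20; rewrite /lap -sE => ->; rewrite -EFinM -expRD.
  by congr (expR _)%:E; ring.
have m1 : measurable_fun setT (fun w => ((N1 w - 1) ^+ 2)%:E).
  by apply/measurable_EFinP; apply: measurable_funX; exact: measurable_funB.
(* The expansion of the square is arranged as [(N - 1)^2 + 2 N = N^2 + 1], so that only nonnegative
   integrals are added. *)
have : (\int[Q]_w ((N1 w - 1) ^+ 2)%:E + 2%:E * \int[Q]_w (N1 w)%:E =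
        \int[Q]_w (N1 w ^+ 2)%:E + \int[Q]_w (cst 1%:E) w)%E.
  rewrite -ge0_integralZl_EFin//; last 2 first.
  - by move=> w _; rewrite lee_fin expR_ge0.
  - exact/measurable_EFinP.
  rewrite -ge0_integralD//; last 3 first.
  - by move=> w _; rewrite lee_fin sqr_ge0.
  - by move=> w _; rewrite -EFinM lee_fin mulr_ge0// expR_ge0.
  - by apply: measurable_funeM; exact/measurable_EFinP.
  rewrite -ge0_integralD//; last 2 first.
  - by move=> w _; rewrite lee_fin sqr_ge0.
  - by apply/measurable_EFinP; exact: measurable_funX.
  by apply: eq_integral => w _; rewrite -EFinM -!EFinD; congr EFin; ring.
have E1 : (\int[Q]_w (cst 1%:E) w = 1)%E.
  by rewrite (integral_cst Q measurableT) mul1e; exact: probability_setT.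
rewrite EN1 EN2 E1 mule1.
have := @markov_ge0 _ _ _ Q (fun w => ((N1 w - 1) ^+ 2)%:E) (eta ^+ 2) m1.
have fq : Q [set w | eta <= `|N1 w - 1|] \is a fin_num.
  apply: fin_num_measure; apply: measurable_set_ge; apply: measurableT_comp => //.
  exact: measurable_funB.
have -> : [set w | (eta ^+ 2)%:E <= ((N1 w - 1) ^+ 2)%:E]%E = [set w | eta <= `|N1 w - 1|].
  apply/seteqP; split => w /=; rewrite lee_fin -[(N1 w - 1) ^+ 2]real_normK ?num_real//;
    by rewrite ler_pXn2r// ?nnegrE ?normr_ge0 ?ltW.
move=> /(_ (fun w => _) (sqr_ge0 _)).
set I := integral _ _ _ => hM hI.
have {}hM := hM (fun w => (sqr_ge0 (N1 w - 1) : (0 <= ((N1 w - 1) ^+ 2)%:E)%E)).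
rewrite -(fineK fq) in hM *; case: I hI hM => [i|//|//] [] hi.
rewrite -EFinM !lee_fin => hM; rewrite ler_pdivlMr ?exprn_gt0// mulrC.
by rewrite (le_trans hM)//; lra.
Qed.

Lemma exp_left_tail (y : R) : (Q [set w | (L 1 w < - y)%R] <= (expR (Psi 1 - y))%:E)%E.
Proof.
have mL := levy_measurable HL ler01.
have := @markov_ge0 _ _ _ Q (fun w => (expR (- (1 * L 1 w)))%:E) (expR y).
have -> : (\int[Q]_w (expR (- (1 * L 1 w)))%:E)%E = (expR (Psi 1))%:E by exact: (lap1 ler01).
have mf : measurable_fun setT (fun w => (expR (- (1 * L 1 w)))%:E).
  by apply/measurable_EFinP; exact: (measurableT_comp (measurable_expL 1)).
move=> /(_ mf (fun w => _) (expR_ge0 _)) h.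
have {}h := h (fun w => (expR_ge0 (- (1 * L 1 w)) : (0 <= (expR (- (1 * L 1 w)))%:E)%E)).
have mA : measurable [set w | (L 1 w < - y)%R].
  exact: measurable_set_lt.
have mB : measurable [set w | ((expR y)%:E <= (expR (- (1 * L 1 w)))%:E)%E].
  by rewrite -[X in measurable X]setTI; apply: emeasurable_fun_c_infty.
apply: (@le_trans _ _ (Q [set w | ((expR y)%:E <= (expR (- (1 * L 1 w)))%:E)%E])).
  by apply: le_measure; rewrite ?inE// => w /= h1; rewrite lee_fin ler_expR; lra.
have fq := @fin_num_measure _ _ _ Q _ mB.
rewrite -(fineK fq) in h *; move: h; rewrite -EFinM !lee_fin => h.
by rewrite expRD expRN ler_pdivlMr ?expR_gt0// mulrC.
Qed.

Hypothesis Psi_slope : asymptotic_slope Psi gam.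

(** With [lam = 1 / m], the exponent of the martingale is [- (L s + gam * s) / m] up to the error
    [s * (Psi lam - gam * lam)], so a deviation of [L s + gam * s] of order [m] becomes one of order
    1. One [m0] serves all rational times up to [m]. *)
Lemma marginal_lln (eps del : R) : 0 < eps -> 0 < del ->
  exists m0, forall m, (m0 <= m)%N -> forall k N (s : R), s = k%:R / N.+1%:R ->
    s <= m%:R -> (Q [set w | (eps * m%:R < `|L s w + gam * s|)%R] <= del%:E)%E.
Proof.
have [Psi_ge Psi_lim] := Psi_slope.
(* Half of [eps] pays for the exponent, at most [2 * eta], and half for the error [s * e1]. The
   bound [ln (1 + del * eta ^+ 2)] imposed on [m * e2] makes the variance at most
   [del * eta ^+ 2]. *)
move=> eps0 del0; pose eta := Num.min (eps / 4) (2^-1).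
have eta0 : 0 < eta by rewrite lt_min divr_gt0//= invr_gt0.
have [eta2 eta4] : eta <= 2^-1 /\ eta <= eps / 4.
  by split; rewrite ge_min lexx ?orbT.
have de : 0 < 1 + del * eta ^+ 2 by rewrite addr_gt0// mulr_gt0// exprn_gt0.
have x0 : 0 < ln (1 + del * eta ^+ 2).
  by rewrite ln_gt0// ltrDl mulr_gt0// exprn_gt0.
have h01 : 0 <= (1 : R) <= 2 by lra.
have h02 : 0 <= (2 : R) <= 2 by lra.
have [m1 Hm1] := Psi_lim _ h01 _ (divr_gt0 eps0 (ltr0Sn R 1)).
have [m2 Hm2] := Psi_lim _ h02 _ x0.
exists (maxn 1 (maxn m1 m2)) => m; rewrite !geq_max => /andP[m_gt0 /andP[m1m m2m]] k N s sE sm.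
have s0 : 0 <= s by rewrite sE divr_ge0.
have M0 : 0 < m%:R :> R by rewrite ltr0n.
move: {Hm1 Hm2}(Hm1 _ m1m) (Hm2 _ m2m) => H1 H2.
set lam := 1 / m%:R in H1; have lam0 : 0 <= lam by rewrite divr_ge0.
have lamM : lam * m%:R = 1 by rewrite /lam mul1r mulVf// gt_eqF.
have l2 : 2 / m%:R = 2 * lam by rewrite /lam mul1r.
rewrite {}l2 in H2.
have E1 := Psi_ge _ lam0; have E2 : 0 <= Psi (2 * lam) - gam * (2 * lam) by apply: Psi_ge; rewrite mulr_ge0.
set e1 := Psi lam - _ in H1 E1; set e2 := Psi (2 * lam) - _ in H2 E2.
apply: (@le_trans _ _ (Q [set w | (eta <= `|expR (- (lam * L s w) - s * Psi lam) - 1|)%R])).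
  have mL := levy_measurable HL s0.
  apply: le_measure; rewrite ?inE.
  - apply: measurable_set_gt; apply: measurableT_comp => //.
    exact: measurable_funD.
  - apply: measurable_set_ge; apply: measurableT_comp => //.
    apply: measurable_funB => //; apply: measurableT_comp => //.
    apply: measurable_funB => //; apply: measurableT_comp => //.
    exact: measurable_funM.
  - move=> w /= h; rewrite leNgt; apply/negP => /(expR_sub1_small _).
    rewrite (ltW eta0) eta2 => /(_ isT) => hy.
    move: h; rewrite ltNge => /negP; apply.
    have -> : L s w + gam * s = - ((- (lam * L s w) - s * Psi lam) + s * e1) * m%:R.
      transitivity ((L s w + gam * s) * (lam * m%:R)); first by rewrite lamM mulr1.
      by rewrite /e1; ring.
    rewrite normrM normrN (ger0_norm (ltW M0)) ler_pM2r//.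
    apply: (le_trans (ler_normD _ _)).
    have -> : `|s * e1| = s * e1 by rewrite ger0_norm// mulr_ge0.
    have : s * e1 <= m%:R * e1 by rewrite ler_wpM2r.
    by lra.
apply: (le_trans (chebyshev_exp lam0 eta0 sE)); rewrite lee_fin.
rewrite ler_pdivrMr ?exprn_gt0// lerBlDl -[leRHS]lnK ?posrE// ler_expR.
apply: le_trans H2.
have -> : Psi (2 * lam) - 2 * Psi lam = e2 - 2 * e1 by rewrite /e1 /e2; ring.
apply: (@le_trans _ _ (s * e2)); first by rewrite ler_wpM2l//; lra.
by rewrite ler_wpM2r.
Qed.

End laplace.

(** * Slope of the Laplace exponent at zero *)

Section lapexp.
Context (R : realType) (gam sig : R) (pi : {measure set R -> \bar R}).
Hypothesis Hpi : levy_measure_cond pi.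

Lemma expRN_sub1D_bound (u : R) : 0 <= u ->
  0 <= expR (- u) - 1 + u <= Num.min u (u ^+ 2).
Proof.
move=> u0; have h1 := expR_ge1Dx u; have h2 := expR_ge1Dx (- u).
have h3 : expR (- u) * expR u = 1 by rewrite expRN mulVf// gt_eqF// expR_gt0.
have h4 := expR_gt0 (- u).
set a := expR (- u) in h2 h3 h4 *; set b := expR u in h1 h3.
have h5 : a * (1 + u) <= a * b by rewrite ler_pM2l.
rewrite h3 in h5.
apply/andP; split; first by lra.
rewrite le_min; apply/andP; split; nra.
Qed.

Let g (lam z : R) := expR (- (lam * z)) - 1 + lam * z.

Let mg lam : measurable_fun setT (g lam).
Proof.
apply: measurable_funD; last exact: measurable_funM.
apply: measurable_funB => //; apply: measurableT_comp => //.
by apply: measurableT_comp => //; exact: measurable_funM.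
Qed.

Let g0 lam z : 0 <= lam -> 0 < z -> 0 <= g lam z.
Proof.
move=> l0 z0; by have /andP[] := @expRN_sub1D_bound (lam * z) (mulr_ge0 l0 (ltW z0)).
Qed.

Lemma lapexp_ge lam : 0 <= lam -> 0 <= lapexp gam sig pi lam - gam * lam.
Proof.
move=> l0; rewrite /lapexp; set I := fine _.
rewrite (_ : _ - _ = sig ^+ 2 / 2 * lam ^+ 2 + I); last by ring.
rewrite addr_ge0//.
  by rewrite mulr_ge0 ?sqr_ge0// divr_ge0 ?sqr_ge0.
apply: fine_ge0; apply: integral_ge0 => z /=; rewrite in_itv /= andbT => z0.
by rewrite lee_fin; exact: g0.
Qed.

Lemma lapexp_lim (th : R) : 0 <= th <= 2 -> forall eps : R, 0 < eps ->
  exists m0, forall m, (m0 <= m)%N ->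
    m%:R * (lapexp gam sig pi (th / m%:R) - gam * (th / m%:R)) <= eps.
Proof.
move=> /andP[th0 th2] eps eps0.
have mD : measurable (`]0, +oo[ : set R) by [].
pose f_ n (z : R) : \bar R := (n%:R * g (th / n%:R) z)%:E.
(* The factor 4 dominates both [th] and [th ^+ 2] for [th <= 2], so dominated convergence applies
   with the integrable [min z (z ^+ 2)]. *)
pose G (z : R) : \bar R := (4 * Num.min z (z ^+ 2))%:E.
have mmin : measurable_fun setT (fun z : R => Num.min z (z ^+ 2)).
  by apply: measurable_minr => //; exact: measurable_funX.
have fG n z : 0 < z -> (0 <= f_ n z <= G z)%E.
  move=> z0; rewrite /f_ /G !lee_fin mulr_ge0 ?g0 ?divr_ge0//=.
  case: n => [|n]; first by rewrite mul0r mulr_ge0// le_min ltW// sqr_ge0.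
  have N1 : 1 <= n.+1%:R :> R by rewrite ler1n.
  have u0 : 0 <= th / n.+1%:R * z by rewrite mulr_ge0 ?divr_ge0// ltW.
  have /andP[_] := expRN_sub1D_bound u0; rewrite le_min => /andP[].
  rewrite -/(g _ _); set x := g _ _; set u := _ * z in u0 * => xu xu2.
  have uE : n.+1%:R * u = th * z by rewrite /u mulrA mulrCA divff ?mulr1// pnatr_eq0.
  have h1 : n.+1%:R * x <= th * z by rewrite -uE ler_pM2l// (lt_le_trans _ N1).
  have h2 : n.+1%:R * x <= th * z * (th * z).
    apply: (@le_trans _ _ (n.+1%:R * u ^+ 2)); first by rewrite ler_pM2l// (lt_le_trans _ N1).
    by rewrite -uE expr2; have := mulr_ge0 u0 u0; nra.
  have h3 : th * z <= 4 * z by rewrite ler_pM2r//; lra.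
  have h4 : th * z * (th * z) <= 4 * z ^+ 2.
    by rewrite -expr2 exprMn ler_pM2r ?exprn_gt0//; nra.
  rewrite minr_pMr// le_min; apply/andP; split; [exact: le_trans h3|exact: le_trans h4].
have iG : pi.-integrable `]0, +oo[ G.
  apply/integrableP; split.
    by apply/measurable_EFinP; apply: measurable_funTS; exact: measurable_funM.
  rewrite (eq_integral (fun z : R => 4%:E * (Num.min z (z ^+ 2))%:E)%E); last first.
    move=> z; rewrite inE /= in_itv /= andbT => z0.
    by rewrite /= ger0_norm ?EFinM// mulr_ge0// le_min ltW// sqr_ge0.
  rewrite ge0_integralZl_EFin//; last 2 first.
  - by move=> z /=; rewrite in_itv /= andbT => z0; rewrite lee_fin le_min ltW// sqr_ge0.
  - by apply/measurable_EFinP; exact: measurable_funTS.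
  by apply: lte_mul_pinfty => //; have [] := Hpi.
have [] := @dominated_convergence _ _ _ pi `]0, +oo[ mD f_ (cst 0%E) G.
- by move=> n; apply/measurable_EFinP; apply: measurable_funTS; exact: measurable_funM.
- exact: measurable_cst.
- apply: aeW => z /=; rewrite in_itv /= andbT => z0.
  apply/fine_cvgP; split; first by near=> n.
  apply/cvgrPdist_le => e e0; near=> n.
  rewrite /= sub0r normrN ger0_norm; last by have /andP[] := fG n z z0; rewrite lee_fin.
  have n0 : 0 < n%:R :> R by near: n; exact: nbhs_infty_gtr.
  have /andP[_] := @expRN_sub1D_bound (th / n%:R * z) (mulr_ge0 (divr_ge0 th0 (ltW n0)) (ltW z0)).
  rewrite le_min => /andP[_ h].
  apply: (@le_trans _ _ (n%:R * (th / n%:R * z) ^+ 2)); first by rewrite ler_pM2l.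
  rewrite (_ : _ * _ = (th * z) ^+ 2 / n%:R); last by field; rewrite gt_eqF.
  rewrite ler_pdivrMr// [e * _]mulrC -ler_pdivrMr//.
  by near: n; exact: nbhs_infty_ger.
- exact: iG.
- apply: aeW => z n /=; rewrite in_itv /= andbT => z0.
  have /andP[h1 h2] := fG n z z0; rewrite lee_fin in h1.
  by rewrite ger0_norm.
move=> _ _; rewrite integral0 => /fine_cvgP[_ cv].
have /cvgrPdist_le/(_ _ (divr_gt0 eps0 (ltr0Sn R 1))) [m1 _ H1] := cv.
have [m2 Hm2] : exists m2 : nat, forall m, (m2 <= m)%N -> sig ^+ 2 / 2 * th ^+ 2 <= eps / 2 * m%:R.
  exists (Num.bound (sig ^+ 2 / 2 * th ^+ 2 / (eps / 2))).+1 => m hm.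
  rewrite [eps / 2 * _]mulrC -ler_pdivrMr ?divr_gt0//.
  have h0 : 0 <= sig ^+ 2 / 2 * th ^+ 2 / (eps / 2).
    by apply: divr_ge0; [rewrite mulr_ge0 ?divr_ge0 ?sqr_ge0|lra].
  by apply: (le_trans (ltW (archi_boundP h0))); rewrite ler_nat ltnW.
exists (maxn 1 (maxn m1 m2)) => m; rewrite !geq_max => /andP[m_gt0 /andP[m1m m2m]].
have M0 : 0 < m%:R :> R by rewrite ltr0n.
have -> : lapexp gam sig pi (th / m%:R) - gam * (th / m%:R) =
   sig ^+ 2 / 2 * (th / m%:R) ^+ 2 + fine (\int[pi]_(z in `]0%R, +oo[) (g (th / m%:R) z)%:E)%E.
  by rewrite /lapexp; lra.
rewrite mulrDr; have -> : eps = eps / 2 + eps / 2 by lra.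
apply: lerD.
  rewrite (_ : _ * _ = sig ^+ 2 / 2 * th ^+ 2 / m%:R); last by field; rewrite gt_eqF.
  by rewrite ler_pdivrMr// Hm2.
have := H1 m m1m; rewrite /= sub0r normrN.
have -> : (\int[pi]_(z in `]0%R, +oo[) f_ m z = m%:R%:E * \int[pi]_(z in `]0%R, +oo[) (g (th / m%:R) z)%:E)%E.
  rewrite -ge0_integralZl_EFin//.
  - by move=> z /=; rewrite in_itv /= andbT => z0; rewrite lee_fin g0// divr_ge0.
  - by apply/measurable_EFinP; exact: measurable_funTS.
set I := integral _ _ _.
have I0 : (0 <= I)%E.
  by apply: integral_ge0 => z /=; rewrite in_itv /= andbT => z0; rewrite lee_fin g0// divr_ge0.
case: I I0 => [i i0|_|//] /=.
  by rewrite ger0_norm// mulr_ge0.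
by rewrite mulr0; lra.
Unshelve. all: by end_near.
Qed.

End lapexp.

(** * Maximal inequalities conditional on the past *)

(** First-entrance decomposition: [seqDU A i] says that [A i] occurs and no earlier [A j] does.
    Independently of this, with probability at least one half, [G i] leads from there into [C]; the
    resulting pieces of [C] are disjoint. *)
Lemma ottaviani (R : realType) d (Om : measurableType d) (Q : probability Om R)
    (E C : set Om) (A G : nat -> set Om) :
  measurable E -> measurable C -> (forall i, measurable (A i)) ->
  (forall i, measurable (G i)) ->
  (forall i, Q ((E `&` seqDU A i) `&` G i) = (Q (E `&` seqDU A i) * Q (G i))%E) ->
  (forall i, ((2^-1)%:E <= Q (G i))%E) ->
  (forall i, A i `&` G i `<=` C) ->
  (Q (E `&` \bigcup_i A i) <= 2%:E * Q (E `&` C))%E.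
Proof.
move=> mE mC mA mG ind G2 AGC.
pose D i := E `&` seqDU A i.
have mS i : measurable (seqDU A i).
  by apply: measurableD => //; exact: bigsetU_measurable.
have mD i : measurable (D i) by exact: measurableI.
have tD : trivIset setT D by apply: trivIset_setIl; exact: trivIset_seqDU.
have tDG : trivIset setT (fun i => D i `&` G i) by exact: trivIset_setIr.
have mDG i : measurable (D i `&` G i) by exact: measurableI.
have -> : E `&` \bigcup_i A i = \bigcup_i D i.
  by rewrite seqDU_bigcup_eq setI_bigcupr.
apply: (@le_trans _ _ (2%:E * Q (\bigcup_i (D i `&` G i)))%E); last first.
  apply: lee_wpmul2l; first by rewrite lee_fin.
  apply: le_measure; rewrite ?inE.
  - exact: bigcup_measurable.
  - exact: measurableI.
  - by move=> w [i _ [[Ew [Aw _]] Gw]]; split => //; exact: (AGC i).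
rewrite !measure_bigcup//.
rewrite -nneseriesZl//; apply: lee_nneseries => // i _.
apply: (@le_trans _ _ (2%:E * (Q (D i) * Q (G i)))%E); last by rewrite -ind.
rewrite muleA [(2%:E * _)%E]muleC -muleA -[leLHS]mule1; apply: lee_wpmul2l => //.
have := G2 i; rewrite -(fineK (fin_num_measure Q _ (mG i))) -EFinM !lee_fin => h; lra.
Qed.

Lemma dyadic_between (R : realType) (x y : R) : 0 <= x -> x < y ->
  exists n k, x < k%:R / (2 ^ n)%:R < y.
Proof.
move=> x0 xy; have d0 : 0 < y - x by rewrite subr_gt0.
pose n := Num.bound (y - x)^-1.
have p0 : 0 < (2 ^ n)%:R :> R by rewrite ltr0n expn_gt0.
have hn : (y - x)^-1 < (2 ^ n)%:R.
  have := archi_boundP (ltW (_ : 0 < (y - x)^-1)); rewrite invr_gt0 => /(_ d0) h.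
  by apply: (lt_trans h); rewrite ltr_nat ltn_expl.
have h1 : (2 ^ n)%:R^-1 < y - x by rewrite -[ltRHS]invrK ltf_pV2 ?posrE ?invr_gt0.
have xn0 : 0 <= x * (2 ^ n)%:R by rewrite mulr_ge0.
have /andP[t1 t2] := truncn_itv xn0.
exists n, (Num.truncn (x * (2 ^ n)%:R)).+1; apply/andP; split.
  by rewrite ltr_pdivlMr.
have : (Num.truncn (x * (2 ^ n)%:R)).+1%:R / (2 ^ n)%:R <= x + (2 ^ n)%:R^-1.
  rewrite ler_pdivrMr// mulrDl mulVf ?gt_eqF// -natr1.
  by rewrite lerD2r.
by lra.
Qed.

Section maximal.
Context (R : realType) d (Om : measurableType d) (Q : probability Om R).
Context (L : R -> Om -> R) (Psi : R -> R) (gam : R).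
Hypothesis HL : is_levy Q L Psi.

(** The increment from time [a] with a drift [c] added back: [c = gam] measures deviations from the
    mean path, [c = 0] the raw increment. *)
Definition exits (c : R) (O : set R) (a T : R) : set Om :=
  [set w | exists s, 0 <= s <= T /\ O (L (a + s) w - L a w + c * s)].

Let grid n k : R := k%:R / (2 ^ n)%:R.

Let exitn c O a (T n : nat) : set Om :=
  [set w | exists k, (k <= T * 2 ^ n)%N /\ O (L (a + grid n k) w - L a w + c * grid n k)].

Let grid_ge0 n k : 0 <= grid n k. Proof. by rewrite divr_ge0. Qed.

Lemma levy_right_cont w t : 0 <= t -> L x w @[x --> t^'+] --> L t w.
Proof. by move=> t0; have [_ [_ [+ _]]] := HL => /(_ w t t0)[]. Qed.

Lemma levy_right_nbhs w (a c s : R) (O : set R) : open O -> 0 <= a -> 0 <= s ->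
  O (L (a + s) w - L a w + c * s) ->
  exists2 e : R, 0 < e & forall s', s <= s' < s + e -> O (L (a + s') w - L a w + c * s').
Proof.
move=> oO a0 s0 Os.
have cv : (L x w - L a w + c * (x - a)) @[x --> (a + s)^'+] -->
    L (a + s) w - L a w + c * (a + s - a).
  apply: cvgD.
    by apply: cvgB; [apply: levy_right_cont; exact: addr_ge0|exact: cvg_cst].
  apply: cvg_at_right_filter; apply: cvgM; first exact: cvg_cst.
  by apply: cvgB; [exact: cvg_id|exact: cvg_cst].
have Os' : O (L (a + s) w - L a w + c * (a + s - a)) by rewrite [a + s]addrC addrK addrC.
have /cv := open_nbhs_nbhs (conj oO Os').
move=> [e /= e0 He]; exists e => // s' /andP[ss' s'e].
have [<-//|nss] := eqVneq s s'.
have lt : s < s' by rewrite lt_neqAle nss.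
have := He (a + s'); rewrite /= [a + s' - a]addrC addKr; apply; last by rewrite ltrD2l.
by rewrite ltr_distlC; apply/andP; split; lra.
Qed.

Lemma exits_bigcup (c : R) (O : set R) (a : R) (T : nat) : open O -> 0 <= a ->
  exits c O a T%:R = \bigcup_n exitn c O a T n.
Proof.
move=> oO a0; apply/seteqP; split => w.
  move=> [s [/andP[s0 sT] Os]].
  (* At [s = T] there is no room to the right inside the window, but [T] is itself a grid point;
     elsewhere openness and right-continuity move [s] to a later dyadic time. *)
  have := sT; rewrite le_eqVlt => /orP[/eqP sE|lT].
    exists 0%N => //; exists T; rewrite muln1; split => //.
    by rewrite /grid expn0 divr1 -sE.
  have [e e0 He] := levy_right_nbhs oO a0 s0 Os.
  have : s < Num.min (s + e) T%:R by rewrite lt_min lT andbT ltrDl.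
  move=> /(dyadic_between s0)[n [k /andP[h1]]]; rewrite lt_min => /andP[h2 h3].
  exists n => //; exists k; split; last by apply: He; rewrite ltW.
  move: h3; rewrite ltr_pdivrMr ?ltr0n ?expn_gt0// -natrM ltr_nat; exact: ltnW.
move=> [n _ [k [kT Ok]]]; exists (grid n k); split => //.
by rewrite grid_ge0 /= ler_pdivrMr ?ltr0n ?expn_gt0// -natrM ler_nat.
Qed.

Lemma past_step (c : R) (O : set R) (a b s : R) : 0 <= a -> 0 <= s -> a + s <= b -> measurable O ->
  past L b [set w | O (L (a + s) w - L a w + c * s)].
Proof.
move=> a0 s0 ab mO.
rewrite (_ : [set _ | _] = (fun w => L (a + s) w - L a w) @^-1` ((fun x => x + c * s) @^-1` O))//.
apply: past_incr.
- by rewrite addr_ge0.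
- by rewrite a0 (le_trans _ ab)// lerDl.
- rewrite -[X in measurable X]setTI; apply: (_ : measurable_fun setT (fun x : R => x + c * s)) => //.
  exact: measurable_funD.
Qed.

Let past_exitn (c : R) (O : set R) (a : R) (T n : nat) (b : R) : 0 <= a -> a + T%:R <= b -> measurable O ->
  past L b (exitn c O a T n).
Proof.
move=> a0 ab mO.
rewrite (_ : exitn _ _ _ _ _ = \bigcup_k (if (k <= T * 2 ^ n)%N then
   [set w | O (L (a + grid n k) w - L a w + c * grid n k)] else set0)).
  apply: past_bigcup => k; case: ifPn => kT; last exact: past0.
  apply: past_step => //; apply: le_trans ab; rewrite lerD2l.
  by rewrite ler_pdivrMr ?ltr0n ?expn_gt0// -natrM ler_nat.
apply/seteqP; split => w.
  by move=> [k [kT Ok]]; exists k => //; rewrite kT.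
by move=> [k _]; case: ifPn => // kT Ok; exists k.
Qed.

Lemma past_exits (c : R) (O : set R) (a : R) (T : nat) (b : R) : 0 <= a -> a + T%:R <= b -> open O ->
  past L b (exits c O a T%:R).
Proof.
move=> a0 ab oO; rewrite exits_bigcup//; apply: past_bigcup => n.
by apply: past_exitn => //; exact: open_measurable.
Qed.

Lemma past_indep_shift (c a s : R) (E : set Om) (C : set R) : 0 <= a -> 0 <= s -> past L a E ->
  measurable C ->
  Q (E `&` [set w | C (L (a + s) w - L a w + c * s)]) =
  (Q E * Q [set w | C (L s w + c * s)%R])%E.
Proof.
move=> a0 s0 pE mC.
have mC' : measurable ((fun x : R => x + c * s) @^-1` C).
  rewrite -[X in measurable X]setTI; apply: (_ : measurable_fun setT (fun x : R => x + c * s)) => //.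
  exact: measurable_funD.
have as_ : 0 <= a <= a + s by rewrite a0 lerDl.
have := past_indep HL as_ pE mC'.
by rewrite addrAC subrr add0r.
Qed.

(** Ottaviani's inequality on the grid: [A k] puts the path in [O] at grid point [k], and [G k] puts
    the remaining increment up to [T] in [V]. The remaining times are rational, which is why [HV]
    asks for rational times only. Past the last grid point [A] is empty and [G] full. *)
Let exitn_bound (c : R) (O V C : set R) (a : R) (T n : nat) E :
  measurable O -> measurable V -> measurable C ->
  (forall x v, O x -> V v -> C (x + v)) ->
  (forall k N (s : R), s = k%:R / N.+1%:R -> s <= T%:R ->
     ((2^-1)%:E <= Q [set w | V (L s w + c * s)%R])%E) ->
  0 <= a -> past L a E ->
  (Q (E `&` exitn c O a T n) <= 2%:E * (Q E * Q [set w | C (L T%:R w + c * T%:R)%R]))%E.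
Proof.
move=> mO mV mC OVC HV a0 pE.
pose A k := if (k <= T * 2 ^ n)%N then
   [set w | O (L (a + grid n k) w - L a w + c * grid n k)] else set0.
pose G k := if (k <= T * 2 ^ n)%N then
   [set w | V (L (a + T%:R) w - L (a + grid n k) w + c * (T%:R - grid n k))] else setT.
have gT k : (k <= T * 2 ^ n)%N -> grid n k <= T%:R.
  by move=> kT; rewrite ler_pdivrMr ?ltr0n ?expn_gt0// -natrM ler_nat.
have GE k (kT : (k <= T * 2 ^ n)%N) :
  G k = [set w | V (L (a + grid n k + (T%:R - grid n k)) w - L (a + grid n k) w + c * (T%:R - grid n k))].
  by rewrite /G kT; apply/funext => w /=; rewrite [_ - grid n k]addrC addrA addrK.
have pA k : past L (a + grid n k) (A k).
  rewrite /A; case: ifPn => kT; last exact: past0.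
  exact: past_step.
have mA k : measurable (A k) by exact: (past_measurable HL (pA k)).
have mG k : measurable (G k).
  have [kT|kT] := leqP k (T * 2 ^ n)%N; last by rewrite /G leqNgt kT/=.
  rewrite GE//; apply: (past_measurable HL (a := a + T%:R)); apply: past_step => //.
  - exact: addr_ge0.
  - by rewrite subr_ge0 gT.
  - by rewrite [_ - grid n k]addrC addrA addrK.
have -> : exitn c O a T n = \bigcup_k A k.
  apply/seteqP; split => w.
    by move=> [k [kT Ok]]; exists k => //; rewrite /A kT.
  by move=> [k _]; rewrite /A; case: ifPn => // kT Ok; exists k.
have pC : past L (a + T%:R) [set w | C (L (a + T%:R) w - L a w + c * T%:R)].
  exact: past_step.
rewrite -(past_indep_shift c a0 _ pE mC)//.
apply: (@ottaviani _ _ _ Q _ _ A G) => //.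
- exact: (past_measurable HL pE).
- exact: (past_measurable HL pC).
- move=> k; have [kT|kT] := leqP k (T * 2 ^ n)%N; last first.
    by rewrite /G leqNgt kT/= setIT probability_setT mule1.
  rewrite GE// past_indep_shift//.
  + have ask : 0 <= a + grid n k by exact: addr_ge0.
    have Tk : 0 <= T%:R - grid n k by rewrite subr_ge0 gT.
    have pT : past L (a + grid n k) setT by exact: pastT.
  have := past_indep_shift c ask Tk pT mV.
    by rewrite setTI probability_setT mul1e => ->.
  + exact: addr_ge0.
  + by rewrite subr_ge0 gT.
  + apply: pastI.
      by apply: past_le pE; rewrite lerDl.
    rewrite /seqDU; apply: pastD => //; rewrite -bigcup_mkord.
    rewrite bigcup_mkcond; apply: past_bigcup => j; case: ifPn => [|_]; last exact: past0.
    rewrite inE /= => jk; apply: past_le (pA j); rewrite lerD2l ler_pM2r ?invr_gt0 ?ltr0n ?expn_gt0//.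
    by rewrite ler_nat ltnW.
- move=> k; have [kT|kT] := leqP k (T * 2 ^ n)%N; last first.
    by rewrite /G leqNgt kT/= probability_setT lee_fin; lra.
  rewrite GE//.
  have ask : 0 <= a + grid n k by exact: addr_ge0.
  have Tk : 0 <= T%:R - grid n k by rewrite subr_ge0 gT.
  have pT : past L (a + grid n k) setT by exact: pastT.
  have := past_indep_shift c ask Tk pT mV.
  rewrite setTI probability_setT mul1e => ->.
  apply: (HV (T * 2 ^ n - k)%N (2 ^ n).-1); last by rewrite gerBl.
  rewrite prednK ?expn_gt0// natrB// mulrBl natrM mulfK// gt_eqF// ltr0n expn_gt0//.
- move=> k w; rewrite /A /G; case: ifPn => [kT|_] [] //= Ow Vw.
  have := OVC _ _ Ow Vw; congr C; ring.
Qed.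

Lemma exits_bound (c : R) (O V C : set R) (a : R) (T : nat) E :
  open O -> measurable V -> measurable C ->
  (forall x v, O x -> V v -> C (x + v)) ->
  (forall k N (s : R), s = k%:R / N.+1%:R -> s <= T%:R ->
     ((2^-1)%:E <= Q [set w | V (L s w + c * s)%R])%E) ->
  0 <= a -> past L a E ->
  (Q (E `&` exits c O a T%:R) <= 2%:E * (Q E * Q [set w | C (L T%:R w + c * T%:R)%R]))%E.
Proof.
move=> oO mV mC OVC HV a0 pE; have mO : measurable O by exact: open_measurable.
rewrite exits_bigcup// setI_bigcupr.
have mE := past_measurable HL pE.
have mX n : measurable (exitn c O a T n).
  by apply: (past_measurable HL (a := a + T%:R)); exact: past_exitn.
(* The dyadic grids are nested, so the bound, uniform in [n], passes to the monotone limit. *)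
have ndX : nondecreasing_seq (fun n => E `&` exitn c O a T n).
  apply/nondecreasing_seqP => n; apply/subsetPset => w [Ew [k [kT Ok]]]; split => //.
  exists (2 * k)%N; split.
    by rewrite expnS mulnCA leq_mul2l.
  suff -> : grid n.+1 (2 * k) = grid n k by [].
  rewrite /grid expnS !natrM -mulf_div divff ?mul1r//.
have cv := @nondecreasing_cvg_mu _ _ _ Q (fun n => E `&` exitn c O a T n) _ _ ndX.
have {}cv := cv (fun n => measurableI _ _ mE (mX n)) (bigcup_measurable (fun n _ => measurableI _ _ mE (mX n))).
rewrite -(cvg_lim _ cv)//; apply: lime_le; first by apply/cvg_ex; eexists; exact: cv.
by apply: nearW => n /=; exact: (@exitn_bound c O V C).
Qed.

Hypothesis gam_ge0 : 0 <= gam.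
Hypothesis Psi_slope : asymptotic_slope Psi gam.

Lemma open_norm_gt (eta : R) : open [set x : R | eta < `|x|].
Proof.
rewrite (_ : [set _ | _] = (fun x : R => `|x|) @^-1` `]eta, +oo[).
  apply: open_comp; last exact: interval_open.
  by move=> x _; exact: norm_continuous x.
by apply/seteqP; split => x; rewrite /= in_itv /= andbT.
Qed.

Lemma open_lt (c : R) : open [set x : R | x < c].
Proof.
rewrite (_ : [set _ | _] = `]-oo, c[%classic); first exact: interval_open.
by apply/seteqP; split => x; rewrite /= in_itv.
Qed.

Lemma half_le_setC (A B : set Om) : measurable A -> B = ~` A ->
  (Q A <= (2^-1)%:E)%E -> ((2^-1)%:E <= Q B)%E.
Proof.
move=> mA ->; rewrite probability_setC// -(fineK (fin_num_measure Q _ mA)).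
by rewrite -EFinB !lee_fin => h; lra.
Qed.

Lemma lln_max (eps del : R) : 0 < eps -> 0 < del ->
  exists m0, forall m, (m0 <= m)%N -> forall a E, 0 <= a -> past L a E ->
   (Q (E `&` exits gam [set x | (eps * m%:R < `|x|)%R] a m%:R) <= del%:E * Q E)%E.
Proof.
move=> eps0 del0; have e20 : 0 < eps / 2 by rewrite divr_gt0.
(* One half is the probability required of the set [V]; [del / 2] compensates the factor 2 of
   Ottaviani's inequality. *)
pose del' := Num.min (2^-1) (del / 2).
have del'0 : 0 < del' by rewrite lt_min divr_gt0// andbT; lra.
have [d2 dd] : del' <= 2^-1 /\ del' <= del / 2 by split; rewrite ge_min lexx ?orbT.
have [m0 H] := marginal_lln HL Psi_slope e20 del'0.
exists m0 => m m0m a E a0 pE.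
have mL s : 0 <= s -> measurable_fun setT (fun w => `|L s w + gam * s|).
  move=> s0; apply: measurableT_comp => //; apply: measurable_funD => //.
  exact: (levy_measurable HL s0).
have mN : measurable_fun setT (fun x : R => `|x|) by [].
apply: le_trans.
  apply: (@exits_bound gam _ [set v | `|v| <= eps / 2 * m%:R] [set v | eps / 2 * m%:R < `|v|]) => //.
  - exact: open_norm_gt.
  - exact: (measurable_set_le mN).
  - exact: (measurable_set_gt mN).
  - move=> x v /= hx hv; have := ler_normB (x + v) v; rewrite addrK; lra.
  - move=> k N s sE sm; have s0 : 0 <= s by rewrite sE divr_ge0.
    apply: (@half_le_setC [set w | (eps / 2 * m%:R < `|L s w + gam * s|)%R]).
    + exact: measurable_set_gt (mL _ s0) _.
    + by apply/seteqP; split => w /=; rewrite leNgt => /negP.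
    + by apply: (le_trans (H m m0m k N s sE sm)); rewrite lee_fin.
have hm := H m m0m m 0%N m%:R; rewrite divr1 in hm.
have {}hm := hm erefl (lexx _).
have fE := fin_num_measure Q _ (past_measurable HL pE).
rewrite muleA [(2%:E * _)%E]muleC -muleA [leRHS]muleC.
apply: lee_wpmul2l => //.
have mA := measurable_set_gt (mL _ (ler0n R m)) (eps / 2 * m%:R).
move: hm; rewrite -(fineK (fin_num_measure Q _ mA)) -EFinM !lee_fin; lra.
Qed.

(** A path that falls below [- 2 y] within a unit of time ends below [- y] unless it climbs back by
    more than [y], which has probability at most one half once [y] is large; the final value has an
    exponential left tail. *)
Lemma left_max : exists2 y0, 0 <= y0 & forall y, y0 <= y -> forall a E, 0 <= a -> past L a E ->
   (Q (E `&` exits 0 [set x | (x < - (2 * y))%R] a 1) <= (2 * expR (Psi 1 - y))%:E * Q E)%E.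
Proof.
have h2 : 0 < (2^-1 : R) by lra.
have [m0 H] := marginal_lln HL Psi_slope ltr01 h2.
pose M := maxn 1 m0; exists M%:R => // y My a E a0 pE.
have M1 : 1 <= M%:R :> R by rewrite ler1n leq_max.
have mL s : 0 <= s -> measurable_fun setT (L s) by exact: (levy_measurable HL).
apply: le_trans.
  apply: (@exits_bound 0 _ [set v | v <= y] [set v | v < - y] a 1%N) => //.
  - exact: (measurable_set_le (f := id)).
  - exact: (measurable_set_lt (f := id)).
  - by move=> x v /=; lra.
  - move=> k N s sE s1; have s0 : 0 <= s by rewrite sE divr_ge0.
    apply: (@half_le_setC [set w | (y < L s w)%R]).
    + exact: measurable_set_gt (mL _ s0) _.
    + by apply/seteqP; split => w /=; rewrite mul0r addr0 leNgt => /negP.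
    + have sM : s <= M%:R by apply: le_trans M1.
      have mb : (m0 <= M)%N by rewrite leq_max leqnn orbT.
      apply: le_trans (H M mb k N s sE sM); apply: le_measure; rewrite ?inE.
      * exact: measurable_set_gt (mL _ s0) _.
      * apply: measurable_set_gt; apply: measurableT_comp => //.
        by apply: measurable_funD => //; exact: mL.
      * move=> w /= yL; rewrite mul1r ger0_norm; last by have := mulr_ge0 gam_ge0 s0; lra.
        by have := mulr_ge0 gam_ge0 s0; lra.
have mE := past_measurable HL pE.
rewrite (_ : [set w | _] = [set w | (L 1 w < - y)%R]); last first.
  by apply/seteqP; split => w /=; rewrite mul0r addr0.
have mA := measurable_set_lt (mL _ ler01) (- y).
rewrite muleA [(2%:E * _)%E]muleC -muleA [leRHS]muleC.
apply: lee_wpmul2l => //.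
have := exp_left_tail HL y.
rewrite -(fineK (fin_num_measure Q _ mA)) -EFinM !lee_fin; lra.
Qed.

End maximal.

(** * Visits to an interval at integer times *)

Section pr.
Context (R : realType) d (Om : measurableType d) (Q : probability Om R).

Definition pr (A : set Om) : R := fine (Q A).

Lemma prE A : measurable A -> Q A = (pr A)%:E.
Proof. by move=> mA; rewrite /pr fineK//; exact: fin_num_measure. Qed.

Lemma pr_ge0 A : 0 <= pr A. Proof. exact: fine_ge0. Qed.

Lemma pr0 : pr set0 = 0. Proof. by rewrite /pr measure0. Qed.

Lemma pr_le A B : measurable A -> measurable B -> A `<=` B -> pr A <= pr B.
Proof.
by move=> mA mB AB; rewrite -lee_fin -!prE//; apply: le_measure; rewrite ?inE.
Qed.

Lemma prID A B : measurable A -> measurable B -> pr A = pr (A `&` B) + pr (A `\` B).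
Proof.
move=> mA mB; apply: EFin_inj; rewrite EFinD -!prE//; first 1 last.
- exact: measurableD.
- exact: measurableI.
by rewrite addeC; exact: measureDI.
Qed.

End pr.

Lemma sum_le_count (R : realType) (F : nat -> R) (q : R) K n : 0 <= q ->
  (forall k, F k <= q) -> (forall k, (K <= k)%N -> F k <= 0) ->
  \sum_(0 <= k < n) F k <= K%:R * q.
Proof.
move=> q0 Fq F0; suff : \sum_(0 <= k < n) F k <= (minn n K)%:R * q.
  by move/le_trans; apply; rewrite ler_wpM2r// ler_nat geq_minr.
elim: n => [|n IH]; first by rewrite big_geq// min0n mul0r.
rewrite big_nat_recr//=; have [nK|Kn] := ltnP n K.
  have -> : minn n.+1 K = (minn n K).+1 by rewrite (minn_idPl nK) (minn_idPl (ltnW nK)).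
  by rewrite -natr1 mulrDl mul1r lerD.
have -> : minn n.+1 K = minn n K by rewrite (minn_idPr Kn) (minn_idPr (leqW Kn)).
by rewrite -[leRHS]addr0 lerD// F0.
Qed.

Lemma sum_split_le (R : realType) (F : nat -> R) (q : R) m n : 0 <= q ->
  (forall k, F k <= q) ->
  \sum_(0 <= k < n) F k <= m%:R * q + \sum_(0 <= k < n - m) F (m + k)%N.
Proof.
move=> q0 Fq; have h k : \sum_(0 <= i < k) F i <= k%:R * q.
  elim: k => [|k IH]; first by rewrite big_geq// mul0r.
  by rewrite big_nat_recr//= -natr1 mulrDl mul1r lerD.
have [nm|mn] := leqP n m.
  have -> : (n - m = 0)%N by apply/eqP; rewrite subn_eq0.
  by rewrite [X in _ + X]big_geq// addr0 (le_trans (h n))// ler_wpM2r// ler_nat.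
rewrite (big_cat_nat (n := m))//=; last exact: ltnW.
rewrite lerD// -{1}[m]add0n big_addn; apply: ler_sum => i _; by rewrite addnC.
Qed.

Section visits.
Context (R : realType) d (Om : measurableType d) (Q : probability Om R).
Context (L : R -> Om -> R) (Psi : R -> R) (gam : R).
Hypothesis HL : is_levy Q L Psi.
Hypothesis gam_gt0 : 0 < gam.

(** [r] is a phase: integrating visit counts over [r] in [[0, 1[] recovers occupation times.
    Survival is tested only at the times [r + j], which is implied by being before [tau0], so bounds
    on visits bound occupation from above. *)
Definition visit (x r c c' : R) (k : nat) : set Om :=
  [set w | (forall j, (j <= k)%N -> 0 <= x + L (r + j%:R) w) /\
           c <= x + L (r + k%:R) w < c'].

Definition stray (eta a T : R) : set Om := exits L gam [set x | eta < `|x|] a T.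

Lemma past_half (O : set R) (x b s : R) : 0 <= s <= b -> measurable O ->
  past L b [set w | O (x + L s w)].
Proof.
move=> sb mO; have mO' : measurable ((fun y => x + y) @^-1` O).
  rewrite -[X in measurable X]setTI.
  by apply: (_ : measurable_fun setT (fun y : R => x + y)) => //; exact: measurable_funD.
have : past L b (L s @^-1` ((fun y => x + y) @^-1` O)) by exact: past_preimage.
exact.
Qed.

Lemma past_visit (x r c c' : R) k : 0 <= r -> past L (r + k%:R) (visit x r c c' k).
Proof.
move=> r0.
rewrite (_ : visit _ _ _ _ _ = (\bigcap_j (if (j <= k)%N then [set w | `[0, +oo[%classic (x + L (r + j%:R) w)] else setT))
   `&` [set w | `[c, c'[%classic (x + L (r + k%:R) w)]).
  apply: pastI.
    apply: past_bigcap => j; case: ifPn => jk; last exact: pastT.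
    by apply: past_half => //; rewrite addr_ge0//= lerD2l ler_nat.
  by apply: past_half => //; rewrite addr_ge0//= lexx.
apply/seteqP; split => w.
  move=> [h1 h2]; split; last by rewrite /= in_itv.
  by move=> j _; case: ifPn => // jk; rewrite /= in_itv /= andbT; exact: h1.
move=> [h1 h2]; split; last by move: h2; rewrite /= in_itv.
by move=> j jk; have := h1 j I; rewrite jk /= in_itv /= andbT.
Qed.

Lemma past_stray (eta a : R) (T : nat) (b : R) : 0 <= a -> a + T%:R <= b ->
  past L b (stray eta a T%:R).
Proof. by move=> a0 ab; apply: (past_exits HL) => //; exact: open_norm_gt. Qed.

(** [C] bounds the expected number of visits after [i] given any past event. Where there is no visit
    at [i], the index moves on. After a visit, a path that does not stray is below [c] from step [K]
    on, and negative at step [m], so it makes at most [K] visits. A straying path, of conditional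
    probability at most [del], is charged [m] visits and restarted at [i + m]. Hence the condition
    [K + del * (m + C) <= C]. *)
Lemma visits_induct (x r c c' eta del C : R) (m K n i : nat) (E : set Om) :
  0 <= r -> (0 < m)%N -> 0 <= del -> 0 <= C ->
  (forall a E, 0 <= a -> past L a E -> pr Q (E `&` stray eta a m%:R) <= del * pr Q E) ->
  c' - c + eta <= gam * K%:R -> c' + eta <= gam * m%:R ->
  K%:R + del * m%:R + del * C <= C ->
  past L (r + i%:R) E ->
  \sum_(0 <= k < n) pr Q (E `&` visit x r c c' (i + k)) <= C * pr Q E.
Proof.
move=> r0 m0 del0 C0 Hbad HK Hm HC; elim/ltn_ind: n i E => n IH i E pE.
case: n IH => [_|n IH]; first by rewrite big_geq// mulr_ge0// pr_ge0.
have rk k : 0 <= r + k%:R by rewrite addr_ge0.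
have mV k : measurable (visit x r c c' k) by apply: (past_measurable HL (a := r + k%:R)); exact: past_visit.
have mE := past_measurable HL pE.
pose E1 := E `&` visit x r c c' i; pose E2 := E `\` visit x r c c' i.
have pE1 : past L (r + i%:R) E1 by apply: pastI => //; exact: past_visit.
have pE2 : past L (r + i%:R) E2 by apply: pastD => //; exact: past_visit.
have mE1 := past_measurable HL pE1; have mE2 := past_measurable HL pE2.
pose B := stray eta (r + i%:R) m%:R.
have pB : past L (r + (i + m)%:R) B by apply: past_stray => //; rewrite natrD addrA.
have mB := past_measurable HL pB.
have sE k : pr Q (E `&` visit x r c c' k) =
    pr Q (E1 `&` visit x r c c' k) + pr Q (E2 `&` visit x r c c' k).
  rewrite (@prID _ _ _ Q (E `&` visit x r c c' k) (visit x r c c' i))//; last exact: measurableI.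
  by rewrite /E1 /E2 !setDE; congr (pr Q _ + pr Q _); rewrite setIAC.
under eq_bigr do rewrite sE.
rewrite big_split /= (prID Q mE (mV i)) mulrDr; apply: lerD; last first.
  rewrite big_nat_recl//= addn0.
  (* Without a visit at [i] the first term vanishes, and the induction applies to one term fewer. *)
  have -> : E2 `&` visit x r c c' i = set0.
    by rewrite /E2 setDE -setIA setICl setI0.
  rewrite pr0 add0r; under eq_bigr do rewrite -addSnnS.
  apply: IH => //; apply: past_le pE2; by rewrite lerD2l ler_nat.
have sE1 k : pr Q (E1 `&` visit x r c c' k) =
    pr Q ((E1 `\` B) `&` visit x r c c' k) + pr Q ((E1 `&` B) `&` visit x r c c' k).
  rewrite (@prID _ _ _ Q (E1 `&` visit x r c c' k) B)//; last exact: measurableI.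
  by rewrite addrC !setDE; congr (pr Q _ + pr Q _); rewrite setIAC.
under eq_bigr do rewrite sE1.
rewrite big_split /=.
have B1 : pr Q (E1 `&` B) <= del * pr Q E1 by exact: Hbad.
have q0 := pr_ge0 Q E1; have q1 := pr_ge0 Q (E1 `&` B).
have mE1B : measurable (E1 `&` B) by exact: measurableI.
have h1 : \sum_(0 <= k < n.+1) pr Q ((E1 `\` B) `&` visit x r c c' (i + k)) <= K%:R * pr Q E1.
  apply: sum_le_count => //.
    move=> k; apply: pr_le => //; last by move=> w [[]].
    by apply: measurableI => //; exact: measurableD.
  move=> k Kk; rewrite (_ : _ `&` _ = set0) ?pr0//.
  apply/seteqP; split => // w [[[Ew [Vi1 /andP[_ Vi2]]] nB] [Vk1 /andP[Vk2 _]]].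
  have good s : 0 <= s <= m%:R -> L (r + i%:R + s) w - L (r + i%:R) w + gam * s <= eta.
    move=> sm; rewrite leNgt; apply/negP => h; apply: nB; exists s; split => //=.
    by apply: (lt_le_trans h); exact: ler_norm.
  (* Up to [m] the drift has brought the path below [c]; beyond [m] the survival test at [i + m]
     already fails. *)
  have [km|mk] := leqP k m.
    have := good k%:R; rewrite ler0n ler_nat => /(_ km).
    have := Vk2; rewrite natrD addrA.
    have : gam * K%:R <= gam * k%:R by rewrite ler_pM2l// ler_nat.
    by lra.
  have := good m%:R; rewrite ler0n lexx => /(_ isT).
  have := Vk1 (i + m)%N; rewrite leq_add2l natrD addrA => /(_ (ltnW mk)); lra.
have h2 : \sum_(0 <= k < n.+1) pr Q ((E1 `&` B) `&` visit x r c c' (i + k)) <=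
   m%:R * pr Q (E1 `&` B) + C * pr Q (E1 `&` B).
  apply: le_trans.
    apply: (@sum_split_le _ _ (pr Q (E1 `&` B)) m) => // k.
    by apply: pr_le => //; [exact: measurableI].
  rewrite lerD2l; under eq_bigr do rewrite addnA.
  apply: IH; first by rewrite ltn_subrL m0.
  by apply: pastI => //; apply: past_le pE1; rewrite lerD2l ler_nat leq_addr.
apply: (le_trans (lerD h1 h2)).
rewrite -mulrDl; have mC : 0 <= m%:R + C by rewrite addr_ge0.
apply: (@le_trans _ _ (K%:R * pr Q E1 + (m%:R + C) * (del * pr Q E1))).
  by rewrite lerD2l ler_wpM2l.
rewrite mulrA -mulrDl ler_wpM2r//; lra.
Qed.

Hypothesis Psi_slope : asymptotic_slope Psi gam.

Lemma pr_stray (eps del : R) : 0 < eps -> 0 < del ->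
  exists m0, forall m, (m0 <= m)%N -> forall a E, 0 <= a -> past L a E ->
   pr Q (E `&` stray (eps * m%:R) a m%:R) <= del * pr Q E.
Proof.
move=> e0 d0; have [m0 H] := lln_max HL Psi_slope e0 d0.
exists m0 => m mm a E a0 pE; have := H m mm a E a0 pE.
rewrite !prE ?lee_fin//; first exact: (past_measurable HL pE).
apply: measurableI; first exact: (past_measurable HL pE).
by apply: (past_measurable HL (a := a + m%:R)); exact: past_stray.
Qed.

Lemma visits_bound (h eps : R) : 1 < h -> 0 < eps ->
  exists2 c0 : R, 0 < c0 & forall c x r n, c0 <= c -> 0 <= r ->
    \sum_(0 <= k < n) pr Q (visit x r c (h * c) k) <= (1 + eps) * ((h - 1) * c / gam).
Proof.
move=> h1 eps0; have hm1 : 0 < h - 1 by rewrite subr_gt0.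
have h0 : 0 < h by lra.
(* Since [m] will be at most [3 * h * c / gam], the second term makes [eta = e1 * m] at most
   [eps * (h - 1) * c / 8]; the first keeps [eta <= gam * m / 4], which leaves room for the path to
   become negative. *)
pose e1 := Num.min (gam / 4) (eps * (h - 1) * gam / (24 * h)).
have e10 : 0 < e1.
  by rewrite lt_min divr_gt0//= divr_gt0// ?mulr_gt0.
have [e14 e1h] : e1 <= gam / 4 /\ e1 <= eps * (h - 1) * gam / (24 * h).
  by split; rewrite ge_min lexx ?orbT.
(* The denominator bounds [(m + C) / a], where [a] is the time needed to cross the block at speed
   [gam] and [C = (1 + eps) * a]; straying then costs at most [eps * a / 2]. *)
pose del := eps / 2 / (3 * h / (h - 1) + 1 + eps).
have D0 : 0 < 3 * h / (h - 1) + 1 + eps.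
  have : 0 < 3 * h / (h - 1) by rewrite divr_gt0// mulr_gt0.
  by lra.
have del0 : 0 < del by rewrite divr_gt0// divr_gt0.
have [m0 Hm0] := pr_stray e10 del0.
(* The last threshold gives [8 <= eps * a], so rounding [K] up to an integer costs at most
   [eps * a / 8]. *)
exists (Num.max gam (Num.max (gam * m0%:R) (8 * gam / (eps * (h - 1))))).
  by rewrite lt_max gam_gt0.
move=> c x r n; rewrite !ge_max => /andP[cg /andP[cm ce]] r0.
have c0 : 0 < c by exact: lt_le_trans cg.
set a := (h - 1) * c / gam; have a0 : 0 < a by rewrite divr_gt0// mulr_gt0.
have aE : gam * a = (h - 1) * c by rewrite /a [gam * _]mulrC divfK// gt_eqF.
have a8 : 8 <= eps * a.
  move: ce; rewrite ler_pdivrMr ?mulr_gt0// => ce.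
  by rewrite -(ler_pM2r gam_gt0) -mulrA [a * gam]mulrC aE; lra.
pose m := (Num.truncn (2 * h * c / gam)).+1.
have y0 : 0 <= 2 * h * c / gam by rewrite divr_ge0 ?ltW// !mulr_gt0.
have /andP[t1 t2] := truncn_itv y0.
have m1 : 2 * h * c <= gam * m%:R by rewrite [gam * _]mulrC -ler_pdivrMr// ltW.
have m2 : gam * m%:R <= 3 * h * c.
  have : gam * m%:R <= gam * (2 * h * c / gam + 1).
    by rewrite ler_pM2l// /m -natr1 lerD2r.
  rewrite mulrDr [gam * (_ / _)]mulrC divfK ?gt_eqF// mulr1.
  have : c <= h * c by rewrite ler_peMl// ltW.
  by lra.
have m0m : (m0 <= m)%N.
  rewrite -(ler_nat R) -(ler_pM2l gam_gt0); apply: (le_trans cm).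
  apply: le_trans m1; have : c <= h * c by rewrite ler_peMl// ltW.
  by lra.
set eta := e1 * m%:R.
have eta1 : eta <= eps * (h - 1) * c / 8.
  have : e1 * (24 * h) <= eps * (h - 1) * gam by rewrite -ler_pdivlMr// mulr_gt0.
  move=> hh; have hh2 : e1 * (24 * h) * m%:R <= eps * (h - 1) * gam * m%:R by rewrite ler_wpM2r.
  have hh3 : eps * (h - 1) * (gam * m%:R) <= eps * (h - 1) * (3 * h * c).
    by rewrite ler_pM2l// mulr_gt0.
  have : eta * (24 * h) <= eps * (h - 1) * c / 8 * (24 * h) by rewrite /eta; lra.
  by rewrite ler_pM2r// mulr_gt0.
have eta2 : eta <= gam * m%:R / 4 by rewrite /eta; have := ler0n R m; nra.
have eta0 : 0 <= eta by rewrite mulr_ge0// ltW.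
pose K := (Num.truncn (((h - 1) * c + eta) / gam)).+1.
have z0 : 0 <= ((h - 1) * c + eta) / gam.
  by rewrite divr_ge0 ?ltW// ltr_wpDr// mulr_gt0.
have /andP[k1 k2] := truncn_itv z0.
have K1 : (h - 1) * c + eta <= gam * K%:R by rewrite [gam * _]mulrC -ler_pdivrMr// ltW.
have K2 : K%:R <= a + eps * a / 4.
  rewrite /K -natr1 -(ler_pM2l gam_gt0).
  have : gam * (Num.truncn (((h - 1) * c + eta) / gam))%:R <= (h - 1) * c + eta.
    by rewrite [gam * _]mulrC -ler_pdivlMr.
  move=> hk; rewrite !mulrDr mulr1 aE; move: hk.
  have -> : gam * (eps * a / 4) = eps * (gam * a) / 4 by ring.
  have : gam * 8 <= gam * (eps * a) by rewrite ler_pM2l.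
  have -> : gam * (eps * a) = eps * (gam * a) by ring.
  rewrite aE.
  by lra.
have mH : m%:R <= 3 * h / (h - 1) * a.
  rewrite -(ler_pM2l gam_gt0) mulrCA aE; apply: (le_trans m2).
  by rewrite mulrA divfK// gt_eqF.
have := @visits_induct x r c (h * c) eta del ((1 + eps) * a) m K n 0%N setT r0 _ (ltW del0).
rewrite /pr probability_setT mulr1.
have -> : \sum_(0 <= k < n) fine (Q ([set: Om] `&` visit x r c (h * c) (0 + k))) =
   \sum_(0 <= k < n) fine (Q (visit x r c (h * c) k)).
  by apply: eq_bigr => k _; rewrite setTI add0n.
apply => //.
- by rewrite mulr_ge0// ?ltW//; lra.
- by move=> a' E a'0 pE; exact: Hm0.
- by lra.
- by lra.
- have : del * (m%:R + (1 + eps) * a) <= del * ((3 * h / (h - 1) + 1 + eps) * a).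
    by rewrite ler_pM2l//; lra.
  rewrite mulrA /del divfK ?gt_eqF//; lra.
- exact: pastT.
Qed.

End visits.

(** * Dips between integer times and first passages *)

Lemma exists_expr_gt (R : realType) (h x : R) : 1 < h -> exists n, x < h ^+ n.
Proof.
move=> h1; have hh : 0 < h - 1 by rewrite subr_gt0.
have z0 : 0 <= `|x| / (h - 1) by rewrite divr_ge0// ltW.
have := archi_boundP z0; set N := Num.bound _; rewrite ltr_pdivrMr// => hz.
exists N; apply: (le_lt_trans (ler_norm x)); apply: (lt_le_trans hz).
elim: N {hz} => [|N IH]; first by rewrite mul0r expr0.
rewrite exprS -natr1 mulrDl mul1r.
have p1 : 1 <= h ^+ N by rewrite exprn_ege1// ltW.
by move: p1 IH; move: (h ^+ N) => p p1 IH; nra.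
Qed.

Lemma exists_geometric_block (R : realType) (h b z : R) : 1 < h -> 0 < b -> b <= z ->
  exists n, h ^+ n * b <= z < h * (h ^+ n * b).
Proof.
move=> h1 b0 bz; have zb1 : 1 <= z / b by rewrite ler_pdivlMr// mul1r.
have [[|n] Pn nmin] := ex_minnP (exists_expr_gt (z / b) h1).
  by move: Pn; rewrite expr0 ltNge zb1.
exists n; apply/andP; split.
  by rewrite -ler_pdivlMr// leNgt; apply/negP => /nmin; rewrite ltnn.
by move: Pn; rewrite ltr_pdivrMr// exprS mulrA.
Qed.

Section passage.
Context (R : realType) d (Om : measurableType d) (Q : probability Om R).
Context (L : R -> Om -> R) (Psi : R -> R) (gam : R).
Hypothesis HL : is_levy Q L Psi.
Hypothesis gam_gt0 : 0 < gam.
Hypothesis Psi_slope : asymptotic_slope Psi gam.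

(* Off [dip], the values at integer times control the whole path above [b]; the
   threshold is kept in the form [2 * y] of [left_max]. *)
Definition dip_at (x b e : R) (n k : nat) : set Om :=
  visit L x 0 (2 ^+ n * b) (2 * (2 ^+ n * b)) k `&`
  exits L 0 [set y | y < - (2 * (e * (2 ^+ n * b) / 2))] k%:R 1.

Definition dip (x b e : R) : set Om := \bigcup_n \bigcup_k dip_at x b e n k.

Lemma measurable_visit (x r c c' : R) k : 0 <= r -> measurable (visit L x r c c' k).
Proof.
by move=> r0; apply: (past_measurable HL (a := r + k%:R)); exact: past_visit.
Qed.

Lemma measurable_dip_at x b e n k : measurable (dip_at x b e n k).
Proof.
apply: measurableI; first exact: measurable_visit.
have h : past L (k%:R + 1%:R) (exits L 0 [set y | y < - (2 * (e * (2 ^+ n * b) / 2))] k%:R 1%:R).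
  by apply: (past_exits HL) => //; exact: open_lt.
exact: (past_measurable HL h).
Qed.

Lemma measurable_dip x b e : measurable (dip x b e).
Proof.
by apply: bigcupT_measurable => n; apply: bigcupT_measurable => k; exact: measurable_dip_at.
Qed.

Lemma dipP (x b e : R) w k s : 0 < b -> 0 <= e -> ~ dip x b e w ->
  (forall j, (j <= k)%N -> b <= x + L j%:R w) -> 0 <= s <= 1 ->
  (1 - e) * (x + L k%:R w) <= x + L (k%:R + s) w.
Proof.
move=> b0 e0 nd hb s01; set z := x + L k%:R w.
have zb : b <= z by exact: hb.
have [n /andP[n1 n2]] := exists_geometric_block (ltr1n R 2) b0 zb.
set c := 2 ^+ n * b in n1 n2.
rewrite leNgt; apply/negP => h; apply: nd.
exists n => //; exists k => //; split.
  split; last by rewrite add0r -/c n1 n2.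
  by move=> j jk; rewrite add0r (le_trans (ltW b0))// hb.
exists s; split => //=; rewrite -/c mul0r addr0.
have : e * c <= e * z by rewrite ler_wpM2l.
move: h; rewrite /z; lra.
Qed.

Lemma expRN_le (z : R) : 0 < z -> expR (- z) <= 2 / z ^+ 2.
Proof.
move=> z0; have h : z ^+ 2 / 2 <= expR z.
  apply: le_trans (expR_ge1Dxn 1 (ltW z0)).
  by rewrite (_ : 2`!%:R = 2)// lerDr.
have z2 : 0 < z ^+ 2 by rewrite exprn_gt0.
rewrite expRN ler_pdivlMr// mulrC ler_pdivrMr ?expR_gt0//.
by move: h; rewrite ler_pdivrMr// mulrC.
Qed.

(** At scale [c = 2 ^+ n * b] there are on average O(c) visits, each followed by a relative dip with
    probability O(1 / c^2), by the crude bound [expRN_le] on an exponential. The total at level [n]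
    is O(1 / c), summable over [n] and small with [1 / b]. *)
Lemma dip_bound (e del : R) : 0 < e -> 0 < del ->
  exists2 b0 : R, 0 < b0 & forall b x, b0 <= b -> (Q (dip x b e) <= del%:E)%E.
Proof.
move=> e0 del0.
have [c0 c00 Hc] := visits_bound HL gam_gt0 Psi_slope (ltr1n R 2) ltr01.
have [y0 y00 Hy] := left_max HL (ltW gam_gt0) Psi_slope.
(* The level bound is exactly [D / c]; the threshold [2 * D / del <= b] makes it at most
   [del / 2 ^ n.+1]. *)
pose D := 2 * expR (Psi 1) * (2 / gam) * (8 / e ^+ 2).
have D0 : 0 < D by rewrite !mulr_gt0 ?expR_gt0 ?divr_gt0 ?invr_gt0// exprn_gt0.
exists (Num.max c0 (Num.max (2 * y0 / e) (2 * D / del))).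
  by rewrite lt_max c00.
move=> b x; rewrite !ge_max => /andP[bc /andP[by_ bd]].
have b0 : 0 < b by exact: lt_le_trans bc.
apply: (le_trans (measure_sigma_subadditive _ _ _ (@subset_refl _ _))).
- by move=> n; apply: bigcupT_measurable => k; exact: measurable_dip_at.
- exact: measurable_dip.
apply: (@le_trans _ _ (\sum_(0 <= n <oo) (del / (2 ^ n.+1)%:R)%:E)%E); last first.
  exact: epsilon_trick0 (ltW del0).
apply: lee_nneseries => // n _.
pose c := 2 ^+ n * b.
have p1 : 1 <= 2 ^+ n :> R by rewrite exprn_ege1// ler1n.
have bc' : b <= c by rewrite ler_peMl// ltW.
have c_gt0 : 0 < c by exact: lt_le_trans bc'.
have yc : y0 <= e * c / 2.
  have : 2 * y0 <= e * b by rewrite [e * b]mulrC -ler_pdivrMr.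
  have : e * b <= e * c by rewrite ler_pM2l.
  by lra.
have mD k : measurable (dip_at x b e n k) := @measurable_dip_at x b e n k.
apply: (le_trans (measure_sigma_subadditive _ mD _ (@subset_refl _ _))).
  by apply: bigcupT_measurable.
have hk k : (Q (dip_at x b e n k) <= (2 * expR (Psi 1 - e * c / 2) * pr Q (visit L x 0 c (2 * c) k))%:E)%E.
  have pv : past L k%:R (visit L x 0 c (2 * c) k).
    by rewrite -[X in past L X]add0r; exact: past_visit.
  apply: (le_trans (Hy _ yc k%:R _ (ler0n _ _) pv)).
  by rewrite prE ?EFinM//; exact: measurable_visit.
apply: lime_le; first exact: is_cvg_nneseries.
apply: nearW => N.
apply: (le_trans (lee_sum _ (fun k _ => hk k))).
rewrite sumEFin lee_fin -mulr_sumr.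
have cc : c0 <= c by exact: le_trans bc'.
have := Hc c x 0 N cc (lexx 0).
set S := \sum_(_ <= _ < _) _ => hS.
have -> : (2 ^ n.+1)%:R = 2 * 2 ^+ n :> R by rewrite natrX exprS.
have z0 : 0 < e * c / 2 by rewrite divr_gt0// mulr_gt0.
have hz := expRN_le z0.
rewrite expRD mulrA.
have S0 : 0 <= S by apply: sumr_ge0 => k _; exact: pr_ge0.
have E0 := expR_gt0 (Psi 1).
apply: (@le_trans _ _ (2 * expR (Psi 1) * (2 / (e * c / 2) ^+ 2) * ((1 + 1) * ((2 - 1) * c / gam)))).
  apply: ler_pM; [by rewrite !mulr_ge0// expR_ge0|exact: S0| |exact: hS].
  by rewrite ler_pM2l// mulr_gt0.
have -> : 2 * expR (Psi 1) * (2 / (e * c / 2) ^+ 2) * ((1 + 1) * ((2 - 1) * c / gam)) = D / c.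
  rewrite /D; field; by rewrite !gt_eqF.
have -> : del / (2 * 2 ^+ n) = (del * b / 2) / c.
  rewrite /c; field; by rewrite !gt_eqF// (lt_le_trans ltr01).
rewrite ler_pM2r ?invr_gt0//.
by move: bd; rewrite ler_pdivrMr//; lra.
Qed.

(** A first passage observed at integer times only: these events are disjoint in [k] and belong to
    the past of [k]. The path may have been below [a] earlier, between integers; [dip] accounts for
    that. *)
Definition first_below (x a : R) (k : nat) : set Om :=
  [set w | (forall j, (j < k)%N -> a <= x + L j%:R w) /\ x + L k%:R w < a].

Definition astray (x a eta : R) (m : nat) : set Om :=
  ~` (\bigcup_k first_below x a k) `|`
  \bigcup_k (first_below x a k `&` stray L gam eta k%:R m%:R).

Lemma past_first_below x a k : past L k%:R (first_below x a k).
Proof.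
rewrite (_ : first_below _ _ _ =
   (\bigcap_j (if (j < k)%N then [set w | `[a, +oo[%classic (x + L j%:R w)] else setT))
   `&` [set w | `]-oo, a[%classic (x + L k%:R w)]).
  apply: pastI.
    apply: past_bigcap => j; case: ifPn => jk; last exact: pastT.
    by apply: past_half => //; rewrite ler0n/= ler_nat ltnW.
  by apply: past_half => //; rewrite ler0n/=.
apply/seteqP; split => w.
  move=> [h1 h2]; split; last by rewrite /= in_itv.
  by move=> j _; case: ifPn => // jk; rewrite /= in_itv /= andbT; exact: h1.
move=> [h1 h2]; split; last by move: h2; rewrite /= in_itv.
by move=> j jk; have := h1 j I; rewrite jk /= in_itv /= andbT.
Qed.

Lemma measurable_first_below x a k : measurable (first_below x a k).
Proof. by apply: (past_measurable HL (a := k%:R)); exact: past_first_below. Qed.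

Lemma trivIset_first_below x a : trivIset setT (first_below x a).
Proof.
apply/trivIsetP => i j _ _; wlog ij : i j / (i < j)%N.
  move=> H; rewrite neq_ltn => /orP[ij|ji]; first by apply: H => //; rewrite neq_ltn ij.
  by rewrite setIC; apply: H => //; rewrite neq_ltn ji.
move=> _; apply/seteqP; split => // w [[_ h1] [/(_ i ij) h2 _]].
by move: h1; rewrite ltNge h2.
Qed.

Lemma measurable_astray x a eta m : measurable (astray x a eta m).
Proof.
apply: measurableU.
  by apply: measurableC; apply: bigcupT_measurable => k; exact: measurable_first_below.
apply: bigcupT_measurable => k; apply: measurableI; first exact: measurable_first_below.
by apply: (past_measurable HL (a := k%:R + m%:R)); apply: (past_stray gam HL).
Qed.

Lemma astrayP x a eta m w : ~ astray x a eta m w ->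
  exists k, first_below x a k w /\
    forall s, 0 <= s <= m%:R -> `|L (k%:R + s) w - L k%:R w + gam * s| <= eta.
Proof.
move=> /not_orP[/contrapT [k _ fk] nb]; exists k; split => // s sm.
rewrite leNgt; apply/negP => h; apply: nb; exists k => //; split => //.
by exists s.
Qed.

Lemma never_below0 x a : Q (~` (\bigcup_k first_below x a k)) = 0%E.
Proof.
have mU : measurable (\bigcup_k first_below x a k).
  by apply: bigcupT_measurable => k; exact: measurable_first_below.
apply/eqP; rewrite eq_le measure_ge0 andbT.
apply/lee_addgt0Pr => del del0; rewrite add0e.
have g2 : 0 < gam / 2 by rewrite divr_gt0.
have [m0 H] := marginal_lln HL Psi_slope g2 del0.
(* For this [m], still being above [a] at time [m] forces [L m + gam * m > gam / 2 * m], a deviation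
   of small probability. *)
pose m := maxn m0 (Num.bound (2 * (x - a) / gam)).+1.
have := H m (leq_maxl _ _) m 0%N m%:R; rewrite divr1 => /(_ erefl (lexx _)).
apply: le_trans; have mL := levy_measurable HL (ler0n R m).
apply: le_measure; rewrite ?inE.
- exact: measurableC.
- apply: measurable_set_gt; apply: measurableT_comp => //.
  exact: measurable_funD.
move=> w nU /=; have za : a <= x + L m%:R w.
  rewrite leNgt; apply/negP => h; apply: nU.
  have ex : exists k, x + L k%:R w < a by exists m.
  have [k hk kmin] := ex_minnP ex; exists k => //; split => // j jk.
  by rewrite leNgt; apply: contraTN jk => /kmin; rewrite -leqNgt.
have mb : 2 * (x - a) < gam * m%:R.
  have [xa|xa] := ltP (x - a) 0.
    by have := ler0n R m; have := mulr_ge0 (ltW gam_gt0) (ler0n R m); lra.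
  have y0 : 0 <= 2 * (x - a) / gam by rewrite divr_ge0 ?mulr_ge0// ltW.
  have := archi_boundP y0; rewrite ltr_pdivrMr// [_ * gam]mulrC => h; apply: (lt_le_trans h).
  by rewrite ler_pM2l// ler_nat (leq_trans (leqnSn _))// leq_maxr.
apply: lt_le_trans (ler_norm _); lra.
Qed.

(** The maximal inequality relative to the past event [first_below x a k], summed over the disjoint
    [k], loses nothing; hence an [m0] uniform in the start [x] and the level [a]. *)
Lemma astray_bound (eps del : R) : 0 < eps -> 0 < del ->
  exists m0, forall m, (m0 <= m)%N -> forall x a,
    (Q (astray x a (eps * m%:R) m) <= del%:E)%E.
Proof.
move=> eps0 del0; have [m0 H] := pr_stray HL Psi_slope eps0 del0.
exists m0 => m mm x a.
have mF k : measurable (first_below x a k) by exact: measurable_first_below.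
have mS k : measurable (stray L gam (eps * m%:R) k%:R m%:R).
  by apply: (past_measurable HL (a := k%:R + m%:R)); apply: (past_stray gam HL).
have mFS k : measurable (first_below x a k `&` stray L gam (eps * m%:R) k%:R m%:R).
  exact: measurableI.
apply: (le_trans (measureU2 _ _ _)).
- by apply: measurableC; exact: bigcupT_measurable.
- exact: bigcupT_measurable.
rewrite /= never_below0 add0e.
apply: (le_trans (measure_sigma_subadditive _ mFS _ (@subset_refl _ _))).
  exact: bigcupT_measurable.
apply: (@le_trans _ _ (\sum_(0 <= k <oo) (del%:E * Q (first_below x a k))))%E.
  apply: lee_nneseries => // k _.
  have pf : past L k%:R (first_below x a k) by exact: past_first_below.
  have := H m mm k%:R _ (ler0n _ _) pf.
  by rewrite -lee_fin EFinM -!prE.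
rewrite nneseriesZl// (_ : (\sum_(0 <= k <oo) _)%E = Q (\bigcup_k first_below x a k)); last first.
  rewrite measure_bigcup//; last exact: trivIset_first_below.
  by apply: eq_eseriesl => k; rewrite in_setT.
rewrite -[leRHS]mule1; apply: lee_wpmul2l; first by rewrite lee_fin ltW.
by apply: probability_le1; exact: bigcupT_measurable.
Qed.

End passage.

(** * Joint measurability and the clock *)

Lemma emeasurable_fun_lt_set (R : realType) d (Om : measurableType d) (f : Om -> \bar R) :
  (forall y : R, measurable [set w | (f w < y%:E)%E]) -> measurable_fun setT f.
Proof.
move=> mf; apply: (measurability _ (ErealGenInftyO.measurableE R)) => _ /= -[_ [r ->] <-].
by rewrite setTI preimage_itvNyo.
Qed.

Section joint.
Context (R : realType) d (Om : measurableType d) (Q : probability Om R).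
Context (L : R -> Om -> R) (Psi : R -> R).
Hypothesis HL : is_levy Q L Psi.

Let pos (s : R) := Num.max 0 s.

Let pos_ge0 s : 0 <= pos s. Proof. by rewrite le_max lexx. Qed.

Let mpos : measurable_fun setT pos.
Proof. exact: measurable_maxr. Qed.

(** By right-continuity [L] is the limit of its values at the next dyadic time, strictly to the
    right. Freezing negative times at 0 makes the map total, as Tonelli's theorem needs. *)
Lemma measurable_levy_joint : measurable_fun setT (fun z : R * Om => L (Num.max 0 z.1) z.2).
Proof.
pose an n (s : R) := ((Num.truncn (pos s * (2 ^ n)%:R)).+1)%:R / (2 ^ n)%:R : R.
have p2 n : 0 < (2 ^ n)%:R :> R by rewrite ltr0n expn_gt0.
apply: (@measurable_fun_cvg _ _ _ _ (fun n z => L (an n z.1) z.2)).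
- move=> n _ B mB; rewrite setTI.
  rewrite (_ : _ @^-1` B = \bigcup_k (((fun s => pos s * (2 ^ n)%:R) @^-1` `[k%:R, k.+1%:R[)
     `*` (L (k.+1%:R / (2 ^ n)%:R) @^-1` B))).
    apply: bigcupT_measurable => k; apply: measurableX.
      rewrite -[X in measurable X]setTI; apply: (_ : measurable_fun setT (fun s => pos s * (2 ^ n)%:R)) => //.
      exact: measurable_funM.
    by rewrite -[X in measurable X]setTI; apply: (levy_measurable HL) => //; rewrite divr_ge0.
  apply/seteqP; split => -[s w] /=.
    move=> Bw; exists (Num.truncn (pos s * (2 ^ n)%:R)) => //; split => //=.
    by rewrite in_itv /=; apply: truncn_itv; rewrite mulr_ge0.
  by move=> [k _ [/= + Bw]]; rewrite in_itv /= => /truncn_def; rewrite /an => ->.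
- move=> [s w] _ /=; have cv : L x w @[x --> (pos s)^'+] --> L (pos s) w by exact: (levy_right_cont HL).
  apply: (cvg_trans _ cv); move=> A [e /= e0 He].
  have [N HN] : exists N : nat, forall n, (N <= n)%N -> (2 ^ n)%:R^-1 < e.
    exists (Num.bound e^-1) => n Nn.
    have h := archi_boundP (ltW (_ : 0 < e^-1)); rewrite invr_gt0 in h.
    rewrite -[ltRHS]invrK ltf_pV2 ?posrE ?invr_gt0//; apply: (lt_le_trans (h e0)).
    by rewrite ler_nat (leq_trans Nn)// ltnW// ltn_expl.
  exists N => // n /= Nn.
  have xn0 : 0 <= pos s * (2 ^ n)%:R by rewrite mulr_ge0.
  have /andP[t1 t2] := truncn_itv xn0.
  have a1 : pos s < an n s by rewrite ltr_pdivlMr.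
  have a2 : an n s <= pos s + (2 ^ n)%:R^-1.
    by rewrite ler_pdivrMr// mulrDl mulVf ?gt_eqF// -natr1 lerD2r.
  apply: He => //=; rewrite ltr_distlC; have := HN n Nn.
  by move=> h; apply/andP; split; lra.
Qed.

Lemma measurable_shift_joint (x : R) : measurable_fun setT (fun z : R * Om => x + L (Num.max 0 z.1) z.2).
Proof. by apply: measurable_funD => //; exact: measurable_levy_joint. Qed.

Lemma tau0_ge0 x w : (0 <= tau0 L x w)%E.
Proof.
by rewrite leNgt; apply/negP => /ereal_inf_ltP[_ [t [t0 _] <-]]; rewrite lte_fin ltNge t0.
Qed.

Lemma tau0_le x s w : 0 <= s -> x + L s w < 0 -> (tau0 L x w <= s%:E)%E.
Proof. by move=> s0 h; apply: ereal_inf_lbound; exists s. Qed.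

Lemma ge0_before_tau0 x s w : 0 <= s -> (s%:E < tau0 L x w)%E -> 0 <= x + L s w.
Proof. by move=> s0; rewrite leNgt; apply: contraTN => h; rewrite -leNgt tau0_le. Qed.

Lemma tau0_lt x (y : R) w : (tau0 L x w < y%:E)%E ->
  exists s, 0 <= s < y /\ x + L s w < 0.
Proof.
move=> /ereal_inf_ltP[_ [s [s0 h] <-]]; rewrite lte_fin => sy.
by exists s; rewrite s0 sy.
Qed.

Lemma right_open_lt x s w (y : R) : 0 <= s -> x + L s w < y ->
  exists2 e : R, 0 < e & forall t, s < t < s + e -> x + L t w < y.
Proof.
move=> s0 h; have cv : L x w @[x --> s^'+] --> L s w by exact: (levy_right_cont HL).
have op : open [set z : R | z < y - x] := @open_lt R (y - x).
have hs : [set z : R | z < y - x] (L s w) by rewrite /=; lra.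
have /cv [e /= e0 He] := open_nbhs_nbhs (conj op hs).
exists e => // t /andP[st te]; have := He t; rewrite /= ltr_distlC.
move=> /(_ _ st) ht; suff : L t w < y - x by lra.
by apply: ht; apply/andP; split; lra.
Qed.

Lemma measurable_tau0 x : measurable_fun setT (tau0 L x).
Proof.
apply: emeasurable_fun_lt_set => y.
rewrite (_ : [set w | _] = \bigcup_n \bigcup_k (if (k%:R / (2 ^ n)%:R < y) then
   [set w | x + L (k%:R / (2 ^ n)%:R) w < 0] else set0)).
  apply: bigcupT_measurable => n; apply: bigcupT_measurable => k; case: ifPn => // _.
  apply: measurable_set_lt; apply: measurable_funD => //.
  by apply: (levy_measurable HL); rewrite divr_ge0.
apply/seteqP; split => w /=.
  move=> /tau0_lt[s [/andP[s0 sy] h]].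
  have [e e0 He] := right_open_lt s0 h.
  have : s < Num.min (s + e) y by rewrite lt_min sy andbT ltrDl.
  move=> /(dyadic_between s0)[n [k /andP[h1]]]; rewrite lt_min => /andP[h2 h3].
  by exists n => //; exists k => //; rewrite h3; apply: He; rewrite h1.
move=> [n _ [k _]]; case: ifPn => // ky h.
by apply: (le_lt_trans (tau0_le _ h)); rewrite ?lte_fin// divr_ge0.
Qed.

Context (Rr : R -> R).
Hypothesis Rc : {within `[0%R, +oo[, continuous Rr}.
Hypothesis Rpos : forall x, 0 < x -> 0 < Rr x.

Lemma measurable_einv : measurable_fun setT (@einv R).
Proof.
apply: measurable_fun_if => //.
  by apply: measurable_funTS; exact: measurable_fun_eqr.
apply/measurable_EFinP.
have -> : [set: R] `&` (fun t : R => t == 0) @^-1` [set false] = [set t : R | t != 0].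
  by apply/seteqP; split => t /=; [move=> [_ ->]|move=> /negbTE].
apply: open_continuous_measurable_fun; first exact: open_neq.
by move=> t; rewrite inE /= => t0; exact: inv_continuous.
Qed.

Lemma measurable_einvR : measurable_fun setT (fun y : R => einv (Rr (Num.max 0 y))).
Proof.
have mR : measurable_fun (`[0, +oo[%classic : set R) Rr by apply: subspace_continuous_measurable_fun.
have sub : [set Num.max 0 x | x in [set: R]] `<=` `[0, +oo[.
  by move=> _ [y _ <-]; rewrite /= in_itv /= andbT.
have mI : measurable (`[0, +oo[ : set R) by [].
have := measurable_comp mI sub mR mpos.
exact: measurableT_comp measurable_einv.
Qed.

Lemma Rr0_ge0 : 0 <= Rr 0.
Proof.
have /continuous_within_itvcyP[_ cv] := Rc.
rewrite leNgt; apply/negP => R0.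
have /cv [e /= e0 He] := open_nbhs_nbhs (conj (@open_lt R 0) R0).
have e20 : 0 < e / 2 by rewrite divr_gt0.
have := He (e / 2); rewrite /= sub0r normrN gtr0_norm// => h.
have he : e / 2 < e by lra.
by have := h he e20; rewrite ltNge ltW// Rpos.
Qed.

Lemma Rr_ge0 x : 0 <= x -> 0 <= Rr x.
Proof. by rewrite le_eqVlt => /orP[/eqP <-|/Rpos/ltW//]; exact: Rr0_ge0. Qed.

Lemma einv_ge0 x : 0 <= x -> (0 <= einv (Rr x))%E.
Proof.
by move=> x0; rewrite /einv; case: eqP => // _; rewrite lee_fin invr_ge0 Rr_ge0.
Qed.

(** The integrand of [eta] extended by 0 to the whole product space. Where the test succeeds both
    truncations by [Num.max 0] are the identity; elsewhere they keep the arguments in the domain of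
    regularity. *)
Definition clock_rate (x : R) (z : R * Om) : \bar R :=
  if (0 <= z.1) && (z.1%:E < tau0 L x z.2)%E
  then einv (Rr (Num.max 0 (x + L (Num.max 0 z.1) z.2))) else 0%E.

Lemma clock_rate_ge0 x z : (0 <= clock_rate x z)%E.
Proof. by rewrite /clock_rate; case: ifP => // _; apply: einv_ge0; rewrite le_max lexx. Qed.

Lemma measurable_before_tau0 x :
  measurable_fun setT (fun z : R * Om => (0 <= z.1) && (z.1%:E < tau0 L x z.2)%E).
Proof.
apply: measurable_and.
  apply: measurable_fun_ler => //.
apply: measurable_fun_lte.
- by apply/measurable_EFinP.
- by apply: measurableT_comp; [exact: measurable_tau0|exact: measurable_snd].
Qed.

Lemma measurable_clock_rate x : measurable_fun setT (clock_rate x).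
Proof.
apply: measurable_fun_ifT => //; first exact: measurable_before_tau0.
apply: (measurableT_comp measurable_einvR); exact: measurable_shift_joint.
Qed.

Lemma etaE x s w : Defs.eta Rr L x s w =
  (\int[lebesgue_measure]_(r in [set r | (r <= s)%R]) clock_rate x (r, w))%E.
Proof.
rewrite /Defs.eta [LHS]integral_mkcond [RHS]integral_mkcond; apply: eq_integral => r _.
rewrite !patchE /clock_rate /=.
case: (ltP r%:E (tau0 L x w)) => [rt|tr]; last first.
  rewrite andbF if_same ifF//; apply/negbTE; rewrite notin_setE /= => -[_].
  by rewrite ltNge tr.
case: (boolP (0 <= r)) => [r0|r0]; last first.
  rewrite if_same ifF//; apply/negbTE; rewrite notin_setE /= => -[/andP[]].
  by rewrite (negbTE r0).
rewrite andbT (max_idPr r0) (max_idPr (ge0_before_tau0 r0 rt)).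
by congr (if _ then _ else _); apply/idP/idP; rewrite !inE /= r0 /= => // -[].
Qed.

Lemma measurable_eta x s : measurable_fun setT (Defs.eta Rr L x s).
Proof.
pose f (z : Om * R) : \bar R := if z.2 <= s then clock_rate x (z.2, z.1) else 0%E.
rewrite (_ : Defs.eta Rr L x s = fubini_F (@lebesgue_measure R) f).
  apply: measurable_fun_fubini_tonelli_F.
    apply: measurable_fun_ifT => //.
      exact: measurable_fun_ler.
    apply: measurableT_comp; first exact: measurable_clock_rate.
    by apply: measurable_fun_pair; [exact: measurable_snd|exact: measurable_fst].
  by move=> z; rewrite /f; case: ifP => // _; exact: clock_rate_ge0.
apply/funext => w; rewrite etaE /fubini_F [LHS]integral_mkcond.
apply: eq_integral => r _; rewrite patchE /f /=.
by congr (if _ then _ else _); apply/idP/idP; rewrite inE.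
Qed.

Lemma eta_nd x w s s' : s <= s' -> (Defs.eta Rr L x s w <= Defs.eta Rr L x s' w)%E.
Proof.
move=> ss'; rewrite !etaE.
have mc : measurable_fun setT (fun r => clock_rate x (r, w)).
  by apply: measurableT_comp; [exact: measurable_clock_rate|exact: pair2_measurable].
have mle c : measurable [set r : R | r <= c] by exact: (measurable_set_le (f := id)).
apply: ge0_subset_integral => //.
- exact: mle.
- exact: mle.
- exact: measurable_funTS.
- by move=> r _; exact: clock_rate_ge0.
- by move=> r /= /le_trans; apply.
Qed.

Lemma etainv_ge0 x t w : (0 <= etainv Rr L x t w)%E.
Proof.
by rewrite leNgt; apply/negP => /ereal_inf_ltP[_ [s [s0 _] <-]]; rewrite lte_fin ltNge s0.
Qed.

Lemma measurable_etainv x t : measurable_fun setT (etainv Rr L x t).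
Proof.
apply: emeasurable_fun_lt_set => y.
rewrite (_ : [set w | _] = \bigcup_n \bigcup_k (if (k%:R / (2 ^ n)%:R < y) then
   [set w | (t%:E < Defs.eta Rr L x (k%:R / (2 ^ n)%:R) w)%E] else set0)).
  apply: bigcupT_measurable => n; apply: bigcupT_measurable => k; case: ifPn => // _.
  rewrite -[X in measurable X]setTI; apply: emeasurable_fun_o_infty => //.
  exact: measurable_eta.
apply/seteqP; split => w /=.
  move=> /ereal_inf_ltP[_ [s [s0 h] <-]]; rewrite lte_fin => sy.
  have [n [k /andP[h1 h2]]] := dyadic_between s0 sy.
  exists n => //; exists k => //; rewrite h2 /=.
  by apply: (lt_le_trans h); apply: eta_nd; exact: ltW.
move=> [n _ [k _]]; case: ifPn => // ky h.
apply/ereal_inf_ltP; exists (k%:R / (2 ^ n)%:R)%:E; last by rewrite lte_fin.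
by exists (k%:R / (2 ^ n)%:R) => //; split => //; rewrite divr_ge0.
Qed.

Lemma measurable_Xtc x t : measurable_fun setT (Xtc Rr L x t).
Proof.
pose u w := mine (etainv Rr L x t w) (tau0 L x w).
have mu_ : measurable_fun setT u.
  by apply: measurable_mine; [exact: measurable_etainv|exact: measurable_tau0].
have u0 w : (0 <= u w)%E by rewrite le_min etainv_ge0 tau0_ge0.
rewrite (_ : Xtc Rr L x t = (fun w => if (u w < +oo)%E then
   (x + L (Num.max 0 (fine (u w))) w)%:E else +oo%E)).
  apply: measurable_fun_ifT => //; first exact: measurable_fun_lte.
  apply/measurable_EFinP; apply: measurable_funD => //.
  have mf : measurable_fun setT (fun w => (fine (u w), w)).
    apply: measurable_fun_pair => //.
    by apply: measurableT_comp => //; exact: fine_measurable.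
  exact: (measurableT_comp measurable_levy_joint mf).
apply/funext => w; rewrite /Xtc -/(u w); have := u0 w.
by case: (u w) => [r| |]//=; rewrite lee_fin => r0; rewrite ltry (max_idPr r0).
Qed.

Lemma Xlaw1E x (ts : 'I_1 -> R) (Bs : 'I_1 -> set \bar R) :
  Xlaw Q Rr L x ts Bs = Q (Xtc Rr L x (ts ord0) @^-1` Bs ord0).
Proof.
rewrite /Xlaw; congr (Q _); apply/seteqP; split => w; first exact.
by move=> h i; rewrite ord1.
Qed.

End joint.

(** * Occupation times *)

Lemma lebesgue_measure_shift (R : realType) (a : R) (A : set R) : measurable A ->
  lebesgue_measure ((fun x => a + x) @^-1` A) = lebesgue_measure A.
Proof.
have mT : measurable_fun setT (fun x : R => a + x) by exact: measurable_funD.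
move=> mA; apply/esym.
apply: (@lebesgue_measure_unique R (pushforward lebesgue_measure
  ((fun x => a + x) : measurableTypeR R -> measurableTypeR R))) => //= _ [[c e]] _ <-.
rewrite /pushforward.
have -> : (fun x : R => a + x) @^-1` `]c, e]%classic = `](c - a), (e - a)]%classic.
  by apply/seteqP; split => x /=; rewrite !in_itv /= => /andP[h1 h2]; apply/andP; split; lra.
rewrite !lebesgue_measure_itv/= !lte_fin ltrD2r; case: ifP => // _.
by rewrite -EFinB; congr EFin; ring.
Qed.

Lemma ge0_integral_shift (R : realType) (a : R) (D : set R) (f : R -> \bar R) :
  measurable D -> measurable_fun setT f -> (forall x, 0 <= f x)%E ->
  (\int[lebesgue_measure]_(x in D) f x =
   \int[lebesgue_measure]_(x in (fun x => a + x)%R @^-1` D) f (a + x)%R)%E.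
Proof.
move=> mD mf f0.
have mT : measurable_fun setT (fun x : R => a + x) by exact: measurable_funD.
transitivity (\int[pushforward lebesgue_measure
  ((fun x => a + x)%R : measurableTypeR R -> measurableTypeR R)]_(x in D) f x)%E.
  apply: eq_measure_integral => A mA _.
  by apply/esym; exact: lebesgue_measure_shift.
rewrite ge0_integral_pushforward//.
exact: measurable_funTS.
Qed.

(** Folds the half-line onto one period, which turns an occupation time into an average over phases
    of sums over integer steps. *)
Lemma ge0_integral_period_split (R : realType) (f : R -> \bar R) :
  measurable_fun setT f -> (forall x, 0 <= f x)%E -> (forall x, x < 0 -> f x = 0%E) ->
  (\int[lebesgue_measure]_x f x =
   \int[lebesgue_measure]_(r in `[0%R, 1%R[) \sum_(0 <= k <oo) f (k%:R + r)%R)%E.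
Proof.
move=> mf f0 fneg.
pose F (k : nat) : set R := `[k%:R, k.+1%:R[%classic.
have mF k : measurable (F k) by exact: measurable_itv.
have tF : trivIset setT F.
  apply/trivIsetP => i j _ _; wlog ij : i j / (i < j)%N.
    move=> H; rewrite neq_ltn => /orP[ij|ji]; first by apply: H => //; rewrite neq_ltn ij.
    by rewrite setIC; apply: H => //; rewrite neq_ltn ji.
  move=> _; apply/seteqP; split => // x []; rewrite /F /= !in_itv /= => /andP[_ h1] /andP[h2 _].
  by have := le_lt_trans h2 h1; rewrite ltr_nat ltnS leqNgt ij.
have UF : \bigcup_k F k = `[0, +oo[%classic.
  apply/seteqP; split => x /=; rewrite in_itv /= andbT.
    by move=> [k _]; rewrite /F /= in_itv /= => /andP[h _]; exact: le_trans h.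
  by move=> x0; exists (Num.truncn x) => //; rewrite /F /= in_itv /= truncn_itv.
transitivity (\int[lebesgue_measure]_(x in \bigcup_k F k) f x)%E.
  rewrite UF [RHS]integral_mkcond; apply: eq_integral => x _.
  rewrite patchE; case: ifPn => //; rewrite notin_setE /= in_itv /= andbT => /negP.
  by rewrite -ltNge => /fneg.
rewrite ge0_integral_bigcup//; last exact: measurable_funTS.
rewrite integral_nneseries//; last first.
  move=> n; apply: measurable_funTS; apply: measurableT_comp => //; exact: measurable_funD.
apply: eq_eseriesr => k _.
rewrite (ge0_integral_shift k%:R)//; congr integral.
apply/seteqP; split => x; rewrite /F /= !in_itv /= => /andP[h1 h2]; apply/andP;
  rewrite -natr1 in h2 *; split; lra.
Qed.

Lemma integral_cst_itv_co (R : realType) (p q K : R) : p <= q ->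
  (\int[lebesgue_measure]_(x in `[p, q[) (cst K%:E) x = (K * (q - p))%:E)%E.
Proof.
move=> pq; have mI : measurable (`[p, q[ : set R) by exact: measurable_itv.
rewrite (integral_cst (@lebesgue_measure R) mI) [X in (_ * X)%E](_ : _ = (q - p)%:E) ?EFinM//.
apply: (etrans (lebesgue_measure_itv `[p, q[)).
rewrite /= lte_fin; case: ifPn => [_|]; first by rewrite -EFinB.
by rewrite -leNgt => h; congr EFin; lra.
Qed.

Section occupation.
Context (R : realType) d (Om : measurableType d) (Q : probability Om R).
Context (L : R -> Om -> R) (Psi : R -> R) (gam : R).
Hypothesis HL : is_levy Q L Psi.

Definition occ (x c c' : R) (z : R * Om) : \bar R :=
  (((0 <= z.1) && (z.1%:E < tau0 L x z.2)%E &&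
   (c <= x + L (Num.max 0 z.1) z.2 < c')) %:R)%:E.

Lemma occ_ge0 x c c' z : (0 <= occ x c c' z)%E.
Proof. by rewrite /occ lee_fin ler0n. Qed.

Lemma measurable_occ x c c' : measurable_fun setT (occ x c c').
Proof.
pose g (b : bool) : \bar R := (b%:R)%:E.
have mg : measurable_fun setT g by [].
apply: (measurableT_comp mg).
have m1 := measurable_before_tau0 HL x.
have m2 := measurable_shift_joint HL x.
apply: measurable_and => //; apply: measurable_and.
  exact: measurable_fun_ler.
exact: measurable_fun_ltr.
Qed.

Lemma measurable_occ_time x c c' :
  measurable_fun setT (fun w => \int[lebesgue_measure]_s occ x c c' (s, w))%E.
Proof.
pose g (z : Om * R) := occ x c c' (z.2, z.1).
have mg : measurable_fun setT g.
  apply: (measurableT_comp (measurable_occ x c c')).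
  by apply: measurable_fun_pair; [exact: measurable_snd|exact: measurable_fst].
by apply: (measurable_fun_fubini_tonelli_F (m2 := @lebesgue_measure R) g mg) => z; exact: occ_ge0.
Qed.

(** After exchanging the integrals and folding time, the occupation at [k + r] implies [visit] at
    step [k] with phase [r], since being before [tau0] there makes all earlier values nonnegative.
    The phases have total mass 1. *)
Lemma occupation_bound (x c c' C : R) :
  (forall r n, 0 <= r -> \sum_(0 <= k < n) pr Q (visit L x r c c' k) <= C) ->
  (\int[Q]_w \int[lebesgue_measure]_s occ x c c' (s, w) <= C%:E)%E.
Proof.
move=> HC.
pose occ' (z : Om * R) := occ x c c' (z.2, z.1).
have mocc' : measurable_fun setT occ'.
  apply: (measurableT_comp (measurable_occ x c c')).
  by apply: measurable_fun_pair; [exact: measurable_snd|exact: measurable_fst].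
have -> : (\int[Q]_w \int[lebesgue_measure]_s occ x c c' (s, w) =
   \int[lebesgue_measure]_s \int[Q]_w occ' (w, s))%E.
  by rewrite -(fubini_tonelli (m1 := Q) (m2 := @lebesgue_measure R) occ' mocc')// => z; exact: occ_ge0.
pose f (s : R) : \bar R := (\int[Q]_w occ' (w, s))%E.
have mf : measurable_fun setT f.
  apply: (measurable_fun_fubini_tonelli_G (m1 := Q) occ' mocc') => z; exact: occ_ge0.
have f0 s : (0 <= f s)%E by apply: integral_ge0 => w _; exact: occ_ge0.
have fneg s : s < 0 -> f s = 0%E.
  move=> s0; rewrite /f integral0_eq// => w _; rewrite /occ' /occ /=.
  by rewrite leNgt s0.
rewrite (ge0_integral_period_split mf f0 fneg).
have mV r k : 0 <= r -> measurable (visit L x r c c' k) by exact: (measurable_visit HL).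
have fV r k : 0 <= r -> (f (k%:R + r)%R <= (pr Q (visit L x r c c' k))%:E)%E.
  move=> r0; rewrite -prE; last exact: mV.
  have <- : (\int[Q]_w (\1_(visit L x r c c' k) w)%:E = Q (visit L x r c c' k))%E.
    by rewrite integral_indic ?setIT//; exact: mV.
  apply: ge0_le_integral => //.
  - by move=> w _; exact: occ_ge0.
  - by apply: (measurableT_comp mocc'); exact: pair2_measurable.
  - by apply/measurable_EFinP; apply: measurable_indic; exact: mV.
  move=> w _; rewrite /occ' /occ /= lee_fin indicE ler_nat.
  have kr0 : 0 <= k%:R + r by rewrite addr_ge0.
  rewrite kr0 /=; case: (boolP (_ && _)) => //= /andP[tw].
  rewrite (max_idPr kr0) => Iw.
  suff -> : w \in visit L x r c c' k by [].
  rewrite inE; split; last by rewrite [r + _]addrC.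
  move=> j jk; apply: (ge0_before_tau0 (w := w)); first by rewrite addr_ge0.
  by apply: le_lt_trans tw; rewrite lee_fin addrC lerD2r ler_nat.
apply: (@le_trans _ _ (\int[lebesgue_measure]_(r in `[0%R, 1%R[) (cst C%:E) r)%E).
  apply: ge0_le_integral => //.
  - by move=> r _; apply: nneseries_ge0 => k _ _; exact: f0.
  - apply: ge0_emeasurable_sum => // k _; apply: measurable_funTS; apply: (measurableT_comp mf).
    exact: measurable_funD.
  - move=> r /=; rewrite in_itv /= => /andP[r0 _].
    apply: lime_le; first by apply: is_cvg_nneseries.
    apply: nearW => n; apply: (le_trans (lee_sum _ (fun k _ => fV r k r0))).
    by rewrite sumEFin lee_fin; exact: HC.
by rewrite integral_cst_itv_co// subr0 mulr1.
Qed.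

Context (Rr : R -> R).
Hypothesis Rc : {within `[0%R, +oo[, continuous Rr}.
Hypothesis Rpos : forall x, 0 < x -> 0 < Rr x.

Definition rate_above (x b : R) (z : R * Om) : \bar R :=
  if b <= x + L (Num.max 0 z.1) z.2 then clock_rate L Rr x z else 0%E.

Lemma rate_above_ge0 x b z : (0 <= rate_above x b z)%E.
Proof. by rewrite /rate_above; case: ifP => // _; exact: clock_rate_ge0. Qed.

Lemma measurable_rate_above x b : measurable_fun setT (rate_above x b).
Proof.
apply: measurable_fun_ifT => //; last exact: (measurable_clock_rate HL).
by apply: measurable_fun_ler => //; exact: (measurable_shift_joint HL).
Qed.

Definition time_above (x b : R) (w : Om) : \bar R :=
  (\int[lebesgue_measure]_s rate_above x b (s, w))%E.

Lemma measurable_rate_above_path x b w :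
  measurable_fun setT (fun s => rate_above x b (s, w)).
Proof. by apply: (measurableT_comp (measurable_rate_above x b)); exact: pair2_measurable. Qed.

Lemma time_above_ge0 x b w : (0 <= time_above x b w)%E.
Proof. by apply: integral_ge0 => s _; exact: rate_above_ge0. Qed.

Lemma measurable_time_above x b : measurable_fun setT (time_above x b).
Proof.
pose g (z : Om * R) := rate_above x b (z.2, z.1).
have mg : measurable_fun setT g.
  apply: (measurableT_comp (measurable_rate_above x b)).
  by apply: measurable_fun_pair; [exact: measurable_snd|exact: measurable_fst].
by apply: (measurable_fun_fubini_tonelli_F (m2 := @lebesgue_measure R) g mg) => z; exact: rate_above_ge0.
Qed.

Lemma mean_time_above (x b h K : R) (s C : nat -> R) : 0 < b -> 1 < h ->
  (forall n, 0 <= s n) ->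
  (forall n y, h ^+ n * b <= y < h * (h ^+ n * b) -> (Rr y)^-1 <= s n) ->
  (forall n r N, 0 <= r ->
     \sum_(0 <= k < N) pr Q (visit L x r (h ^+ n * b) (h * (h ^+ n * b)) k) <= C n) ->
  (forall N, \sum_(0 <= n < N) s n * C n <= K) ->
  (\int[Q]_w time_above x b w <= K%:E)%E.
Proof.
move=> b0 h1 s0 Hs HC HK.
pose c n := h ^+ n * b.
have moccp n w : measurable_fun setT (fun t => occ x (c n) (h * c n) (t, w)).
  by apply: (measurableT_comp (measurable_occ _ _ _)); exact: pair2_measurable.
have term0 n z : (0 <= (s n)%:E * occ x (c n) (h * c n) z)%E.
  by rewrite mule_ge0 ?occ_ge0// lee_fin.
(* Only the block containing the current value contributes a nonzero term, and that single term
   suffices. *)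
have pt z : (rate_above x b z <= \sum_(0 <= n <oo) ((s n)%:E * occ x (c n) (h * c n) z))%E.
  rewrite /rate_above; set y := x + _.
  case: ifPn => [by_|_]; last by apply: nneseries_ge0 => n _ _.
  rewrite /clock_rate; case: ifPn => [tz|_]; last by apply: nneseries_ge0 => n _ _.
  have y0 : 0 < y by exact: lt_le_trans by_.
  rewrite -/y (max_idPr (ltW y0)).
  have [n /andP[n1 n2]] := exists_geometric_block h1 b0 by_.
  apply: (@le_trans _ _ ((s n)%:E * occ x (c n) (h * c n) z)%E).
    rewrite /occ tz -/y n1 n2 /= mule1 /einv gt_eqF ?Rpos// lee_fin.
    by apply: Hs; rewrite n1.
  apply: le_trans (nneseries_lim_ge n.+1 _) => //.
  rewrite big_nat_recr//= -[leLHS]add0e; apply: leeD => //.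
  by apply: sume_ge0 => k _.
apply: (@le_trans _ _ (\int[Q]_w \sum_(0 <= n <oo) ((s n)%:E *
    \int[lebesgue_measure]_t occ x (c n) (h * c n) (t, w)))%E).
  apply: ge0_le_integral => //.
  - by move=> w _; exact: time_above_ge0.
  - exact: measurable_time_above.
  - apply: ge0_emeasurable_sum => //.
      by move=> n w _ _; rewrite mule_ge0// ?lee_fin// integral_ge0// => t _; exact: occ_ge0.
    move=> n _; apply: measurable_funeM.
    exact: measurable_occ_time.
  move=> w _.
  rewrite (_ : (\sum_(0 <= n <oo) _)%E = (\sum_(0 <= n <oo)
      \int[lebesgue_measure]_t ((s n)%:E * occ x (c n) (h * c n) (t, w)))%E); last first.
    apply: eq_eseriesr => n _; rewrite -ge0_integralZl_EFin//.
      by move=> t _; exact: occ_ge0.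
    exact: moccp.
  rewrite -integral_nneseries//; last by move=> n; apply: measurable_funeM; exact: moccp.
  apply: ge0_le_integral => //.
  - by move=> t _; exact: rate_above_ge0.
  - exact: measurable_rate_above_path.
  - by apply: ge0_emeasurable_sum => // n _; apply: measurable_funeM; exact: moccp.
rewrite integral_nneseries//; last 2 first.
- move=> n; apply: measurable_funeM.
  exact: measurable_occ_time.
- by move=> n w _; rewrite mule_ge0// ?lee_fin// integral_ge0// => t _; exact: occ_ge0.
apply: lime_le.
  apply: is_cvg_nneseries => n _ _; apply: integral_ge0 => w _.
  by rewrite mule_ge0// ?lee_fin// integral_ge0// => t _; exact: occ_ge0.
apply: nearW => N; apply: le_trans (_ : (\sum_(0 <= n < N) s n * C n)%:E <= _)%E; last first.
  by rewrite lee_fin.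
rewrite -sumEFin; apply: lee_sum => n _.
rewrite ge0_integralZl_EFin//; last 2 first.
- by move=> w _; apply: integral_ge0 => t _; exact: occ_ge0.
- exact: measurable_occ_time.
rewrite EFinM; apply: lee_wpmul2l; first by rewrite lee_fin.
by apply: occupation_bound => r M r0; exact: HC.
Qed.

End occupation.

(** * Windows after first passages *)

Section windows.
Context (R : realType) d (Om : measurableType d) (Q : probability Om R).
Context (L : R -> Om -> R) (Psi : R -> R) (gam : R).
Hypothesis HL : is_levy Q L Psi.
Hypothesis gam_gt0 : 0 < gam.
Context (Rr : R -> R).
Hypothesis Rc : {within `[0%R, +oo[, continuous Rr}.
Hypothesis Rpos : forall x, 0 < x -> 0 < Rr x.

Lemma above_first_below (x a b e : R) k w : 0 < b -> 0 <= e <= 1 -> b <= a ->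
  ~ dip L x b e w -> first_below L x a k w ->
  forall s : R, 0 <= s < k%:R -> (1 - e) * a <= x + L s w.
Proof.
move=> b0 /andP[e0 e1] ba nd [fk _] s /andP[s0 sk].
have /andP[j1 j2] := truncn_itv s0; set j := Num.truncn s in j1 j2.
have jk : (j < k)%N by rewrite -(ltr_nat R); exact: le_lt_trans sk.
have -> : s = j%:R + (s - j%:R) by ring.
apply: (@le_trans _ _ ((1 - e) * (x + L j%:R w))).
  by rewrite ler_wpM2l ?subr_ge0//; exact: fk.
apply: (dipP b0 e0 nd).
  by move=> i ij; apply: (le_trans ba); apply: fk; exact: leq_ltn_trans jk.
by rewrite -natr1 in j2; apply/andP; split; lra.
Qed.

(** The passage below [a] cannot overshoot much: the previous integer value is at least [a] and no
    dip occurs, so the path enters the window above [(1 - e1) * a]. It then follows its drift up to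
    [et] for [m] units of time. Starting above [a] makes the passage index positive, so that a
    previous integer exists. *)
Lemma window_path (x a c b e1 et : R) m w :
  0 < b -> 0 <= e1 <= 1 -> b <= a -> 0 <= et ->
  c <= (1 - e1) * a - gam * m%:R - et -> a <= x ->
  ~ dip L x b e1 w -> ~ astray L gam x a et m w ->
  exists k, [/\ first_below L x a k w,
    (forall s : R, 0 <= s <= k%:R + m%:R -> c <= x + L s w) &
    (forall s : R, k%:R <= s <= k%:R + m%:R -> x + L s w <= a + et)].
Proof.
move=> b0 e01 ba et0 hc ax nd /astrayP[k [fk hk]].
have ab := above_first_below b0 e01 ba nd fk.
have [fk1 fk2] := fk.
case/andP: (e01) => e0 e1'.
have gm : 0 <= gam * m%:R by rewrite mulr_ge0// ltW.
have k0 : (0 < k)%N.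
  rewrite lt0n; apply/eqP => k0; move: fk2; rewrite k0 (levy0 HL).
  by rewrite addr0 ltNge ax.
have Zk : (1 - e1) * a <= x + L k%:R w.
  have kE : (k%:R : R) = k.-1%:R + 1 by rewrite natr1 prednK.
  have k1 : (k.-1 < k)%N by rewrite prednK.
  rewrite kE; apply: (@le_trans _ _ ((1 - e1) * (x + L k.-1%:R w))).
    by rewrite ler_wpM2l ?subr_ge0//; exact: fk1.
  apply: (dipP b0 e0 nd); last by rewrite ler01 lexx.
  by move=> i ij; apply: (le_trans ba); apply: fk1; exact: leq_ltn_trans k1.
exists k; split => // s /andP[s1 s2].
- case: (ltP s k%:R) => [sk|ks].
    by apply: le_trans (ab s _); [lra|rewrite s1 sk].
  have := hk (s - k%:R).
  have -> : k%:R + (s - k%:R) = s by ring.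
  have -> : 0 <= s - k%:R <= m%:R by apply/andP; split; lra.
  move=> /(_ isT); rewrite ler_norml => /andP[h1 h2].
  have : gam * (s - k%:R) <= gam * m%:R by rewrite ler_wpM2l ?(ltW gam_gt0)//; lra.
  by lra.
- have := hk (s - k%:R).
  have -> : k%:R + (s - k%:R) = s by ring.
  have -> : 0 <= s - k%:R <= m%:R by apply/andP; split; lra.
  move=> /(_ isT); rewrite ler_norml => /andP[h1 h2].
  have : 0 <= gam * (s - k%:R) by rewrite mulr_ge0 ?(ltW gam_gt0)//; lra.
  by lra.
Qed.

Lemma lt_tau0 (x s : R) w : (forall r : R, 0 <= r <= s -> 0 <= x + L r w) ->
  (s%:E <= tau0 L x w)%E.
Proof.
move=> H; rewrite leNgt; apply/negP => /tau0_lt[r [/andP[r0 rs]]].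
by rewrite ltNge H// r0 ltW.
Qed.

Lemma measurable_clock_rate_path x w : measurable_fun setT (fun s => clock_rate L Rr x (s, w)).
Proof.
by apply: (measurableT_comp (measurable_clock_rate HL Rc x)); exact: pair2_measurable.
Qed.

Lemma eta_window (x T k m i : R) w : T < k -> 0 <= k -> 0 <= m -> 0 <= i ->
  (forall s : R, 0 <= s <= k + m -> 0 < x + L s w) ->
  (forall s : R, k <= s <= k + m -> i <= (Rr (x + L s w))^-1) ->
  (Defs.eta Rr L x T w + (m * i)%:E <= Defs.eta Rr L x (k + m) w)%E.
Proof.
move=> Tk k0 m0 i0 Zpos Hi; rewrite !etaE.
have mc := measurable_clock_rate_path x w.
have mI : measurable (`[k, (k + m)[ : set R) by exact: measurable_itv.
have mle e : measurable [set r : R | r <= e] by exact: (measurable_set_le (f := id)).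
apply: (@le_trans _ _ (\int[lebesgue_measure]_(r in ([set r | (r <= T)%R] `|` `[k, (k + m)%R[)%classic)
    clock_rate L Rr x (r, w))%E).
  rewrite ge0_integral_setU//=; last 4 first.
  - exact: mle.
  - exact: measurable_funTS.
  - by move=> s _; exact: clock_rate_ge0.
  - by apply/disj_setPS => s []; rewrite /= in_itv /= => h1 /andP[h2 _]; lra.
  apply: leeD => //.
  apply: (@le_trans _ _ (\int[lebesgue_measure]_(r in `[k, (k + m)%R[) (cst i%:E) r)%E).
    rewrite integral_cst_itv_co ?lerDl// lee_fin.
    by rewrite [k + m]addrC addrK mulrC.
  apply: ge0_le_integral => //.
  - exact: measurable_funTS.
  move=> s; rewrite /= in_itv /= => /andP[s1 s2].
  have s0 : 0 <= s by lra.
  rewrite /clock_rate /= s0 /=.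
  have -> : (s%:E < tau0 L x w)%E.
    apply: (@lt_le_trans _ _ (k + m)%:E); first by rewrite lte_fin.
    by apply: lt_tau0 => r hr; exact/ltW/Zpos.
  rewrite (max_idPr s0).
  have zp : 0 < x + L s w by apply: Zpos; rewrite s0 ltW.
  rewrite (max_idPr (ltW zp)) /einv gt_eqF ?Rpos// lee_fin.
  by apply: Hi; rewrite s1 ltW.
apply: ge0_subset_integral => //.
- exact: (measurableU _ _ (mle T) mI).
- exact: mle.
- exact: measurable_funTS.
- by move=> s _; exact: clock_rate_ge0.
by move=> s [|] /=; rewrite ?in_itv /=; lra.
Qed.

Context (c i : nat -> R) (m : nat -> nat) (b e1 e2 : R).

Definition good (x : R) n : set Om :=
  ~` (dip L x b e1 `|` astray L gam x (c n.+1) (e2 * (m n)%:R) (m n)).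

Lemma measurable_good x n : measurable (good x n).
Proof.
by apply: measurableC; apply: measurableU; [exact: (measurable_dip HL)|exact: (measurable_astray gam HL)].
Qed.

Definition window_sum (x : R) N w : R :=
  \sum_(0 <= n < N) \1_(good x n) w * ((m n)%:R * i n).

(* The windows are disjoint in time: [Z] stays above [c n.+1] during all windows
   of higher level, and window [n] opens below [c n.+1]. *)
Lemma window_sum_eta x N w : 0 < b -> 0 <= e1 <= 1 -> 0 <= e2 ->
  b <= c 0%N -> (forall n, c n <= c n.+1) -> (forall n, 0 <= i n) ->
  (forall n y, c n <= y <= c n.+2 -> i n <= (Rr y)^-1) ->
  (forall n, c n <= (1 - e1) * c n.+1 - gam * (m n)%:R - e2 * (m n)%:R) ->
  (forall n, c n.+1 + e2 * (m n)%:R <= c n.+2) ->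
  c N <= x ->
  exists T : R, [/\ 0 <= T, (forall s : R, 0 <= s <= T -> b <= x + L s w) &
    ((window_sum x N w)%:E <= Defs.eta Rr L x T w)%E].
Proof.
move=> b0 e01 e20 bc0 cS i0 Hi Hm1 Hm2 cNx.
have cmono : {homo c : n p / (n <= p)%N >-> n <= p}.
  by apply: homo_leq => //; exact: le_trans.
have bc n : b <= c n by apply: (le_trans bc0); exact: cmono.
(* The induction goes down in level, which is forward in time: [T] is the end of the last window
   used, and the path is above the current level up to [T]. *)
suff H j : (j <= N)%N -> exists T : R, [/\ 0 <= T,
    (forall s : R, 0 <= s <= T -> c (N - j)%N <= x + L s w) &
    ((\sum_(N - j <= n < N) \1_(good x n) w * ((m n)%:R * i n))%:E <= Defs.eta Rr L x T w)%E].
  have [T [T0 T1 T2]] := H N (leqnn N).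
  rewrite subnn in T1 T2; exists T; split => // s hs.
  by apply: le_trans (T1 s hs); exact: bc.
elim: j => [_|j IH jN].
  exists 0; split => //.
    move=> s; rewrite subn0 => /andP[s1 s2].
    have -> : s = 0 by lra.
    by rewrite (levy0 HL) addr0.
  rewrite subn0 big_geq// etaE; apply: integral_ge0 => s _; exact: clock_rate_ge0.
have [T [T0 T1 T2]] := IH (ltnW jN).
set n := (N - j.+1)%N.
have nE : (N - j = n.+1)%N by rewrite /n; lia.
have nN : (n < N)%N by rewrite /n; lia.
rewrite nE in T1 T2.
rewrite big_ltn//.
(* On a bad level the indicator is 0, so its window is skipped and [T] is kept. *)
case: (pselect (good x n w)) => [gd|ngd]; last first.
  exists T; split => //.
    by move=> s hs; apply: le_trans (T1 s hs); exact: cS.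
  by rewrite indicE memNset// mul0r add0r.
rewrite indicE mem_set// mul1r.
have [nd na] : ~ dip L x b e1 w /\ ~ astray L gam x (c n.+1) (e2 * (m n)%:R) (m n) w.
  by split => h; apply: gd; [left|right].
have cx : c n.+1 <= x by apply: (le_trans _ cNx); exact: cmono.
have em : 0 <= e2 * (m n)%:R by rewrite mulr_ge0.
have [k [fk hk1 hk2]] := window_path b0 e01 (bc n.+1) em (Hm1 n) cx nd na.
have Tk : T < k%:R.
  rewrite ltNge; apply/negP => kT; have := T1 k%:R.
  by rewrite kT ler0n => /(_ isT); rewrite leNgt; case: fk => _ ->.
exists (k%:R + (m n)%:R); split => //.
rewrite addrC EFinD; apply: le_trans (eta_window (T := T) _ _ _ _ _ _) => //.
- exact: leeD.
- move=> s /hk1; apply: lt_le_trans; exact: lt_le_trans (bc n).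
- move=> s hs; apply: Hi; rewrite hk1; last by move: hs => /andP[h1 ->]; rewrite (le_trans _ h1).
  exact: le_trans (hk2 s hs) (Hm2 n).
Qed.

Lemma Xtc_ge_window (x u T : R) w : 0 < b -> 0 <= u -> 0 <= T ->
  (forall s : R, 0 <= s <= T -> b <= x + L s w) ->
  (u%:E < Defs.eta Rr L x T w)%E -> (b%:E <= Xtc Rr L x u w)%E.
Proof.
move=> b0 u0 T0 hT uT.
have h1 : (etainv Rr L x u w <= T%:E)%E.
  by apply: ereal_inf_lbound; exists T.
have h2 : (T%:E <= tau0 L x w)%E.
  by apply: lt_tau0 => r hr; apply: le_trans (hT r hr); exact: ltW.
have e0 : (0 <= etainv Rr L x u w)%E by exact: etainv_ge0.
rewrite /Xtc min_l; last exact: le_trans h2.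
move: h1 e0; case: (etainv Rr L x u w) => [v| |]//; rewrite !lee_fin => v1 v2.
by rewrite hT// v2.
Qed.

Lemma eta_le_time_above (x b' T : R) w :
  (forall s : R, 0 <= s <= T -> b' <= x + L s w) ->
  (Defs.eta Rr L x T w <= time_above L Rr x b' w)%E.
Proof.
move=> HT; rewrite etaE integral_mkcond; apply: ge0_le_integral => //.
- by move=> s _; rewrite patchE; case: ifP => // _; exact: clock_rate_ge0.
- apply/(measurable_restrictT _ _).1 => //.
    exact: (measurable_set_le (f := id)).
  by apply: measurable_funTS; exact: measurable_clock_rate_path.
- exact: (measurable_rate_above_path HL Rc).
move=> s _; rewrite patchE; case: ifPn => [|_]; last exact: rate_above_ge0.
rewrite inE /= => sT.
case: (leP 0 s) => s0; last first.
  have -> : clock_rate L Rr x (s, w) = 0%E by rewrite /clock_rate /= lt_geF.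
  exact: rate_above_ge0.
by rewrite /rate_above /= (max_idPr s0) HT// s0.
Qed.

End windows.

(** * The function phi *)

(** For [x >= 1] the integrand obeys [x * min (z / x) (z^2 / x^2) <= min z (z^2)], whose integral is
    finite. The bound lets integrability of [1 / (x Psi(1/x) R(x))] pass to [1 / R]. *)
Lemma lapexp_le_linear (R : realType) (gam sig : R) (pi : {measure set R -> \bar R}) :
  levy_measure_cond pi ->
  exists2 C : R, 0 < C & forall x : R, 1 <= x -> x * lapexp gam sig pi x^-1 <= C.
Proof.
move=> Hpi.
pose M := fine (\int[pi]_(z in `]0%R, +oo[) (Num.min z (z ^+ 2))%:E)%E.
have mmin : measurable_fun setT (fun z : R => Num.min z (z ^+ 2)).
  by apply: measurable_minr => //; exact: measurable_funX.
have min0 (z : R) : 0 < z -> 0 <= Num.min z (z ^+ 2) by move=> z0; rewrite le_min ltW// sqr_ge0.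
have I0 : (0 <= \int[pi]_(z in `]0%R, +oo[) (Num.min z (z ^+ 2))%:E)%E.
  by apply: integral_ge0 => z /=; rewrite in_itv /= andbT => z0; rewrite lee_fin min0.
have ME : (\int[pi]_(z in `]0%R, +oo[) (Num.min z (z ^+ 2))%:E = M%:E)%E.
  by rewrite fineK// ge0_fin_numE//; case: Hpi.
have M0 : 0 <= M by exact: fine_ge0.
exists (`|gam| + sig ^+ 2 / 2 + M + 1) => [|x x1].
  by rewrite ltr_pwDr// !addr_ge0// divr_ge0// sqr_ge0.
have x0 : 0 < x by exact: lt_le_trans x1.
rewrite /lapexp; set I := (\int[pi]_(z in _) _)%E.
have mg lam : measurable_fun setT (fun z : R => expR (- (lam * z)) - 1 + lam * z).
  apply: measurable_funD; last exact: measurable_funM.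
  apply: measurable_funB => //; apply: measurableT_comp => //.
  by apply: measurableT_comp => //; exact: measurable_funM.
have g0 (z : R) : 0 < z -> 0 <= expR (- (x^-1 * z)) - 1 + x^-1 * z <= Num.min (x^-1 * z) ((x^-1 * z) ^+ 2).
  by move=> z0; apply: expRN_sub1D_bound; rewrite mulr_ge0 ?invr_ge0 ?ltW.
have IM : (x%:E * I <= M%:E)%E.
  rewrite -ME -ge0_integralZl_EFin//; last 3 first.
  - by move=> z /=; rewrite in_itv /= andbT => /g0/andP[]; rewrite lee_fin.
  - by apply/measurable_EFinP; exact: measurable_funTS.
  - exact: ltW.
  apply: ge0_le_integral => //.
  - by move=> z /=; rewrite in_itv /= andbT => /g0/andP[h _]; rewrite lee_fin mulr_ge0// ltW.
  - by apply/measurable_EFinP; apply: measurable_funTS; apply: measurable_funM.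
  - by apply/measurable_EFinP; exact: measurable_funTS.
  move=> z /=; rewrite in_itv /= andbT => z0; rewrite lee_fin.
  have /andP[_] := g0 z z0; rewrite le_min => /andP[h1 h2].
  rewrite le_min; apply/andP; split.
    apply: (@le_trans _ _ (x * (x^-1 * z))); first by rewrite ler_pM2l.
    by rewrite mulrA divff ?gt_eqF// mul1r.
  apply: (@le_trans _ _ (x * (x^-1 * z) ^+ 2)); first by rewrite ler_pM2l.
  rewrite (_ : _ * _ = z ^+ 2 / x); last by field; rewrite gt_eqF.
  by rewrite ler_pdivrMr// ler_peMr// sqr_ge0.
have II0 : (0 <= I)%E.
  by apply: integral_ge0 => z /=; rewrite in_itv /= andbT => /g0/andP[]; rewrite lee_fin.
have xI : x * fine I <= M.
  move: IM II0; case: (I) => [r| |] //=.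
  by move=> _ _; rewrite mulr0.
rewrite !mulrDr.
have -> : x * (gam * x^-1) = gam by field; rewrite gt_eqF.
have h : x * (sig ^+ 2 / 2 * x^-1 ^+ 2) <= sig ^+ 2 / 2.
  rewrite (_ : _ * _ = sig ^+ 2 / 2 / x); last by field; rewrite gt_eqF.
  by rewrite ler_pdivrMr// ler_peMr// divr_ge0// sqr_ge0.
have := ler_norm gam; lra.
Qed.

Section phi.
Context (R : realType) (Rr : R -> R) (gam : R).
Hypothesis gam_gt0 : 0 < gam.
Hypothesis Rc : {within `[0%R, +oo[, continuous Rr}.
Hypothesis Rpos : forall x, 0 < x -> 0 < Rr x.

Let rate (y : R) : \bar R := einv (Rr (Num.max 0 y)).

Let mrate : measurable_fun setT rate.
Proof. exact: measurable_einvR. Qed.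

Let rateE (y : R) : 0 < y -> rate y = ((Rr y)^-1)%:E.
Proof. by move=> y0; rewrite /rate (max_idPr (ltW y0)) /einv gt_eqF// Rpos. Qed.

Let rate_ge0 (y : R) : (0 <= rate y)%E.
Proof. by apply: einv_ge0 => //; rewrite le_max lexx. Qed.

Let tail (p : R) : \bar R := (\int[lebesgue_measure]_(x in `[p, +oo[) ((Rr x)^-1)%:E)%E.

Let tailE (p : R) : 0 < p -> tail p = (\int[lebesgue_measure]_(x in `[p, +oo[) rate x)%E.
Proof.
move=> p0; apply: eq_integral => x; rewrite inE /= in_itv /= andbT => px.
by rewrite rateE// (lt_le_trans p0).
Qed.

Let tail_ge0 (p : R) : 0 < p -> (0 <= tail p)%E.
Proof. by move=> p0; rewrite tailE//; apply: integral_ge0 => x _. Qed.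

Let tail_split (p q : R) : 0 < p -> p <= q ->
  tail p = (\int[lebesgue_measure]_(x in `[p, q[) rate x + tail q)%E.
Proof.
move=> p0 pq; rewrite !tailE//; last exact: lt_le_trans pq.
rewrite -(@ge0_integral_setU _ _ _ lebesgue_measure)//.
- by congr (integral _ _ _); rewrite -itv_bndbnd_setU// bnd_simp.
- exact: measurable_funTS.
- by apply/disj_setPS => x []; rewrite /= !in_itv /= => /andP[_ h1] /andP[h2 _]; lra.
Qed.

Let integral_rate_le (p q K : R) : 0 < p -> p <= q ->
  (forall x, p <= x < q -> (Rr x)^-1 <= K) ->
  (\int[lebesgue_measure]_(x in `[p, q[) rate x <= (K * (q - p))%:E)%E.
Proof.
move=> p0 pq HK; have mI : measurable (`[p, q[ : set R)%classic by exact: measurable_itv.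
apply: (@le_trans _ _ (\int[lebesgue_measure]_(x in `[p, q[) (cst K%:E) x)%E); last first.
  by rewrite integral_cst_itv_co.
have rK x : (`[p, q[ : set R)%classic x -> (rate x <= K%:E)%E.
  rewrite /= in_itv /= => hx; rewrite rateE ?lee_fin ?HK//.
  by move: hx => /andP[h _]; exact: lt_le_trans h.
by apply: ge0_le_integral => //; exact: measurable_funTS.
Qed.

Let integral_rate_ge (p q K : R) : 0 < p -> p <= q -> 0 <= K ->
  (forall x, p <= x < q -> K <= (Rr x)^-1) ->
  ((K * (q - p))%:E <= \int[lebesgue_measure]_(x in `[p, q[) rate x)%E.
Proof.
move=> p0 pq K0 HK; have mI : measurable (`[p, q[ : set R)%classic by exact: measurable_itv.
apply: (@le_trans _ _ (\int[lebesgue_measure]_(x in `[p, q[) (cst K%:E) x)%E).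
  by rewrite integral_cst_itv_co.
have rK x : (`[p, q[ : set R)%classic x -> (K%:E <= rate x)%E.
  rewrite /= in_itv /= => hx; rewrite rateE ?lee_fin ?HK//.
  by move: hx => /andP[h _]; exact: lt_le_trans h.
by apply: ge0_le_integral => //; exact: measurable_funTS.
Qed.

Lemma rate_bounds (p q : R) : 0 < p -> p <= q ->
  exists2 k : R, 0 < k & exists2 K : R, 0 < K &
    forall x, p <= x <= q -> k <= (Rr x)^-1 <= K.
Proof.
move=> p0 pq.
have cpq : {within `[p, q], continuous Rr}.
  apply: continuous_subspaceW Rc => x; rewrite /= !in_itv /= andbT => /andP[h _].
  exact: (le_trans (ltW p0)).
have [u + Hu] := EVT_max pq cpq; have [v + Hv] := EVT_min pq cpq.
rewrite !in_itv /= => /andP[pv _] /andP[pu _].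
have u0 : 0 < Rr u by apply: Rpos; exact: lt_le_trans pu.
have v0 : 0 < Rr v by apply: Rpos; exact: lt_le_trans pv.
exists (Rr u)^-1; first by rewrite invr_gt0.
exists (Rr v)^-1; first by rewrite invr_gt0.
move=> x hx; have x0 : 0 < Rr x by apply: Rpos; apply: (lt_le_trans p0); case/andP: hx.
by apply/andP; split; rewrite lef_pV2 ?posrE//; [exact: Hu|exact: Hv].
Qed.

Hypothesis tail_fin0 : exists2 a : R, 0 < a & (tail a < +oo)%E.

Let tail_fin (p : R) : 0 < p -> tail p \is a fin_num.
Proof.
move=> p0; have [a a0 ta] := tail_fin0.
rewrite ge0_fin_numE ?tail_ge0//.
case: (leP p a) => [pa|/ltW ap].
  have [k _ [K _ HK]] := rate_bounds p0 pa.
  rewrite (tail_split p0 pa) lte_add_pinfty//.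
  apply: le_lt_trans (ltry (K * (a - p))); apply: integral_rate_le => // x /andP[h1 h2].
  by have /andP[] := HK x (introT andP (conj h1 (ltW h2))).
apply: le_lt_trans ta; rewrite (tail_split a0 ap) -[leLHS]add0e; apply: leeD => //.
by apply: integral_ge0.
Qed.

Local Notation ph := (phi gam Rr).

Let phiB (p q : R) : 0 < p -> p <= q ->
  (\int[lebesgue_measure]_(x in `[p, q[) rate x = (gam * (ph p - ph q))%:E)%E.
Proof.
move=> p0 pq; have q0 : 0 < q by exact: lt_le_trans pq.
have tp := tail_fin p0; have tq := tail_fin q0.
have E : gam * (ph p - ph q) = fine (tail p) - fine (tail q).
  by rewrite /phi -/(tail p) -/(tail q); field; rewrite gt_eqF.
rewrite E EFinB !fineK// (tail_split p0 pq) addeK//.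
Qed.

Lemma phi_le_of_rate_le (p q K : R) : 0 < p -> p <= q ->
  (forall x, p <= x < q -> (Rr x)^-1 <= K) -> gam * (ph p - ph q) <= K * (q - p).
Proof. by move=> p0 pq HK; rewrite -lee_fin -phiB//; exact: integral_rate_le. Qed.

Lemma phi_ge_of_rate_ge (p q K : R) : 0 < p -> p <= q -> 0 <= K ->
  (forall x, p <= x < q -> K <= (Rr x)^-1) -> K * (q - p) <= gam * (ph p - ph q).
Proof. by move=> p0 pq K0 HK; rewrite -lee_fin -phiB//; exact: integral_rate_ge. Qed.

Lemma phi_lt (p q : R) : 0 < p -> p < q -> ph q < ph p.
Proof.
move=> p0 pq; have [k k0 [K _ HK]] := rate_bounds p0 (ltW pq).
have : k * (q - p) <= gam * (ph p - ph q).
  apply: phi_ge_of_rate_ge => //; [exact: ltW|exact: ltW|move=> x /andP[h1 h2]].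
  by have /andP[] := HK x (introT andP (conj h1 (ltW h2))).
have : 0 < k * (q - p) by rewrite mulr_gt0// subr_gt0.
by move=> h1 h2; have := lt_le_trans h1 h2; rewrite pmulr_rgt0// subr_gt0.
Qed.

Lemma phi_le (p q : R) : 0 < p -> p <= q -> ph q <= ph p.
Proof. by move=> p0; rewrite le_eqVlt => /predU1P[->//|/(phi_lt p0)/ltW]. Qed.

Lemma phi_gt0 (p : R) : 0 < p -> 0 < ph p.
Proof.
move=> p0; apply: le_lt_trans (phi_lt p0 (ltr_pwDr ltr01 (lexx p))).
by rewrite divr_ge0 ?(ltW gam_gt0)// fine_ge0// tail_ge0// addr_gt0.
Qed.

Lemma phi_cvg0 (e : R) : 0 < e -> exists2 b0, 0 < b0 & forall b, b0 <= b -> ph b < e.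
Proof.
move=> e0.
have cv : (fun n : nat => \int[lebesgue_measure]_(x in `[1%R, n.+1%:R%R[) rate x)%E @ \oo --> tail 1.
  have -> : tail 1 = (\int[lebesgue_measure]_(x in \bigcup_n `[1%R, n.+1%:R[%classic) rate x)%E.
    rewrite tailE//; congr (integral _ _ _); apply/seteqP; split => x.
      rewrite /= in_itv /= andbT => x1.
      exists (Num.truncn x) => //; rewrite /= in_itv /= x1 /=.
      by have /andP[_] := truncn_itv (le_trans ler01 x1).
    by move=> [n _]; rewrite /= !in_itv /= andbT => /andP[].
  apply: (ge0_nondecreasing_set_cvg_integral (mu := @lebesgue_measure R)) => //.
  - move=> m n mn; apply/subsetPset => x; rewrite /= !in_itv /= => /andP[-> h] /=.
    by apply: (lt_le_trans h); rewrite ler_nat.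
  - by move=> n; exact: measurable_funTS.
have /fine_cvgP[_ /cvgrPdist_lt] : (fun n : nat => (gam * (ph 1 - ph n.+1%:R))%:E) @ \oo --> (gam * ph 1)%:E.
  have -> : (gam * ph 1)%:E = tail 1.
    rewrite /phi -/(tail 1) mulrC divfK ?gt_eqF// fineK//; exact: tail_fin.
  by under eq_fun => n do rewrite -phiB ?ler1n//.
move=> /(_ _ (mulr_gt0 gam_gt0 e0))[N _ HN].
exists N.+1%:R => // b Nb; have := HN N (leqnn N).
rewrite /= (_ : _ - _ = gam * ph N.+1%:R); last by ring.
rewrite ger0_norm; last by rewrite mulr_ge0 ?(ltW gam_gt0)// ltW// phi_gt0.
rewrite ltr_pM2l//; apply: le_lt_trans; exact: phi_le.
Qed.

Lemma phi_continuous (p q : R) : 0 < p -> p <= q -> {within `[p, q], continuous ph}.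
Proof.
move=> p0 pq; have [k _ [K K0 HK]] := rate_bounds p0 pq.
have lip x y : p <= x -> x <= y -> y <= q -> 0 <= ph x - ph y <= K / gam * (y - x).
  move=> px xy yq; have x0 := lt_le_trans p0 px.
  rewrite subr_ge0 phi_le//= mulrAC ler_pdivlMr// mulrC.
  apply: phi_le_of_rate_le => // z /andP[h1 h2].
  by have /andP[] := HK z (introT andP (conj (le_trans px h1) (le_trans (ltW h2) yq))).
have C0 : 0 < K / gam by rewrite divr_gt0.
apply/subspace_continuousP => x; rewrite /= in_itv /= => /andP[px xq].
apply/cvgrPdist_le => e e0; rewrite near_withinE; near=> y; rewrite /= in_itv /= => /andP[py yq].
have xy : `|x - y| <= e / (K / gam).
  near: y; apply/nbhs_ballP; exists (e / (K / gam)); first by rewrite /= divr_gt0.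
  by move=> y /=; rewrite /ball /= => /ltW.
rewrite ler_pdivlMr// mulrC in xy; apply: le_trans xy.
case: (leP x y) => [h|/ltW h].
  by have /andP[h1 h2] := lip x y px h yq; rewrite ger0_norm// distrC ger0_norm// subr_ge0.
have /andP[h1 h2] := lip y x py h xq.
by rewrite distrC ger0_norm// [`|x - y|]ger0_norm// subr_ge0.
Unshelve. all: by end_near.
Qed.

(** [phiinv] chooses a preimage with default value 0, so existence is needed, from the intermediate
    value theorem and [phi_cvg0]; strict monotonicity then locates whichever preimage is chosen. *)
Lemma phiinvP (b0 : R) : 0 < b0 -> forall t, 0 < t <= ph b0 ->
  b0 <= phiinv ph t /\ ph (phiinv ph t) = t.
Proof.
move=> b00 t /andP[t0 tb].
have [b1 b10 /(_ _ (lexx _)) hb1] := phi_cvg0 t0.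
have b01 : b0 <= b1.
  rewrite leNgt; apply/negP => b1b0; have := phi_lt b10 b1b0.
  by move=> h; have := lt_le_trans (lt_trans h hb1) tb; rewrite ltxx.
have [c] : exists2 c, c \in `[b0, b1] & ph c = t.
  apply: IVT => //; first exact: phi_continuous.
  by rewrite ge_min le_max tb (ltW hb1) orbT.
rewrite in_itv /= => /andP[b0c _] phc.
have [h1 h2] : [set b | 0 < b /\ ph b = t] (phiinv ph t).
  by apply: xgetPex; exists c; split => //; exact: lt_le_trans b0c.
split => //; rewrite leNgt; apply/negP => h3.
by have := phi_lt h1 h3; rewrite h2 ltNge tb.
Qed.

End phi.

(** * Regularity of the rate *)

(* The library version asks for measurability, which is not known for the
   kernel of the entrance process. *)
Lemma ge0_le_integral_nonmeasurable d (T : measurableType d) (R : realType)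
    (mu : {measure set T -> \bar R}) (D : set T) (f g : T -> \bar R) :
  (forall x, D x -> 0 <= f x <= g x)%E ->
  (\int[mu]_(x in D) f x <= \int[mu]_(x in D) g x)%E.
Proof.
move=> fg; rewrite [leLHS]integral_mkcond [leRHS]integral_mkcond.
have fg' x : (0 <= (f \_ D) x <= (g \_ D) x)%E.
  by rewrite !patchE; case: ifPn => [|_]; [rewrite inE; exact: fg|rewrite !lexx].
rewrite !ge0_integralTE; last 2 first.
- by move=> x; case/andP: (fg' x) => /le_trans; apply.
- by move=> x; case/andP: (fg' x).
apply: ereal_sup_le => _ [h hf <-]; exists h => // x.
by apply: le_trans (hf x) _; case/andP: (fg' x).
Qed.

(** The factor [x * lapexp gam sig pi x^-1] lies between [gam] and a constant for [x >= 1]: the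
    lower bound gives the sign of the integrand, the upper bound the comparison with [1 / R]. *)
Lemma tail_fin_of_entrance (R : realType) (gam sig : R) (pi : {measure set R -> \bar R})
    (Rr : R -> R) : 0 < gam -> levy_measure_cond pi ->
  {within `[0%R, +oo[, continuous Rr} -> (forall x, 0 < x -> 0 < Rr x) ->
  (exists a : R, 0 < a /\
     (\int[lebesgue_measure]_(x in `[a, +oo[)
        ((x * lapexp gam sig pi x^-1 * Rr x)^-1)%:E < +oo)%E) ->
  exists2 a : R, 0 < a & (\int[lebesgue_measure]_(x in `[a, +oo[) ((Rr x)^-1)%:E < +oo)%E.
Proof.
move=> gam0 Hpi Rc Rpos [a [a0 Ha]].
have [C C0 HC] := lapexp_le_linear gam sig Hpi.
pose b := Num.max a 1.
have ba : a <= b by rewrite le_max lexx.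
have b1 : 1 <= b by rewrite le_max lexx orbT.
have b0 : 0 < b by exact: lt_le_trans b1.
exists b => //.
pose f x := ((x * lapexp gam sig pi x^-1 * Rr x)^-1)%:E.
have xP x : 0 < x -> gam <= x * lapexp gam sig pi x^-1.
  move=> x0; have xi : 0 <= x^-1 by rewrite invr_ge0 ltW.
  have := lapexp_ge gam sig pi xi; rewrite subr_ge0 => h.
  by have := ler_wpM2l (ltW x0) h; rewrite mulrCA divff ?mulr1// gt_eqF.
have mI : measurable (`[b, +oo[ : set R) by exact: measurable_itv.
have bx (x : R) : b <= x -> 0 < x by exact: lt_le_trans.
have mr : measurable_fun (`[b, +oo[ : set R) (fun x => ((Rr x)^-1)%:E).
  apply: (@eq_measurable_fun _ _ _ _ _ (fun y : R => einv (Rr (Num.max 0 y)))).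
    move=> x; rewrite inE /= in_itv /= andbT => /bx x0.
    by rewrite (max_idPr (ltW x0)) /einv gt_eqF// Rpos.
  by apply: measurable_funTS; exact: measurable_einvR.
have r0 x : (`[b, +oo[ : set R)%classic x -> (0 <= ((Rr x)^-1)%:E)%E.
  by rewrite /= in_itv /= andbT => /bx x0; rewrite lee_fin invr_ge0 ltW// Rpos.
have : (C^-1%:E * \int[lebesgue_measure]_(x in `[b, +oo[) ((Rr x)^-1)%:E < +oo)%E.
  apply: le_lt_trans Ha; rewrite -ge0_integralZl_EFin//; last by rewrite invr_ge0 ltW.
  rewrite [leLHS]integral_mkcond [leRHS]integral_mkcond.
  apply: ge0_le_integral_nonmeasurable => x _; rewrite !patchE.
  have fx : a <= x -> (0 <= f x)%E.
    move=> ax; have x0 : 0 < x by exact: lt_le_trans ax.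
    rewrite lee_fin invr_ge0 mulr_ge0//; last exact/ltW/Rpos.
    by apply: le_trans (xP x x0); exact: ltW.
  case: ifPn => [|_]; last first.
    by rewrite lexx /=; case: ifPn => //; rewrite inE /= in_itv /= andbT => /fx.
  rewrite inE /= in_itv /= andbT => hx; have x0 := bx x hx.
  rewrite mem_set /= ?in_itv /= ?andbT ?(le_trans ba)//.
  have Rx := Rpos x x0; have Px := lt_le_trans gam0 (xP x x0).
  rewrite -EFinM !lee_fin mulr_ge0 ?invr_ge0 ?(ltW C0) ?(ltW Rx)//=.
  rewrite invfM ler_pM2r ?invr_gt0// lef_pV2 ?posrE//.
  by apply: HC; exact: le_trans b1 hx.
have := integral_ge0 lebesgue_measure r0.
case: (integral _ _ _) => [r _ _| |] //=; first exact: ltry.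
by rewrite gt0_muley// lte_fin invr_gt0.
Qed.

Section regularity.
Context (R : realType) (Rr : R -> R) (ph : R -> R).

(** One value [r] of the parameter rho suffices: a displacement [d] equals [r * z] with [z = d / r],
    and the supremum defining [Vfun Rr z r] covers [x] as soon as [z0 <= z <= x]. The lower bound
    [h * x <= y] is what makes [z] large. *)
Lemma H3_ratio (v : R) : H3 Rr -> (forall x, 0 < x -> 0 < Rr x) -> 0 < v ->
  exists2 h0 : R, 1 < h0 & forall h, 1 < h <= h0 ->
  exists2 z0 : R, 0 < z0 & forall x y, z0 <= x -> h * x <= y <= h ^+ 4 * x ->
    (Rr y)^-1 <= (1 + v) * (Rr x)^-1.
Proof.
move=> [delta [delta0 [Vc]]] + Rpos v0.
rewrite limf_esupE => V0.
have /ereal_inf_lt[_ [U + <-] HU] : (ereal_inf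
    [set ereal_sup ((fun rho => lim (Vfun Rr z rho @[z --> +oo%R])) @` V) | V in 0^'+] < v%:E)%E.
  by rewrite V0 lte_fin.
move=> /nbhs_ballP[e /= e0 eU].
pose r := Num.min (e / 2) (delta / 2).
have r0 : 0 < r by rewrite lt_min !divr_gt0.
have re : r < e by rewrite gt_min; apply/orP; left; lra.
have rd : r < delta by rewrite gt_min; apply/orP; right; lra.
have Ur : U r.
  by apply: eU => //=; rewrite /ball /= sub0r normrN gtr0_norm.
have lV : (lim (Vfun Rr z r @[z --> +oo%R]) < v%:E)%E.
  by apply: le_lt_trans HU; apply: ereal_sup_ubound; exists r.
have [z1 [z1r Hz1]] : exists z1, z1 \is Num.real /\ forall z, z1 < z -> (Vfun Rr z r < v%:E)%E.
  have := Vc r; rewrite r0 rd => /(_ isT) cv.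
  have : \forall z \near +oo%R, (Vfun Rr z r < v%:E)%E.
    exact: (cv _ (open_ereal_lt' lV)).
  by [].
pose z0 := Num.max 1 (z1 + 1).
have z00 : 0 < z0 by rewrite lt_max ltr01.
have Hd x d : z0 <= x -> r * z0 <= d <= r * x -> (Rr (x + d))^-1 <= (1 + v) * (Rr x)^-1.
  move=> zx /andP[d1 d2].
  pose z := d / r.
  have zz : z0 <= z by rewrite ler_pdivlMr// mulrC.
  have zx' : z <= x by rewrite ler_pdivrMr// mulrC.
  have dE : d = r * z by rewrite /z mulrC divfK// gt_eqF.
  have x0 : 0 < x by exact: lt_le_trans zx.
  have d0 : 0 < d by rewrite dE mulr_gt0// (lt_le_trans z00).
  have z1z : z1 < z by apply: lt_le_trans zz; rewrite lt_max ltrDl ltr01 orbT.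
  have : ((Num.max (Rr x / Rr (x + r * z) - 1) 0)%:E <= v%:E)%E.
    apply: le_trans (ltW (Hz1 z z1z)); apply: ereal_sup_ubound; exists x => //.
  rewrite -dE lee_fin ge_max => /andP[h _].
  have p1 := Rpos x x0; have p2 := Rpos (x + d) (addr_gt0 x0 d0).
  rewrite ler_pdivlMr//; rewrite mulrC; lra.
(* For [h <= 2], the factor [h ^+ 3 + h ^+ 2 + h + 1] of [h ^+ 4 - 1] is at most 15, so the largest
   displacement is at most [r * x]. *)
pose h0 := 1 + Num.min 1 (r / 15).
have m0 : 0 < Num.min 1 (r / 15) by rewrite lt_min ltr01 divr_gt0.
exists h0; first by rewrite ltrDl.
move=> h /andP[h1 hh0].
exists (Num.max z0 (r * z0 / (h - 1))); first by rewrite lt_max z00.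
move=> x y; rewrite ge_max => /andP[zx zx2] /andP[y1 y2].
have x0 : 0 < x by exact: lt_le_trans zx.
have -> : y = x + (y - x) by ring.
apply: Hd => //; rewrite ler_pdivrMr ?subr_gt0// in zx2; apply/andP; split; first by lra.
have hm : h - 1 <= Num.min 1 (r / 15) by rewrite /h0 in hh0; lra.
rewrite le_min in hm; case/andP: hm => hm1 hm2.
have h4 : h ^+ 4 - 1 <= r.
  have -> : h ^+ 4 - 1 = (h - 1) * (h ^+ 3 + h ^+ 2 + h + 1) by ring.
  have h2 : h <= 2 by lra.
  have hh : h ^+ 2 <= 4 by rewrite expr2; nra.
  have hhh : h ^+ 3 <= 8 by rewrite exprS; nra.
  have : (h - 1) * (h ^+ 3 + h ^+ 2 + h + 1) <= (h - 1) * 15 by rewrite ler_wpM2l//; lra.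
  by lra.
apply: (@le_trans _ _ ((h ^+ 4 - 1) * x)); first by lra.
by rewrite ler_wpM2r// ltW.
Qed.

Lemma H1_ratio (e h0 : R) : H1 ph -> 0 < e -> 1 < h0 ->
  exists2 h : R, 1 < h <= h0 &
  exists2 x0 : R, 0 < x0 & forall x, x0 <= x -> 1 - e <= ph (h * x) / ph x.
Proof.
move=> + e0 h01; rewrite /H1 limf_esupE => HH.
have /ereal_sup_gtP[_ [h + <-]] : ((1 - e)%:E < ereal_sup
    ((fun h => limf_einf (fun x : R => (ph (h * x) / ph x)%:E) (pinfty_nbhs R)) @`
       `]1%R, h0]%classic))%E.
  apply: (@lt_le_trans _ _ 1%E); first by rewrite lte_fin; lra.
  (* A limsup equal to 1 bounds from below the supremum over each right neighbourhood of 1, so some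
     [h] in []1, h0]] comes within [e] of it. *)
  rewrite -[leLHS]HH; apply: ereal_inf_lbound.
  exists `]1%R, h0]%classic => //.
  have : \forall t \near 1^'+, `]1%R, h0]%classic t.
    near=> t; rewrite /= in_itv /=; apply/andP; split; near: t.
      exact: nbhs_right_gt.
    exact: nbhs_right_ltW.
  by [].
rewrite /= in_itv /= => hh.
rewrite limf_einfE => /ereal_sup_gtP[_ [U + <-] HU].
move=> [M [Mr HM]]; exists h => //.
exists (Num.max 1 (M + 1)); first by rewrite lt_max ltr01.
move=> x; rewrite ge_max => /andP[x1 x2].
rewrite -lee_fin; apply: le_trans (ltW HU) _; apply: ereal_inf_lbound.
by exists x => //; apply: HM; lra.
Unshelve. all: by end_near. Qed.

Lemma H2_ratio (h : R) : H2 ph -> 1 < h ->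
  exists2 k : R, 0 < k &
  exists2 x0 : R, 0 < x0 & forall x, x0 <= x -> 1 + k <= ph x / ph (h * x).
Proof.
move=> HH h1; have := HH h h1; rewrite limf_einfE => /ereal_sup_gtP[_ [U + <-] HU].
move=> [M [Mr HM]].
have H x : M < x -> (ereal_inf [set (ph x / ph (h * x))%:E | x in U] <= (ph x / ph (h * x))%:E)%E.
  by move=> Mx; apply: ereal_inf_lbound; exists x => //; exact: HM.
set I := ereal_inf _ in HU H.
have [r Ir] : exists r, I = r%:E.
  have := H (M + 1) (ltr_pwDr ltr01 (lexx M)).
  by move: HU; case: (I) => // r _ _; exists r.
rewrite Ir lte_fin in HU.
exists (r - 1); first by lra.
exists (Num.max 1 (M + 1)); first by rewrite lt_max ltr01.
move=> x; rewrite ge_max => /andP[x1 x2].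
have := H x; rewrite Ir lee_fin => h2.
by rewrite addrC subrK; apply: h2; lra.
Qed.

End regularity.

(** * Concentration of the clock and of the time-changed process *)

Section indicator_sums.
Context (R : realType) d (Om : measurableType d) (Q : probability Om R).
Context (G : nat -> set Om) (a : nat -> R) (N : nat) (del : R).
Hypothesis mG : forall n, measurable (G n).
Hypothesis a0 : forall n, 0 <= a n.
Hypothesis QG : forall n, (n < N)%N -> pr Q (~` G n) <= del.

Let S w := \sum_(0 <= n < N) \1_(G n) w * a n.
Let W := \sum_(0 <= n < N) a n.

Let expectation_indic_sum (H : nat -> set Om) : (forall n, measurable (H n)) ->
  (\int[Q]_w (\sum_(0 <= n < N) \1_(H n) w * a n)%:E = (\sum_(0 <= n < N) a n * pr Q (H n))%:E)%E.
Proof.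
move=> mH; under eq_integral do rewrite -sumEFin.
have mi n : measurable_fun setT (fun w => (\1_(H n) w * a n)%:E).
  by apply/measurable_EFinP; apply: measurable_funM => //; exact: measurable_indic.
rewrite ge0_integral_sum//; last by move=> n w _; rewrite lee_fin mulr_ge0// indicE.
rewrite -sumEFin; apply: eq_bigr => n _.
under eq_integral do rewrite mulrC EFinM.
rewrite ge0_integralZl_EFin//; last by apply/measurable_EFinP; exact: measurable_indic.
by rewrite integral_indic// setIT EFinM -prE.
Qed.

Lemma measurable_indic_sum : measurable_fun setT S.
Proof.
apply: measurable_sum => n; apply: measurable_funM => //; exact: measurable_indic.
Qed.

(** Markov's inequality for the missing mass [W - S], the same sum over the complements of the
    [G n]. *)
Lemma indic_sum_deficit (t : R) : 0 < t ->
  (Q [set w | (S w <= W - t)%R] <= (del * W / t)%:E)%E.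
Proof.
move=> t0.
pose D w := \sum_(0 <= n < N) \1_(~` G n) w * a n.
have DE w : D w = W - S w.
  rewrite /D /W /S -sumrB; apply: eq_bigr => n _.
  by rewrite !indicE in_setC; case: (w \in G n) => /=; ring.
have mD : measurable_fun setT D.
  by apply: measurable_sum => n; apply: measurable_funM => //; apply: measurable_indic; exact: measurableC.
have D0 w : 0 <= D w by apply: sumr_ge0 => n _; rewrite mulr_ge0// indicE.
have -> : [set w | (S w <= W - t)%R] = [set w | (t%:E <= (EFin \o D) w)%E].
  by apply/seteqP; split => w /=; rewrite lee_fin DE; lra.
have mk := @markov_ge0 _ _ _ Q (EFin \o D) t _ _ (ltW t0).
have {}mk := mk ((measurable_EFinP _ _).2 mD) (fun w => D0 w).
have mS : measurable [set w | (t%:E <= (EFin \o D) w)%E].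
  rewrite (_ : [set w | _] = [set w | t <= D w]); first exact: measurable_set_ge.
  by apply/seteqP; split => w /=; rewrite lee_fin.
rewrite prE// lee_fin ler_pdivlMr// mulrC -lee_fin EFinM -prE//.
apply: (le_trans mk); rewrite /= expectation_indic_sum; last by move=> n; exact: measurableC.
rewrite lee_fin /W big_distrr /= big_seq_cond [leRHS]big_seq_cond; apply: ler_sum => n.
by rewrite mem_index_iota andbT => /andP[_ nN]; rewrite mulrC ler_wpM2r// QG.
Qed.

(** Where [A > W + t] one has [A >= S + t], because [S <= W]; so [S + t * \1_F <= A] everywhere.
    Taking means, [t * pr F] is at most [K] minus the mean of [S]. *)
Lemma indic_sum_excess (A : Om -> \bar R) (K t : R) : measurable_fun setT A ->
  (\int[Q]_w A w <= K%:E)%E -> (forall w, (S w)%:E <= A w)%E -> 0 < t ->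
  (Q [set w | (W + t)%:E < A w]%E <= ((K - (1 - del) * W) / t)%:E)%E.
Proof.
move=> mA AK SA t0; set F := [set w | _].
have mF : measurable F by rewrite /F -[X in measurable X]setTI; exact: emeasurable_fun_o_infty.
have S0 w : 0 <= S w by apply: sumr_ge0 => n _; rewrite mulr_ge0// indicE.
have SW w : S w <= W by apply: ler_sum => n _; rewrite ler_piMl// indicE; case: (_ \in _).
rewrite prE// lee_fin ler_pdivlMr//.
suff : (\int[Q]_w (S w + t * \1_F w)%:E <= K%:E)%E.
  under eq_integral do rewrite EFinD.
  rewrite ge0_integralD//; last 4 first.
  - by move=> w _; rewrite lee_fin.
  - by apply/measurable_EFinP; exact: measurable_indic_sum.
  - by move=> w _; rewrite lee_fin mulr_ge0// ?ltW// indicE.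
  - by apply/measurable_EFinP; apply: measurable_funM => //; exact: measurable_indic.
  under [X in (_ + X)%E]eq_integral do rewrite EFinM.
  rewrite ge0_integralZl_EFin//; last 2 first.
  - by apply/measurable_EFinP; exact: measurable_indic.
  - exact: ltW.
  rewrite [X in (_ + t%:E * X)%E](_ : _ = (pr Q F)%:E); last first.
    by rewrite integral_indic// setIT; exact: prE.
  rewrite expectation_indic_sum// -EFinM -EFinD lee_fin.
  have : (1 - del) * W <= \sum_(0 <= n < N) a n * pr Q (G n).
    rewrite /W big_distrr /= big_seq_cond [leRHS]big_seq_cond; apply: ler_sum => n.
    rewrite mem_index_iota andbT => /andP[_ nN]; rewrite mulrC ler_wpM2l//.
    have := QG nN; have : pr Q setT = pr Q (G n) + pr Q (~` G n).
      by rewrite -[~` _]setTD -[X in _ = pr Q X + _]setTI; exact: prID.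
    by rewrite {1}/pr probability_setT /=; lra.
  by rewrite [pr Q F * t]mulrC; lra.
apply: le_trans AK; apply: ge0_le_integral => //.
- by move=> w _; rewrite lee_fin addr_ge0// mulr_ge0 ?indicE// ltW.
- apply/measurable_EFinP; apply: measurable_funD; first exact: measurable_indic_sum.
  by apply: measurable_funM => //; exact: measurable_indic.
move=> w _; rewrite indicE; case: (boolP (w \in F)) => [|_]; last by rewrite mulr0 addr0.
by rewrite inE /F /= mulr1 => /ltW; apply: le_trans; rewrite lee_fin lerD2r.
Qed.

End indicator_sums.

Lemma window_length (R : realType) (gam h e b : R) : 0 < gam -> 1 < h -> 0 < e <= 1 -> 0 < b ->
  1 <= e / 2 * ((h - 1) * b / gam) ->
  exists m : nat -> nat, forall n,
   [/\ h ^+ n * b <= (1 - e / 4 * (h - 1) / h) * (h ^+ n.+1 * b) - gam * (m n)%:R - gam * e / 4 * (m n)%:R,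
       h ^+ n.+1 * b + gam * e / 4 * (m n)%:R <= h ^+ n.+2 * b,
       (1 - e) * ((h - 1) * (h ^+ n * b) / gam) <= (m n)%:R &
       (m n)%:R <= (h - 1) * (h ^+ n * b) / gam].
Proof.
move=> g0 h1 /andP[e0 e1] b0 hb.
have h0 : 0 < h by lra.
pose l n := (h - 1) * (h ^+ n * b) / gam.
(* [l n] is the time to cross block [n] at speed [gam]. The factor [r] leaves room for straying,
   [e / 4] of the drift, and for the dip at the passage, [e / 4] of the block width; the hypothesis
   on [b] pays for rounding down. *)
pose r := (1 - e / 4) / (1 + e / 4).
exists (fun n => Num.truncn (r * l n)) => n.
have hn1 : 1 <= h ^+ n by rewrite exprn_ege1// ltW.
have hn0 : 0 < h ^+ n by rewrite exprn_gt0.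
have l0 : 0 < l n by rewrite divr_gt0// mulr_gt0 ?mulr_gt0// subr_gt0.
have e4 : 0 < 1 + e / 4 by lra.
have r0 : 0 <= r by apply: divr_ge0; lra.
have r1 : r <= 1 by rewrite ler_pdivrMr//; lra.
have r2 : 1 - e / 2 <= r by rewrite ler_pdivlMr//; nra.
have /andP[t1 t2] := truncn_itv (mulr_ge0 r0 (ltW l0)).
set m := (Num.truncn _)%:R in t1 t2 *; rewrite -natr1 -/m in t2.
have m0 : 0 <= m by exact: ler0n.
have gl : gam * l n = (h - 1) * (h ^+ n * b) by rewrite /l; field; rewrite gt_eqF.
have gm : gam * m * (1 + e / 4) <= (1 - e / 4) * ((h - 1) * (h ^+ n * b)).
  rewrite -gl; have -> : (1 - e / 4) * (gam * l n) = gam * (r * l n) * (1 + e / 4).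
    have re : r * (1 + e / 4) = 1 - e / 4 by rewrite /r divfK// gt_eqF.
    by rewrite -re; ring.
  by rewrite ler_pM2r// ler_pM2l.
have ml : m <= l n by apply: (le_trans t1); rewrite ler_piMl// ltW.
have gml : gam * m <= (h - 1) * (h ^+ n * b) by rewrite -gl ler_pM2l.
have u0 : 0 < h ^+ n * b by rewrite mulr_gt0.
split => //.
- have -> : (1 - e / 4 * (h - 1) / h) * (h ^+ n.+1 * b) = h ^+ n * b + (1 - e / 4) * ((h - 1) * (h ^+ n * b)).
    by rewrite exprS; field; rewrite gt_eqF.
  by lra.
- have -> : h ^+ n.+2 * b = h ^+ n.+1 * b + h * ((h - 1) * (h ^+ n * b)) by rewrite !exprS; ring.
  rewrite lerD2l; have : gam * m * (e / 4) <= gam * m by rewrite ler_piMr ?mulr_ge0 ?(ltW g0)//; lra.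
  have : (h - 1) * (h ^+ n * b) <= h * ((h - 1) * (h ^+ n * b)).
    by rewrite ler_peMl ?(ltW h1)// mulr_ge0 ?(ltW u0)//; lra.
  by lra.
- have le1 : 1 <= e / 2 * l n.
    apply: (le_trans hb); rewrite ler_pM2l; last by lra.
    rewrite /l ler_pM2r ?invr_gt0// ler_pM2l ?subr_gt0// ler_peMl//; exact: ltW.
  have : (1 - e / 2) * l n <= r * l n by rewrite ler_pM2r.
  by rewrite -/(l n); lra.
Qed.

(** * Arithmetic of the error constants *)

Lemma quartic_bounds (R : realType) (a : R) : 0 <= a <= 1 / 20 ->
  (1 + a) ^+ 4 <= (1 + 20 * a) * (1 - a) ^+ 2 /\ (1 - 20 * a) * (1 + a) ^+ 4 <= (1 - a) ^+ 5.
Proof.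
move=> /andP[a0 a1].
have a2 : a * a <= a / 20 by nra.
have h2 : (1 + a) ^+ 2 <= 1 + 41 / 20 * a by rewrite expr2; nra.
have h20 : 0 <= (1 + a) ^+ 2 by exact: sqr_ge0.
have h4 : (1 + a) ^+ 4 <= 1 + 5 * a.
  rewrite (_ : (1 + a) ^+ 4 = (1 + a) ^+ 2 * (1 + a) ^+ 2); last by ring.
  by nra.
have g2 : 1 - 2 * a <= (1 - a) ^+ 2 by rewrite expr2; nra.
have g5 : 1 - 5 * a <= (1 - a) ^+ 5.
  have g4 : 1 - 4 * a <= (1 - a) ^+ 2 * (1 - a) ^+ 2 by nra.
  by rewrite (_ : (1 - a) ^+ 5 = (1 - a) ^+ 2 * (1 - a) ^+ 2 * (1 - a)); [nra|ring].
by split; nra.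
Qed.

Lemma mean_constant (R : realType) (a h F P : R) : 0 <= a <= 1 / 20 -> 1 < h <= 1 + a ->
  (1 - a) ^+ 2 * P <= F -> 0 <= P ->
  (1 + a) * (1 + a) * h ^+ 2 * P <= (1 + 20 * a) * F.
Proof.
move=> ha /andP[h1 hha] PF P0; have [qb _] := quartic_bounds ha.
case/andP: ha => a0 a1.
have h2a : h ^+ 2 <= (1 + a) ^+ 2 by rewrite ler_pXn2r ?nnegrE//; lra.
apply: (@le_trans _ _ ((1 + a) ^+ 4 * P)).
  apply: ler_wpM2r => //; rewrite (_ : (1 + a) ^+ 4 = (1 + a) * (1 + a) * (1 + a) ^+ 2); last by ring.
  by apply: ler_wpM2l => //; rewrite mulr_ge0; lra.
apply: (@le_trans _ _ ((1 + 20 * a) * (1 - a) ^+ 2 * P)); first exact: ler_wpM2r.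
by rewrite -mulrA; apply: ler_wpM2l => //; lra.
Qed.

Lemma weight_constant (R : realType) (a h F F' x : R) : 0 <= a <= 1 / 20 -> 1 < h <= 1 + a -> 0 <= F ->
  (1 - a) ^+ 3 * F <= F' -> x <= a * F' ->
  (1 - 20 * a) * F <= (1 - a) / ((1 + a) * h ^+ 3) * (F' - x).
Proof.
move=> ha /andP[h1 hha] F0 FF' xF'; have [_ qb] := quartic_bounds ha.
case/andP: ha => a0 a1.
have h3a : h ^+ 3 <= (1 + a) ^+ 3 by rewrite ler_pXn2r ?nnegrE//; lra.
have h30 : 0 < h ^+ 3 by rewrite exprn_gt0//; lra.
have p0 : 0 < (1 + a) * h ^+ 3 by rewrite mulr_gt0//; lra.
rewrite mulrAC ler_pdivlMr//.
apply: (@le_trans _ _ ((1 - 20 * a) * F * (1 + a) ^+ 4)).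
  apply: ler_wpM2l; first by rewrite mulr_ge0//; lra.
  by rewrite [leRHS]exprS; apply: ler_wpM2l => //; lra.
apply: (@le_trans _ _ ((1 - a) ^+ 5 * F)); first by rewrite mulrAC; exact: ler_wpM2r.
rewrite (_ : (1 - a) ^+ 5 * F = (1 - a) * ((1 - a) * ((1 - a) ^+ 3 * F))); last by ring.
apply: ler_wpM2l; first by lra.
apply: (@le_trans _ _ ((1 - a) * F')); first by apply: ler_wpM2l => //; lra.
by lra.
Qed.

Lemma excess_constant (R : realType) (K F W a : R) : 0 <= a <= 1 -> 0 <= F ->
  K <= (1 + a) * F -> (1 - a) * F <= W -> K - (1 - a) * W <= 8 * a * F.
Proof.
move=> /andP[a0 a1] F0 KF WF; have a1' : 0 <= 1 - a by lra.
have := ler_wpM2l a1' WF; have aF : 0 <= a * F by rewrite mulr_ge0.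
have : 0 <= a * (a * F) by rewrite mulr_ge0.
by lra.
Qed.

Lemma deficit_constant (R : realType) (F W a e : R) : 0 <= F -> a <= e / 2 ->
  (1 - a) * F <= W -> (1 - e) * F <= W - e / 2 * F.
Proof.
by move=> F0 ae WF; have := ler_wpM2r F0 ae; lra.
Qed.

(** With [m] about [2 * b1 / gam], where [b1 = b / (1 - e / 4)], the drift carries the path from
    [b1] to below 0 within [m], even after straying, while the straying itself stays below a small
    multiple of [b]. *)
Lemma exists_horizon (R : realType) (gam b e : R) (m0 : nat) :
  0 < gam -> 0 < e <= 1 -> gam <= b -> gam * m0%:R <= b ->
  exists m, [/\ (m0 <= m)%N,
    b / (1 - e / 4) + gam * e / 32 * m%:R <= (1 + e) * b &
    b / (1 - e / 4) + gam * e / 32 * m%:R < gam * m%:R].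
Proof.
move=> gam0 /andP[e0 e1] bg bm0.
have b0 : 0 < b by lra.
have p1 : 0 < 1 - e / 4 by lra.
set b1 := b / (1 - e / 4).
have bb1 : b <= b1 by rewrite ler_pdivlMr// ler_piMr ?(ltW b0)//; lra.
have h0 : 0 <= e * b * (2 - e) by rewrite !mulr_ge0 ?(ltW e0) ?(ltW b0)//; lra.
have b1b : b1 <= (1 + e / 2) * b by rewrite ler_pdivrMr//; lra.
have b10 : 0 < b1 by lra.
have z0 : 0 <= 2 * b1 / gam by rewrite divr_ge0 ?(ltW gam0)// mulr_ge0// ltW.
have /andP[t1 t2] := truncn_itv z0.
set m := (Num.truncn (2 * b1 / gam)).+1 in t2.
rewrite ltr_pdivrMr// mulrC in t2.
have t3 : gam * m%:R <= 4 * b1.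
  by move: t1; rewrite ler_pdivlMr// => t1; rewrite /m -natr1; lra.
have em : gam * e / 32 * m%:R = gam * m%:R * (e / 32) by ring.
have eb : e * b1 <= 2 * (e * b) by nra.
have eg : e * (gam * m%:R) <= 4 * (e * b1) by nra.
have eb1 : e * b1 <= b1 by nra.
exists m; rewrite em; split; [|lra|lra].
by rewrite -(ler_nat R) -(ler_pM2l gam0); lra.
Qed.

Section clock.
Context (R : realType) d (Om : measurableType d) (Q : probability Om R).
Context (L : R -> Om -> R) (Psi : R -> R) (gam : R).
Hypothesis HL : is_levy Q L Psi.
Hypothesis gam_gt0 : 0 < gam.
Hypothesis Psi_slope : asymptotic_slope Psi gam.
Context (Rr : R -> R).
Hypothesis Rc : {within `[0%R, +oo[, continuous Rr}.
Hypothesis Rpos : forall x, 0 < x -> 0 < Rr x.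
Hypothesis tail_fin : exists2 a : R, 0 < a &
  (\int[lebesgue_measure]_(x in `[a, +oo[) ((Rr x)^-1)%:E < +oo)%E.
Local Notation ph := (phi gam Rr).

Section blocks.
Context (v h z0 : R).
Hypothesis v0 : 0 <= v.
Hypothesis h1 : 1 < h.
Hypothesis z00 : 0 < z0.
Hypothesis Hrate : forall x y, z0 <= x -> h * x <= y <= h ^+ 4 * x ->
    (Rr y)^-1 <= (1 + v) * (Rr x)^-1.

Let h0 : 0 < h. Proof. by have := h1; lra. Qed.
Let hm1 : 0 < h - 1. Proof. by rewrite subr_gt0. Qed.
Let v1 : 0 < 1 + v. Proof. by have := v0; lra. Qed.

Lemma sum_phi_telescope (p : R) N :
  \sum_(0 <= n < N) (ph (h ^+ n * p) - ph (h * (h ^+ n * p))) = ph p - ph (h ^+ N * p).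
Proof.
elim: N => [|N IH]; first by rewrite big_geq// expr0 mul1r subrr.
by rewrite big_nat_recr//= IH exprS mulrA; ring.
Qed.

Lemma mean_time_above_phi (e : R) : 0 < e ->
  exists2 b0 : R, 0 < b0 & forall b x, b0 <= b ->
    (\int[Q]_w time_above L Rr x b w <= ((1 + v) * (1 + e) * h ^+ 2 * ph (b / h ^+ 2))%:E)%E.
Proof.
move=> e0; have [c0 c00 Hc] := visits_bound HL gam_gt0 Psi_slope h1 e0.
have h20 : 0 < h ^+ 2 by rewrite exprn_gt0.
exists (Num.max c0 (h ^+ 2 * z0)) => [|b x]; first by rewrite lt_max c00.
rewrite ge_max => /andP[cb zb].
have b0 : 0 < b by exact: lt_le_trans cb.
set b' := b / h ^+ 2.
have b'E : h ^+ 2 * b' = b by rewrite /b' mulrC divfK// gt_eqF.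
have zb' : z0 <= b' by rewrite ler_pdivlMr// mulrC.
have b'0 : 0 < b' by exact: lt_le_trans zb'.
(* Block [n] starts at [h ^+ 2 * p n]. Its points [y] satisfy [h * t <= y <= h ^+ 4 * t] for all [t]
   in [[p n, h * p n]], so [1 / R] there is at most [1 + v] times its average over that earlier
   block. The average is an increment of phi divided by the length, and the ratio of lengths is the
   factor [h ^+ 2]. *)
pose p n := h ^+ n * b'.
have p0 n : 0 < p n by rewrite mulr_gt0// exprn_gt0.
have zp n : z0 <= p n by rewrite (le_trans zb')// ler_peMl ?(ltW b'0)// exprn_ege1// ltW.
have php n : p n <= h * p n by rewrite ler_peMl ?(ltW h1)// ltW.
have hn n : h ^+ n * b = h ^+ 2 * p n by rewrite -b'E /p; ring.
have d0 n : 0 <= ph (p n) - ph (h * p n) by rewrite subr_ge0 (phi_le gam_gt0).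
pose s n := (1 + v) * (gam * (ph (p n) - ph (h * p n)) / ((h - 1) * p n)).
pose C n := (1 + e) * ((h - 1) * (h ^+ n * b) / gam).
apply: (mean_time_above HL Rc Rpos (h := h) (s := s) (C := C)) => //.
- move=> n; apply: (mulr_ge0 (ltW v1)); apply: divr_ge0; first exact: mulr_ge0 (ltW gam_gt0) (d0 n).
  exact: mulr_ge0 (ltW hm1) (ltW (p0 n)).
- move=> n y; rewrite hn => /andP[y1 y2].
  rewrite /s -ler_pdivrMl// ler_pdivlMr; last exact: mulr_gt0 hm1 (p0 n).
  have y0 : 0 < y by apply: lt_le_trans y1; rewrite mulr_gt0.
  have -> : (h - 1) * p n = h * p n - p n by ring.
  apply: (phi_ge_of_rate_ge gam_gt0 Rc Rpos tail_fin (p0 n) (php n)).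
    by rewrite mulr_ge0 ?invr_ge0 ?(ltW v1)// ltW// Rpos.
  move=> t /andP[t1 t2]; rewrite ler_pdivrMl//; apply: Hrate; first exact: le_trans t1.
  have t0 : 0 < t by exact: lt_le_trans t1.
  apply/andP; split.
    apply: le_trans y1; rewrite expr2 -mulrA ler_pM2l//; exact: ltW.
  apply: (ltW (lt_le_trans y2 _)).
  rewrite (_ : h * _ = h ^+ 3 * p n); last by ring.
  apply: (@le_trans _ _ (h ^+ 3 * t)); first by rewrite ler_pM2l// exprn_gt0.
  by rewrite ler_pM2r// ler_weXn2l// ltW.
- move=> n r N r0; apply: Hc => //.
  by apply: (le_trans cb); rewrite ler_peMl ?(ltW b0)// exprn_ege1// ltW.
- move=> N.
  rewrite (eq_bigr (fun n => (1 + v) * (1 + e) * h ^+ 2 * (ph (p n) - ph (h * p n)))); last first.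
    by move=> n _; rewrite /s /C hn; field; rewrite !gt_eqF.
  rewrite -big_distrr /= sum_phi_telescope ler_pM2l; last by rewrite !mulr_gt0//; lra.
  by rewrite gerBl; exact/ltW/(phi_gt0 gam_gt0 Rc Rpos tail_fin (p0 N)).
Qed.

(** The average of [1 / R] over the later block from [q = h ^+ n.+3 * b] to [h * q], divided by
    [1 + v]. The shift by [h ^+ 3] keeps [q] at least [h * y] for every [y] up to [h ^+ n.+2 * b],
    the highest point a window can reach. *)
Definition block_rate (b : R) n :=
  gam * (ph (h ^+ n * (h ^+ 3 * b)) - ph (h * (h ^+ n * (h ^+ 3 * b)))) /
    ((1 + v) * ((h - 1) * (h ^+ n * (h ^+ 3 * b)))).

Lemma block_rate_ge0 (b : R) n : 0 < b -> 0 <= block_rate b n.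
Proof.
move=> b0; have q0 : 0 < h ^+ n * (h ^+ 3 * b) by rewrite !mulr_gt0 ?exprn_gt0.
apply: divr_ge0; last exact: mulr_ge0 (ltW v1) (mulr_ge0 (ltW hm1) (ltW q0)).
apply: (mulr_ge0 (ltW gam_gt0)).
by rewrite subr_ge0 (phi_le gam_gt0)// ler_peMl ?(ltW h1) ?(ltW q0).
Qed.

Lemma block_rate_le (b : R) n y : z0 <= b -> h ^+ n * b <= y <= h ^+ n.+2 * b ->
  block_rate b n <= (Rr y)^-1.
Proof.
move=> zb /andP[y1 y2]; have b0 : 0 < b by exact: lt_le_trans zb.
have cn0 : 0 < h ^+ n * b by rewrite mulr_gt0 ?exprn_gt0.
set q := h ^+ n * (h ^+ 3 * b).
have q0 : 0 < q by rewrite !mulr_gt0 ?exprn_gt0.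
have y0 : 0 < y by exact: lt_le_trans y1.
rewrite /block_rate -/q ler_pdivrMr; last exact: mulr_gt0 v1 (mulr_gt0 hm1 q0).
have -> : (Rr y)^-1 * ((1 + v) * ((h - 1) * q)) = (1 + v) * (Rr y)^-1 * (h * q - q) by ring.
apply: (phi_le_of_rate_le gam_gt0 Rc Rpos tail_fin) => //.
  by rewrite ler_peMl ?(ltW h1) ?(ltW q0).
move=> t /andP[t1 t2]; apply: Hrate.
  apply: le_trans y1; apply: (le_trans zb); rewrite ler_peMl ?(ltW b0)// exprn_ege1//; exact: ltW.
have qE : q = h ^+ 3 * (h ^+ n * b) by rewrite /q; ring.
apply/andP; split.
  apply: le_trans t1; rewrite qE exprS -mulrA ler_pM2l//.
  have <- : h ^+ n.+2 * b = h ^+ 2 * (h ^+ n * b) by rewrite !exprS; ring.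
  exact: y2.
apply: (ltW (lt_le_trans t2 _)); rewrite qE (_ : h * _ = h ^+ 4 * (h ^+ n * b)); last by ring.
by rewrite ler_pM2l// exprn_gt0.
Qed.

(** Crossing time times [block_rate] is an increment of phi divided by [(1 + v) * h ^+ 3], and these
    increments telescope. *)
Lemma block_sum_bounds (b e : R) (m : nat -> nat) N : 0 < b -> 0 <= e ->
  (forall n, (1 - e) * ((h - 1) * (h ^+ n * b) / gam) <= (m n)%:R <= (h - 1) * (h ^+ n * b) / gam) ->
  (1 - e) / ((1 + v) * h ^+ 3) * (ph (h ^+ 3 * b) - ph (h ^+ N * (h ^+ 3 * b)))
    <= \sum_(0 <= n < N) (m n)%:R * block_rate b n <= ph b.
Proof.
move=> b0 e0 Hm.
have h30 : 0 < h ^+ 3 by rewrite exprn_gt0.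
have h3b : 0 < h ^+ 3 * b by rewrite mulr_gt0.
have E n : (h - 1) * (h ^+ n * b) / gam * block_rate b n =
   ((1 + v) * h ^+ 3)^-1 * (ph (h ^+ n * (h ^+ 3 * b)) - ph (h * (h ^+ n * (h ^+ 3 * b)))).
  rewrite /block_rate; field; rewrite !gt_eqF ?exprn_gt0//.
rewrite -sum_phi_telescope; apply/andP; split.
  rewrite big_distrr /=; apply: ler_sum => n _.
  rewrite -[leLHS]mulrA -E [leLHS]mulrA; apply: ler_wpM2r; first exact: block_rate_ge0.
  by have /andP[] := Hm n.
apply: (@le_trans _ _ (((1 + v) * h ^+ 3)^-1 * \sum_(0 <= n < N) (ph (h ^+ n * (h ^+ 3 * b)) - ph (h * (h ^+ n * (h ^+ 3 * b)))))).
  rewrite big_distrr /=; apply: ler_sum => n _; rewrite -E.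
  by apply: ler_wpM2r; [exact: block_rate_ge0|have /andP[] := Hm n].
rewrite sum_phi_telescope.
have pp := phi_gt0 gam_gt0 Rc Rpos tail_fin.
have hN : 0 < h ^+ N * (h ^+ 3 * b) by rewrite mulr_gt0// exprn_gt0.
have p1 := pp _ hN; have p2 := pp _ h3b; have p3 := pp _ b0.
have h31 : 1 <= h ^+ 3 by rewrite exprn_ege1// ltW.
have : ph (h ^+ 3 * b) <= ph b by rewrite (phi_le gam_gt0)// ler_peMl// ltW.
have k1 : 1 <= (1 + v) * h ^+ 3 by have := v0; nra.
have := ler_peMl (ltW p3) k1.
by rewrite ler_pdivrMl ?(lt_le_trans ltr01 k1)//; lra.
Qed.

End blocks.

(* The window sum is a pathwise lower bound of the time above [b], and its mean
   nearly equals the upper bound on the mean of that time. *)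
Lemma clock_concentration (et del : R) : H1 ph -> H3 Rr -> 0 < et <= 1 -> 0 < del <= 1 ->
  exists2 b0 : R, 0 < b0 & forall b, b0 <= b -> exists x0 : R, forall x, x0 <= x ->
    (Q [set w | ((1 + et) * ph b)%:E < time_above L Rr x b w]%E <= del%:E)%E /\
    exists B, [/\ measurable B, (Q B <= del%:E)%E & forall w, ~ B w -> exists T : R,
      [/\ 0 <= T, (forall s : R, 0 <= s <= T -> b <= x + L s w) &
          (((1 - et) * ph b)%:E <= Defs.eta Rr L x T w)%E]].
Proof.
move=> hH1 hH3 /andP[et0 et1] /andP[del0 del1].
have phpos := phi_gt0 gam_gt0 Rc Rpos tail_fin.
(* Mean and maximum will agree within a factor [1 + O(ka)], and Markov's inequality at height
   [et * F] then gives [8 * ka / et = del]. The division by 20 absorbs all products of factors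
   [1 + a], [1 - a] and powers of [h <= 1 + a]. *)
pose ka := et * del / 8; pose a := ka / 20.
have ka0 : 0 < ka by rewrite /ka !mulr_gt0.
have edet : et * del <= et by rewrite ler_piMr// ltW.
have ka1 : ka <= 1 / 8 by rewrite /ka; lra.
have a0 : 0 < a by rewrite divr_gt0.
have a20 : 20 * a = ka by rewrite /a; lra.
have a1 : a <= 1 / 20 by lra.
have a1p : 0 < 1 - a by lra.
have a10 := ltW a1p.
have ahalf : 1 / 2 <= 1 - a by lra.
have a_le1 : a <= 1 by lra.
have ka1p : 0 <= 1 - ka by lra.
have k8 : 8 * ka = et * del by rewrite /ka; lra.
have kae : ka <= et / 2 by lra.
have kahalf : ka = ka / 2 + ka / 2 by lra.
have [h0 h01 Hh0] := H3_ratio hH3 Rpos a0.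
have h0m : 1 < Num.min h0 (1 + a) by rewrite lt_min h01 ltrDl.
have [h /andP[h1 hm] [x1 x10 Hx1]] := H1_ratio hH1 a0 h0m.
rewrite le_min in hm; case/andP: hm => hh0 ha.
have [z0 z00 Hrate] := Hh0 h (introT andP (conj h1 hh0)).
have hp : 0 < h by lra.
have hm1 : 0 < h - 1 by rewrite subr_gt0.
have ph_h x : x1 <= x -> (1 - a) * ph x <= ph (h * x).
  by move=> x1x; rewrite -ler_pdivlMr; [exact: Hx1|apply: phpos; exact: lt_le_trans x1x].
have [bm bm0 Hbm] := mean_time_above_phi (ltW a0) h1 z00 Hrate a0.
(* These are the dip and stray tolerances for which [window_length] provides the windows. *)
pose e1 := a / 4 * (h - 1) / h; pose e2 := gam * a / 4.
have e10 : 0 < e1 by rewrite /e1 !mulr_gt0 ?invr_gt0.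
have e11 : e1 <= 1 by rewrite /e1 ler_pdivrMr//; nra.
have e20 : 0 < e2 by rewrite /e2 !mulr_gt0 ?invr_gt0.
have ka2 : 0 < ka / 2 by rewrite divr_gt0.
have [bd bd0 Hbd] := dip_bound HL gam_gt0 Psi_slope e10 ka2.
have [m0 Hm0] := astray_bound HL gam_gt0 Psi_slope e20 ka2.
pose b0 := Num.max bm (Num.max bd (Num.max z0 (Num.max (h ^+ 2 * x1)
  (Num.max (2 * gam / (a * (h - 1))) (2 * gam * m0%:R / (h - 1)))))).
exists b0 => [|b]; first by rewrite lt_max bm0.
rewrite /b0 !ge_max => /andP[bbm /andP[bdb /andP[zb /andP[c3 /andP[c1 c2]]]]].
have b_gt0 : 0 < b by exact: lt_le_trans bbm.
have h20 : 0 < h ^+ 2 by rewrite exprn_gt0.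
have h30 : 0 < h ^+ 3 by rewrite exprn_gt0.
have bh2 : x1 <= b / h ^+ 2 by rewrite ler_pdivlMr// mulrC.
have ca : 1 <= a / 2 * ((h - 1) * b / gam).
  move: c1; rewrite ler_pdivrMr ?mulr_gt0// => hb.
  rewrite (_ : _ * _ = b * (a * (h - 1)) / (2 * gam)); last by field; rewrite gt_eqF.
  by rewrite ler_pdivlMr ?mulr_gt0// mul1r.
have cm0 : m0%:R <= (1 - a) * ((h - 1) * b / gam).
  move: c2; rewrite ler_pdivrMr// => hb.
  apply: (@le_trans _ _ (1 / 2 * ((h - 1) * b / gam))).
    rewrite (_ : _ * _ = b * (h - 1) / (2 * gam)); last by field; rewrite gt_eqF.
    by rewrite ler_pdivlMr ?mulr_gt0// mulrC.
  apply: ler_wpM2r => //.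
  by rewrite divr_ge0 ?mulr_ge0// ltW.
have a01 : 0 < a <= 1 by rewrite a0.
have [m Hm] := window_length gam_gt0 h1 a01 b_gt0 ca.
pose c n := h ^+ n * b.
have hn1 n : 1 <= h ^+ n by rewrite exprn_ege1// ltW.
have cb n : b <= c n by rewrite ler_peMl// ltW.
have mm0 n : (m0 <= m n)%N.
  rewrite -(ler_nat R); apply: (le_trans cm0); have [_ _ + _] := Hm n; apply: le_trans.
  apply: ler_wpM2l => //.
  by rewrite ler_pM2r ?invr_gt0// ler_pM2l// cb.
pose F := ph b.
have F0 : 0 < F by exact: phpos.
have bh3 : b <= h ^+ 3 * b by rewrite ler_peMl// ltW.
have b30 : 0 < h ^+ 3 * b by exact: mulr_gt0.
have F30 := phpos _ b30.
have [bN bN0 HbN] := phi_cvg0 gam_gt0 Rc Rpos tail_fin (mulr_gt0 a0 F30).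
(* Finitely many blocks suffice: beyond [h ^+ N * (h ^+ 3 * b)] only a fraction [a] of phi remains.
   The number [N] fixes the starting threshold [h ^+ N * b]. *)
have [N HN] := exists_expr_gt (bN / (h ^+ 3 * b)) h1.
have HN' : ph (h ^+ N * (h ^+ 3 * b)) <= a * ph (h ^+ 3 * b).
  by apply/ltW/HbN; rewrite -ler_pdivrMr// ltW.
have F3 : (1 - a) ^+ 3 * F <= ph (h ^+ 3 * b).
  have bh : x1 <= b.
    by apply: (le_trans bh2); rewrite ler_pdivrMr// ler_peMr ?(ltW b_gt0).
  have s1 := ph_h b bh.
  have s2 : (1 - a) * ph (h * b) <= ph (h * (h * b)).
    by apply: ph_h; apply: (le_trans bh); rewrite ler_peMl// ltW.
  have s3 : (1 - a) * ph (h * (h * b)) <= ph (h * (h * (h * b))).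
    by apply: ph_h; apply: (le_trans bh); rewrite mulrA -expr2 ler_peMl// ltW.
  have -> : h ^+ 3 * b = h * (h * (h * b)) by ring.
  apply: le_trans s3; rewrite (_ : _ * F = (1 - a) * ((1 - a) * ((1 - a) * F))); last by ring.
  apply: ler_wpM2l => //; apply: le_trans s2; exact: ler_wpM2l.
have KF : (1 + a) * (1 + a) * h ^+ 2 * ph (b / h ^+ 2) <= (1 + ka) * F.
  set b' := b / h ^+ 2 in bh2 *.
  have b'E : h * (h * b') = b by rewrite /b'; field; rewrite gt_eqF.
  have b'0 : 0 < b' by exact: lt_le_trans bh2.
  have s1 := ph_h b' bh2.
  have s2 : (1 - a) * ph (h * b') <= ph (h * (h * b')).
    by apply: ph_h; apply: (le_trans bh2); rewrite ler_peMl// ltW.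
  rewrite b'E -/F in s2.
  have s3 : (1 - a) ^+ 2 * ph b' <= F.
    by apply: le_trans s2; rewrite expr2 -mulrA ler_pM2l.
  rewrite -a20; apply: mean_constant (s3) (ltW (phpos _ b'0)); first by rewrite (ltW a0).
  by rewrite h1.
pose i := block_rate a h b.
have Hmb n : (1 - a) * ((h - 1) * (h ^+ n * b) / gam) <= (m n)%:R <= (h - 1) * (h ^+ n * b) / gam.
  by have [_ _ -> ->] := Hm n.
have /andP[W1 W2] := block_sum_bounds (ltW a0) h1 N b_gt0 (ltW a0) Hmb.
set W := \sum_(0 <= n < N) _ in W1 W2.
have WF : (1 - ka) * F <= W.
  apply: le_trans W1; rewrite -a20.
  by apply: weight_constant (ltW F0) F3 HN'; rewrite ?(ltW a0)// h1.
exists (h ^+ N * b) => x xN.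
pose G := good L gam c m b e1 e2 x.
have mG n : measurable (G n) by exact: (measurable_good gam HL).
have QG n : (n < N)%N -> pr Q (~` G n) <= ka.
  move=> _; have mC : measurable (~` G n) by exact: measurableC.
  rewrite -lee_fin -prE// /G /good setCK.
  apply: (le_trans (measureU2 _ _ _)).
  - exact: (measurable_dip HL).
  - exact: (measurable_astray gam HL).
  rewrite kahalf EFinD; apply: leeD; first exact: Hbd.
  exact: Hm0.
have a_ge n : 0 <= (m n)%:R * i n by rewrite mulr_ge0// (block_rate_ge0 (ltW a0) h1).
pose S w := \sum_(0 <= n < N) \1_(G n) w * ((m n)%:R * i n).
have HS w : exists T : R, [/\ 0 <= T, (forall s : R, 0 <= s <= T -> b <= x + L s w) &
    ((S w)%:E <= Defs.eta Rr L x T w)%E].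
  apply: (window_sum_eta HL gam_gt0 Rc Rpos (c := c) (i := i) (m := m) (e1 := e1) (e2 := e2)) => //.
  - by rewrite e11 ltW.
  - exact: ltW.
  - by move=> n; rewrite /c exprS -mulrA ler_peMl ?(ltW h1)//; apply: le_trans (cb n); exact: ltW.
  - by move=> n; exact: (block_rate_ge0 (ltW a0) h1).
  - by move=> n y; exact: (block_rate_le (ltW a0) h1 z00 Hrate zb).
  - by move=> n; have [hc _ _ _] := Hm n.
  - by move=> n; have [_ hc _ _] := Hm n.
split.
- have SA w : ((S w)%:E <= time_above L Rr x b w)%E.
    have [T [T0 T1 T2]] := HS w; apply: (le_trans T2).
    exact: (eta_le_time_above HL Rc).
  have mA : measurable_fun setT (time_above L Rr x b) by exact: (measurable_time_above HL Rc).
  have t0 : 0 < et * F by rewrite mulr_gt0.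
  have AK := Hbm b x bbm.
  have ex := indic_sum_excess mG a_ge QG mA AK SA t0.
  rewrite -/W in ex.
  have mset u : measurable [set w | (u < time_above L Rr x b w)%E].
    by rewrite -[X in measurable X]setTI; exact: emeasurable_fun_o_infty.
  (* Since [W <= F], exceeding [(1 + et) * F] implies exceeding [W + et * F]. *)
  apply: (@le_trans _ _ (Q [set w | ((W + et * F)%:E < time_above L Rr x b w)%E])).
    apply: le_measure; rewrite ?inE//.
    move=> w /=; apply: le_lt_trans; rewrite lee_fin mulrDl mul1r lerD2r//.
  apply: (le_trans ex); rewrite lee_fin ler_pdivrMr//.
  have -> : del * (et * F) = et * del * F by ring.
  rewrite -k8.
  by apply: excess_constant => //; [rewrite (ltW ka0) -subr_ge0|exact: ltW].
- have t0 : 0 < et / 2 * F by rewrite mulr_gt0// divr_gt0.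
  exists [set w | S w <= W - et / 2 * F]; split.
  + by apply: measurable_set_le; exact: (measurable_indic_sum _ _ mG).
  + have := indic_sum_deficit mG a_ge QG t0; rewrite -/W => /le_trans; apply.
    rewrite lee_fin ler_pdivrMr//.
    have -> : del * (et / 2 * F) = 4 * (ka * F).
      by rewrite (_ : del * _ = et * del * F / 2); [rewrite -k8; field|ring].
    apply: (@le_trans _ _ (ka * F)); first by rewrite ler_pM2l.
    by rewrite ler_peMl ?ler1n// mulr_ge0 ?(ltW ka0)// ltW.
  + move=> w /negP; rewrite -ltNge => SW.
    have [T [T0 T1 T2]] := HS w; exists T; split => //; apply: le_trans T2.
    rewrite lee_fin; apply: le_trans (ltW SW).
    exact: deficit_constant (ltW F0) kae WF.
Qed.

(** Up to the first passage [k] below [b] the path is above [(1 - e1) * b], so the clock has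
    consumed at most [u] and its inverse at [u] is at least [k]. From [k] on the path follows its
    drift and is killed before [k + m]. Thus [Xtc] reads the path at a time in [[k, k + m]], where
    it is at most [b + e2 * m]. *)
Lemma Xtc_le_path (x b e1 e2 u : R) m w : 0 < b -> 0 <= e1 < 1 -> 0 <= u ->
  ~ dip L x b e1 w -> ~ astray L gam x b (e2 * m%:R) m w ->
  b + e2 * m%:R < gam * m%:R ->
  (time_above L Rr x ((1 - e1) * b) w <= u%:E)%E ->
  (Xtc Rr L x u w <= (b + e2 * m%:R)%:E)%E.
Proof.
move=> b0 /andP[e10 e11] u0 nd /astrayP[k [fk hk]] hm Au.
have e1' : 0 <= e1 <= 1 by rewrite e10 ltW.
have ab := above_first_below b0 e1' (lexx b) nd fk.
have [_ Zk] := fk.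
have b'0 : 0 < (1 - e1) * b by rewrite mulr_gt0// subr_gt0.
have hk' s : k%:R <= s <= k%:R + m%:R -> x + L s w <= b + e2 * m%:R - gam * (s - k%:R).
  move=> /andP[s1 s2]; have := hk (s - k%:R).
  rewrite (_ : k%:R + (s - k%:R) = s); last by ring.
  have -> : 0 <= s - k%:R <= m%:R by apply/andP; split; lra.
  by move=> /(_ isT); rewrite ler_norml => /andP[_]; lra.
have tk : (k%:R%:E <= tau0 L x w)%E.
  rewrite leNgt; apply/negP => /tau0_lt[r [/andP[r0 rs]]]; rewrite ltNge => /negP; apply.
  by apply: le_trans (ab r _); rewrite ?r0// ltW.
have km : (tau0 L x w <= (k%:R + m%:R)%:E)%E.
  apply: tau0_le; first by rewrite addr_ge0.
  apply: le_lt_trans (hk' _ _) _; first by rewrite lexx lerDl ler0n.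
  by rewrite [k%:R + _]addrC addrK; lra.
have ek : (k%:R%:E <= etainv Rr L x u w)%E.
  apply: le_ereal_inf_tmp => _ [s [s0 us] <-]; rewrite lee_fin leNgt; apply/negP => sk.
  move: us; rewrite ltNge => /negP; apply; apply: le_trans Au.
  apply: (eta_le_time_above HL Rc Rpos) => r /andP[r0 rs]; apply: ab.
  by rewrite r0 (le_lt_trans rs).
rewrite /Xtc; set mn := Order.min _ _.
have m1 : (k%:R%:E <= mn)%E by rewrite le_min ek tk.
have m2 : (mn <= (k%:R + m%:R)%:E)%E by rewrite ge_min km orbT.
move: m1 m2; case: mn => [v| |] //; rewrite !lee_fin => v1 v2.
apply: le_trans (hk' v _) _; first by rewrite v1.
by rewrite gerBl mulr_ge0 ?(ltW gam_gt0)// subr_ge0.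
Qed.

Lemma Xtc_concentration (e del : R) : H1 ph -> H3 Rr -> 0 < e <= 1 -> 0 < del <= 1 ->
  exists2 b0 : R, 0 < b0 & forall b, b0 <= b -> exists x0 : R, forall x u, x0 <= x -> 0 <= u ->
    (u < (1 - e) * ph b -> (Q [set w | (Xtc Rr L x u w < b%:E)%E] <= del%:E)%E) /\
    ((1 + e) * ph b < u -> (Q [set w | (((1 + e) * b)%:E < Xtc Rr L x u w)%E] <= del%:E)%E).
Proof.
move=> hH1 hH3 /andP[e0 e1] /andP[del0 del1]; have gam0 := gam_gt0.
have d3 : 0 < del / 3 <= 1 by apply/andP; split; lra.
have d30 : 0 < del / 3 by lra.
have e01 : 0 < e <= 1 by rewrite e0.
have [bc bc0 Hbc] := clock_concentration hH1 hH3 e01 d3.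
have e40 : 0 < e / 4 by lra.
have e41 : 0 <= e / 4 < 1 by apply/andP; split; lra.
have p1 : 0 < 1 - e / 4 by lra.
have del3 : del = del / 3 + del / 3 + del / 3 by lra.
have del3le : del / 3 <= del by lra.
have [bd bd0 Hbd] := dip_bound HL gam_gt0 Psi_slope e40 d30.
pose e2 := gam * e / 32.
have e20 : 0 < e2 by rewrite divr_gt0// mulr_gt0.
have [m0 Hm0] := astray_bound HL gam_gt0 Psi_slope e20 d30.
have [g0 g00 g0E] : exists2 g0 : R, 0 <= g0 & gam * m0%:R = g0.
  by exists (gam * m0%:R) => //; rewrite mulr_ge0// ltW.
exists (bc + bd + gam + g0) => [|b]; first by lra.
move=> bb; have bbc : bc <= b by lra.
have bbd : bd <= b by lra.
have bg : gam <= b by lra.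
have bm0 : gam * m0%:R <= b by rewrite g0E; lra.
have b0 : 0 < b by lra.
have [x0 Hx0] := Hbc b bbc; exists x0 => x u x0x u0.
have [HA [B [mB QB HB]]] := Hx0 x x0x.
have mX := measurable_Xtc HL Rc Rpos x u.
split => hu.
  apply: (@le_trans _ _ (Q B)); last by apply: (le_trans QB); rewrite lee_fin.
  apply: le_measure; rewrite ?inE//.
    by rewrite -[X in measurable X]setTI; exact: emeasurable_fun_infty_o.
  move=> w /=; rewrite ltNge => /negP Xb; apply: contrapT => /HB[T [T0 T1 T2]]; apply: Xb.
  apply: (Xtc_ge_window b0 u0 T0 T1); apply: lt_le_trans T2.
  by rewrite lte_fin.
(* The level is raised so that [(1 - e / 4) * b1 = b], the level at which the time above has been
   estimated. *)
pose b1 := b / (1 - e / 4).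
have b1E : (1 - e / 4) * b1 = b by rewrite /b1 mulrC divfK// gt_eqF.
have bb1 : b <= b1 by rewrite -b1E ler_piMl ?gerBl ?ltW// divr_gt0.
have b10 : 0 < b1 by exact: lt_le_trans bb1.
have [m [mm0 em2 em3]] := exists_horizon gam0 e01 bg bm0.
rewrite -/b1 -/e2 in em2 em3.
pose D1 := [set w | ((1 + e) * ph b)%:E < time_above L Rr x b w]%E.
pose D2 := dip L x b1 (e / 4).
pose D3 := astray L gam x b1 (e2 * m%:R) m.
have mD1 : measurable D1.
  rewrite /D1 -[X in measurable X]setTI; apply: emeasurable_fun_o_infty => //.
  exact: (measurable_time_above HL Rc).
have mD2 : measurable D2 by exact: (measurable_dip HL).
have mD3 : measurable D3 by exact: (measurable_astray gam HL).
have mD12 : measurable (D1 `|` D2) by exact: measurableU.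
apply: (@le_trans _ _ (Q (D1 `|` D2 `|` D3))).
  apply: le_measure; rewrite ?inE//.
  - by rewrite -[X in measurable X]setTI; exact: emeasurable_fun_o_infty.
  - exact: measurableU.
  move=> w /= hX; apply: contrapT => /not_orP[/not_orP[n1 n2] n3].
  move: hX; rewrite ltNge => /negP; apply.
  apply: (@le_trans _ _ (b1 + e2 * m%:R)%:E); last by rewrite lee_fin.
  apply: (Xtc_le_path b10 e41 u0 n2 n3 em3); rewrite b1E.
  move/negP: n1; rewrite -leNgt => /le_trans; apply.
  by rewrite lee_fin ltW.
apply: (le_trans (measureU2 _ mD12 mD3)).
rewrite del3 !EFinD; apply: leeD; last exact: Hm0.
apply: (le_trans (measureU2 _ mD1 mD2)); apply: leeD => //.
by apply: Hbd; exact: le_trans bb1.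
Qed.

(** The value [+oo] is the default for an infinite stopping index; it requires [tau0] to be
    infinite, so the path never goes below 0. *)
Lemma Xtc_lt_pinfty (x u : R) : 0 <= u -> Q [set w | Xtc Rr L x u w = +oo%E] = 0%E.
Proof.
move=> u0; apply/eqP; rewrite eq_le measure_ge0 andbT.
rewrite -(never_below0 HL gam_gt0 Psi_slope x 0).
apply: le_measure; rewrite ?inE.
- rewrite (_ : [set w | _] = Xtc Rr L x u @^-1` [set +oo%E])//.
  rewrite -[X in measurable X]setTI; exact: (measurable_Xtc HL Rc Rpos).
- apply: measurableC; apply: bigcupT_measurable => k; exact: (measurable_first_below HL).
move=> w /= Xoo [k _ [_ fk]].
have tk : (tau0 L x w <= k%:R%:E)%E by exact: tau0_le.
have : (Order.min (etainv Rr L x u w) (tau0 L x w) <= k%:R%:E)%E by rewrite ge_min tk orbT.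
have : (0%:E <= Order.min (etainv Rr L x u w) (tau0 L x w))%E.
  by rewrite le_min etainv_ge0 tau0_ge0.
by move: Xoo; rewrite /Xtc; case: Order.min.
Qed.

End clock.

(** * Entrance from infinity *)

Section entrance.
Context (R : realType) d (Om : measurableType d) (P : probability Om R).
Context (Y : R -> Om -> \bar R).
Context (K : R -> forall n, ('I_n -> R) -> ('I_n -> set \bar R) -> \bar R).
Hypothesis HY : entrance_process P Y K.

Let mY t : 0 <= t -> measurable_fun setT (Y t). Proof. by case: HY => h _; exact: h. Qed.
Let Y_ge0 t w : 0 <= t -> (0 <= Y t w)%E. Proof. by case: HY => _ [h _]; exact: h. Qed.
Let Y0 w : Y 0 w = +oo%E. Proof. by case: HY => _ [_ [h _]]. Qed.

Lemma entrance_right_cont t w : 0 <= t -> Y s w @[s --> t^'+] --> Y t w.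
Proof. by move=> t0; case: HY => _ [_ [_ [h _]]]; case: (h w t t0). Qed.

Let mpre t (B : set \bar R) : 0 <= t -> measurable B -> measurable (Y t @^-1` B).
Proof. by move=> t0 mB; rewrite -[X in measurable X]setTI; exact: mY. Qed.

Lemma stopping_time_cst (s : R) : 0 <= s -> stopping_time Y (fun=> s%:E).
Proof.
move=> s0; split => [w|t t0 u tu]; first by rewrite lee_fin.
rewrite /natF; case: (leP s t) => st.
  have -> : [set w : Om | (s%:E <= t%:E)%E] = setT by apply/seteqP; split => w //= _; rewrite lee_fin.
  set G := [set A | _].
  have h : <<s G >> (~` set0) by apply: sigma_algebraC; exact: sigma_algebra0.
  by rewrite setC0 in h.
have -> : [set w : Om | (s%:E <= t%:E)%E] = set0.
  by apply/seteqP; split => w //=; rewrite lee_fin leNgt st.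
exact: sigma_algebra0.
Qed.

Lemma stopped_sigma_cst (s : R) (B : set \bar R) : 0 <= s -> measurable B ->
  stopped_sigma Y (fun=> s%:E) (Y s @^-1` B).
Proof.
move=> s0 mB; split.
  by apply: sub_sigma_algebra; exists s, B.
move=> t t0 u tu; case: (leP s t) => st.
  rewrite (_ : _ `&` _ = Y s @^-1` B).
    apply: sub_sigma_algebra; exists s, B; split => //.
    by rewrite s0 (le_trans st)// ltW.
  by apply/seteqP; split => [w []//|w h]; split; rewrite //= ?lee_fin.
rewrite (_ : _ `&` _ = set0); first exact: sigma_algebra0.
by apply/seteqP; split => w []; rewrite /= ?lee_fin leNgt st.
Qed.

(** The strong Markov property at a constant time. [D] consists of finite values because the restart
    kernel describes the process from finite states only. *)
Lemma markov_fixed_time (s u delta : R) (B D : set \bar R) : 0 <= s -> 0 <= u -> 0 <= delta ->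
  measurable B -> measurable D -> D `<=` [set y | (y < +oo)%E] ->
  (forall y, D y -> (0 <= K (fine y) (fun _ : 'I_1 => u) (fun=> B) <= delta%:E)%E) ->
  (P (Y s @^-1` D `&` Y (s + u) @^-1` B) <= delta%:E)%E.
Proof.
move=> s0 u0 d0 mB mD Dfin HK.
case: HY => _ [_ [_ [_ [_ SM]]]].
have := SM _ (stopping_time_cst s0) _ (stopped_sigma_cst s0 mD).
have sub : Y s @^-1` D `<=` [set w | ((fun=> s%:E) w < +oo)%E /\ (Y (fine ((fun=> s%:E) w)) w < +oo)%E].
  by move=> w Dw; split; [exact: ltry|exact: Dfin].
move=> /(_ sub 1%N (fun=> u) (fun=> B) (fun=> u0) (fun=> mB)) /=.
rewrite (_ : [set w | 'I_1 -> B (Y (s + u) w)] = Y (s + u) @^-1` B); last first.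
  by apply/seteqP; split => w /=; [move=> /(_ ord0)|move=> h _].
move=> ->.
apply: (@le_trans _ _ (\int[P]_(w in Y s @^-1` D) (cst delta%:E) w)%E).
  by apply: ge0_le_integral_nonmeasurable => w Dw; exact: HK.
rewrite integral_cst; last exact: mpre.
apply: (@le_trans _ _ (delta%:E * 1)%E); last by rewrite mule1.
by apply: lee_wpmul2l; rewrite ?lee_fin// probability_le1//; exact: mpre.
Qed.

(** Before [s] the path is finite somewhere, hence by right-continuity at some dyadic time; from a
    finite value the kernel gives no mass to [+oo]. The event is a countable union of null sets. *)
Lemma entrance_finite (s : R) : 0 < s ->
  (forall x u, 0 <= u -> K x (fun _ : 'I_1 => u) (fun=> [set +oo%E]) = 0%E) ->
  P (Y s @^-1` [set +oo%E]) = 0%E.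
Proof.
move=> s0 K0; have ms := mpre (ltW s0) (emeasurable_set1 +oo%E).
apply: measure_negligible => //.
pose q (n k : nat) : R := k%:R / (2 ^ n)%:R.
have q0 n k : 0 <= q n k by rewrite divr_ge0.
pose N n k := if q n k < s then Y (q n k) @^-1` [set y | (y < +oo)%E] `&` Y s @^-1` [set +oo%E] else set0.
apply: (@negligibleS _ _ _ _ (\bigcup_n \bigcup_k N n k)); last first.
  apply: negligible_bigcup => n; apply: negligible_bigcup => k.
  rewrite /N; case: ifPn => qs; last exact: negligible_set0.
  have mfin : measurable [set y : \bar R | (y < +oo)%E].
    by rewrite (_ : [set y | _] = ~` [set +oo%E]); [apply: measurableC; exact: emeasurable_set1|
      apply/seteqP; split => y /=; rewrite ltey => /eqP].
  apply/negligibleP; first by apply: measurableI => //; exact: mpre.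
  apply/eqP; rewrite -measure_le0.
  have -> : s = q n k + (s - q n k) by ring.
  apply: (markov_fixed_time (q0 n k) _ (lexx 0)) => //.
  - by rewrite subr_ge0 ltW.
  - by move=> y _; rewrite K0 ?lexx// subr_ge0 ltW.
move=> w /= Ysoo.
have [r [/andP[r0 rs] Yr]] : exists t, 0 < t < s /\ (Y t w < +oo)%E.
  by case: HY => _ [_ [_ [_ [h _]]]]; exact: h.
have [e e0 He] : exists2 e, 0 < e & forall t, r < t < r + e -> (Y t w < +oo)%E.
  have [e /= e0 He] : \forall t \near r^'+, (Y t w < +oo)%E.
    have cr : Y t w @[t --> r^'+] --> Y r w by apply: entrance_right_cont; exact: ltW.
    exact: (cr _ (open_ereal_lt' Yr)).
  exists e => // t /andP[t1 t2]; apply: He => //=.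
  by rewrite /ball /= ltr0_norm ?opprB; lra.
have rm : r < Num.min s (r + e) by rewrite lt_min rs ltrDl.
have [n [k /andP[q1 q2]]] := dyadic_between (ltW r0) rm.
move: q2; rewrite lt_min => /andP[q2 q3].
exists n => //; exists k => //; rewrite /N /q q2; split => //=.
by apply: He; rewrite q1.
Qed.

(** Right-continuity at 0, where [Y] is infinite, makes [Y (t / n.+1)] exceed [x0] eventually; the
    events of a later failure decrease to the empty set. *)
Lemma entrance_large (t x0 delta : R) : 0 < t -> 0 < delta ->
  exists2 s, 0 < s <= t & (P [set w | (Y s w < x0%:E)%E] <= delta%:E)%E.
Proof.
move=> t0 d0; pose s n := t / n.+1%:R.
have s0 n : 0 < s n by rewrite divr_gt0.
have mE n : measurable [set w | (Y (s n) w < x0%:E)%E].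
  rewrite -[X in measurable X]setTI; apply: emeasurable_fun_infty_o => //.
  exact: mY (ltW (s0 n)).
pose F n := \bigcup_(m in [set m | (n <= m)%N]) [set w | (Y (s m) w < x0%:E)%E].
have mF n : measurable (F n) by apply: bigcup_measurable.
have cap : \bigcap_n F n = set0.
  apply/seteqP; split => // w Fw.
  have [e /= e0 He] : \forall u \near 0^'+, (x0%:E < Y u w)%E.
    have Y0w : (x0%:E < Y 0 w)%E by rewrite Y0 ltry.
    have cr : Y t w @[t --> 0^'+] --> Y 0 w by exact: entrance_right_cont.
    exact: (cr _ (open_ereal_gt' Y0w)).
  have [m /= hm] := Fw (Num.bound (t / e)) I.
  apply/negP; rewrite -leNgt; apply/ltW/He => //=.
  rewrite /ball /= sub0r normrN gtr0_norm// /s ltr_pdivrMr// mulrC -ltr_pdivrMr//.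
  have te : 0 <= t / e by rewrite divr_ge0// ltW.
  by apply: (lt_le_trans (archi_boundP te)); rewrite ler_nat ltnW.
have cv : P \o F @ \oo --> P (\bigcap_n F n).
  apply: nonincreasing_cvg_mu => //.
  - by rewrite (le_lt_trans (probability_le1 _ _)) ?ltry.
  - exact: bigcap_measurable.
  - by move=> m n mn; apply/subsetPset => w [k /= nk h]; exists k => //=; exact: leq_trans nk.
rewrite cap measure0 in cv.
have [n _ Hn] : \forall n \near \oo, (P (F n) < delta%:E)%E.
  apply: (cv [set y | (y < delta%:E)%E]); apply: open_ereal_lt'.
  by rewrite lte_fin.
exists (s n); first by rewrite s0 /= /s ler_pdivrMr// ler_peMr ?(ltW t0)// ler1n.
apply: le_trans (ltW (Hn n (leqnn n))); apply: le_measure; rewrite ?inE//.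
by move=> w h; exists n => /=.
Qed.

End entrance.

Lemma deviation_set (R : realType) T (f : T -> \bar R) (c eps : R) : 0 < c -> (forall w, 0 <= f w)%E ->
  [set w | f w = +oo%E \/ eps < `|fine (f w) / c - 1|] =
  [set w | (f w < ((1 - eps) * c)%:E)%E] `|` [set w | (((1 + eps) * c)%:E < f w)%E].
Proof.
move=> c0 f0; apply/seteqP; split => w /=; have := f0 w; case: (f w) => [r| |] //=.
- move=> _ [//|]; rewrite ltr_normr !lte_fin => /orP[h|h]; [right|left].
    by rewrite -ltr_pdivlMr//; lra.
  by rewrite -ltr_pdivrMr//; lra.
- by move=> _ _; right; rewrite ltry.
- rewrite !lte_fin ltr_normr => _ [|].
    by rewrite -ltr_pdivrMr// => h; right; apply/orP; right; lra.
  by rewrite -ltr_pdivlMr// => h; right; apply/orP; left; lra.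
- by move=> _ _; left.
Qed.

(** * Inversion of phi under (H2) *)

Section inversion.
Context (R : realType) (gam : R) (Rr : R -> R).
Hypothesis gam_gt0 : 0 < gam.
Hypothesis Rc : {within `[0%R, +oo[, continuous Rr}.
Hypothesis Rpos : forall x, 0 < x -> 0 < Rr x.
Hypothesis tail_fin : exists2 a : R, 0 < a &
  (\int[lebesgue_measure]_(x in `[a, +oo[) ((Rr x)^-1)%:E < +oo)%E.
Local Notation ph := (phi gam Rr).

(** (H2) with the ratios [(1 - e)^-1] and [1 + e] separates [t = ph c] from [ph ((1 - e) * c)] and
    [ph ((1 + e) * c)] by a factor [1 + k]. A quarter of the gap goes to the waiting time [s],
    another to the concentration error. *)
Lemma phiinv_gap (e : R) : H2 ph -> 0 < e <= 1 / 3 ->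
  exists2 k : R, 0 < k <= 1 & forall b0, 0 < b0 -> exists2 B : R, 0 < B &
  forall t, 0 < t <= ph B -> let c := phiinv ph t in
    [/\ 0 < c, b0 <= (1 - e) * c & forall s, 0 < s <= k / 4 * t ->
      t - s < (1 - k / 4) * ph ((1 - e) * c) /\ (1 + k / 4) * ph ((1 + e) * c) < t - s].
Proof.
move=> hH2 /andP[e0 e1].
have e1p : 0 < 1 - e by lra.
have h1 : 1 < (1 - e)^-1 by rewrite invf_gt1//; lra.
have h2 : 1 < 1 + e by lra.
have [k1 k10 [x1 x10 Hx1]] := H2_ratio hH2 h1.
have [k2 k20 [x2 x20 Hx2]] := H2_ratio hH2 h2.
pose k := Num.min 1 (Num.min k1 k2).
have k0 : 0 < k by rewrite !lt_min ltr01 k10.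
have kk1 : k <= k1 by rewrite !ge_min lexx orbT.
have kk2 : k <= k2 by rewrite !ge_min lexx !orbT.
have k_le1 : k <= 1 by rewrite ge_min lexx.
exists k => [|b0 b00]; first by rewrite k0.
(* As [e <= 1 / 3], [(1 - e) * c] is at least [c / 2], so the factor 2 puts it above all
   thresholds. *)
exists (2 * (b0 + x1 + x2)) => [|t htB]; first by lra.
have B0 : 0 < 2 * (b0 + x1 + x2) by lra.
have [Bc phc] := phiinvP gam_gt0 Rc Rpos tail_fin B0 htB.
case/andP: htB => t0 _.
set c := phiinv ph t in Bc phc *.
have c0 : 0 < c by lra.
have b1h : c / 2 <= (1 - e) * c by nra.
split => // [|s /andP[s0 st]]; first by lra.
have xb : x1 <= (1 - e) * c by lra.
have xc : x2 <= c by lra.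
have q1 := Hx1 _ xb; have q2 := Hx2 _ xc.
rewrite mulrA mulVf ?gt_eqF// mul1r phc ler_pdivlMr// in q1.
have P2 : 0 < ph ((1 + e) * c).
  by apply: (phi_gt0 gam_gt0 Rc Rpos tail_fin); rewrite mulr_gt0//; lra.
rewrite phc ler_pdivlMr// in q2.
have kt : 0 <= (k1 - k) * t by rewrite mulr_ge0 ?subr_ge0// ltW.
have kp : 0 <= (k2 - k) * ph ((1 + e) * c).
  by apply: mulr_ge0; [rewrite subr_ge0|exact: ltW].
have kkt : 0 <= k * (1 - k) * t by rewrite !mulr_ge0 ?subr_ge0// ltW.
have kkp : 0 <= k * (1 - k) * ph ((1 + e) * c).
  by apply: mulr_ge0; [rewrite mulr_ge0 ?subr_ge0// ltW|exact: ltW].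
have kp0 : 0 < k * ph ((1 + e) * c) by rewrite mulr_gt0.
have kt0 : 0 < k * t by rewrite mulr_gt0.
split.
  have : (1 - k / 4) * ((1 + k) * t) <= (1 - k / 4) * ph ((1 - e) * c).
    by apply: ler_wpM2l; lra.
  by lra.
have : (1 - k / 4) * ((1 + k) * ph ((1 + e) * c)) <= (1 - k / 4) * t.
  by apply: ler_wpM2l; lra.
by lra.
Qed.

End inversion.

Theorem theorem3p3 (R : realType) (gam sig : R) (pi : {measure set R -> \bar R})
  (Rr : R -> R)
  (d : measure_display) (Om : measurableType d) (P : probability Om R)
  (d' : measure_display) (Om' : measurableType d') (Q : probability Om' R)
  (L : R -> Om' -> R) (Y : R -> Om -> \bar R) :
  0 < gam -> 0 <= sig -> levy_measure_cond pi ->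
  {within `[0%R, +oo[, continuous Rr} -> (forall x, 0 < x -> 0 < Rr x) ->
  is_levy Q L (lapexp gam sig pi) ->
  (exists a : R, 0 < a /\
     (\int[lebesgue_measure]_(x in `[a, +oo[)
        ((x * lapexp gam sig pi x^-1 * Rr x)^-1)%:E < +oo)%E) ->
  H1 (phi gam Rr) -> H2 (phi gam Rr) -> H3 Rr ->
  entrance_process P Y (Xlaw Q Rr L) ->
  forall eps : R, 0 < eps ->
    P [set w | Y t w = +oo%E \/ eps < `|fine (Y t w) / phiinv (phi gam Rr) t - 1|]
      @[t --> 0^'+] --> 0%E.
Proof.
move=> gam0 _ Hpi Rc Rpos HL Hent hH1 hH2 hH3 HY eps eps0.
have Psi_slope : asymptotic_slope (lapexp gam sig pi) gam.
  by split; [exact: lapexp_ge|exact: lapexp_lim].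
have tail_fin := tail_fin_of_entrance gam0 Hpi Rc Rpos Hent.
pose ph := phi gam Rr.
pose A t := [set w | Y t w = +oo%E \/ eps < `|fine (Y t w) / phiinv ph t - 1|].
(* Two relative errors at most [e] combine to [(1 + e) * (1 + e) <= 1 + 3 * e <= 1 + eps]. *)
pose e := Num.min eps 1 / 3.
have e0 : 0 < e by rewrite divr_gt0// lt_min eps0 ltr01.
have e3 : e <= 1 / 3 by rewrite ler_pM2r ?invr_gt0// ge_min lexx orbT.
have eeps : 3 * e <= eps by rewrite /e mulrC divfK// ge_min lexx.
have e03 : 0 < e <= 1 / 3 by rewrite e0.
have [k /andP[k0 k1] Hk] := phiinv_gap gam0 Rc Rpos tail_fin hH2 e03.
have mY t : 0 <= t -> measurable_fun setT (Y t) by case: HY => h _; exact: h.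
have Y_ge0 t w : 0 <= t -> (0 <= Y t w)%E by case: HY => _ [h _]; exact: h.
have mlt t (a : R) : 0 <= t -> measurable [set w | (Y t w < a%:E)%E].
  by move=> t0; rewrite -[X in measurable X]setTI; apply: emeasurable_fun_infty_o => //; exact: mY.
have mgt t (a : R) : 0 <= t -> measurable [set w | (a%:E < Y t w)%E].
  by move=> t0; rewrite -[X in measurable X]setTI; apply: emeasurable_fun_o_infty => //; exact: mY.
have key del : 0 < del <= 1 -> exists2 B : R, 0 < B & forall t, 0 < t <= ph B ->
    measurable (A t) /\ (P (A t) <= del%:E)%E.
  move=> /andP[del0 del1]; have del3 : del = del / 3 + del / 3 + del / 3 by lra.
  pose e' := Num.min e (k / 4).
  have e'0 : 0 < e' by rewrite lt_min e0 divr_gt0.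
  have e'e : e' <= e by rewrite ge_min lexx.
  have e'k : e' <= k / 4 by rewrite ge_min lexx orbT.
  have e'1 : 0 < e' <= 1 by apply/andP; split; lra.
  have epsl : 1 - eps <= 1 - e by lra.
  have epsu : (1 + e') * (1 + e) <= 1 + eps.
    have : e' * e <= e by rewrite ler_piMl ?(ltW e0)//; case/andP: e'1.
    by lra.
  have d31 : 0 < del / 3 <= 1 by apply/andP; split; lra.
  have [b0 b00 Hb] := Xtc_concentration HL gam0 Psi_slope Rc Rpos tail_fin hH1 hH3 e'1 d31.
  have [B B0 HB] := Hk b0 b00.
  exists B => // t ht; have [c0 bc Hs] := HB t ht.
  have t0 : 0 < t by case/andP: ht.
  set c := phiinv _ t in c0 bc Hs.
  have bc2 : b0 <= (1 + e) * c by apply: (le_trans bc); rewrite ler_pM2r//; lra.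
  have [X1 HX1] := Hb _ bc; have [X2 HX2] := Hb _ bc2.
  pose x0 := Num.max X1 X2.
  have kt0 : 0 < k / 4 * t by rewrite !mulr_gt0.
  have d30 : 0 < del / 3 by case/andP: d31.
  (* The intermediate time is chosen after [t]: a small fraction of it, at which [Y s] already
     exceeds the threshold [x0] of the concentration estimates at both levels. *)
  have [s sk Ps] := entrance_large HY x0 kt0 d30.
  have [lo hi] := Hs s sk; case/andP: sk => s0 sk.
  have st : s <= t by apply: (le_trans sk); rewrite ler_piMl ?(ltW t0)//; lra.
  have u0 : 0 <= t - s by rewrite subr_ge0.
  have p1 : 0 < ph ((1 - e) * c) by apply: (phi_gt0 gam0 Rc Rpos tail_fin); lra.
  have p2 : 0 < ph ((1 + e) * c) by apply: (phi_gt0 gam0 Rc Rpos tail_fin); lra.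
  have lo' : t - s < (1 - e') * ph ((1 - e) * c).
    by apply: (lt_le_trans lo); rewrite ler_pM2r// lerB.
  have hi' : (1 + e') * ph ((1 + e) * c) < t - s.
    by apply: le_lt_trans hi; rewrite ler_pM2r// lerD2l.
  pose D : set (\bar R) := `[x0%:E, +oo%E[%classic.
  pose B1 := [set y : \bar R | (y < ((1 - e) * c)%:E)%E].
  pose B2 := [set y : \bar R | (((1 + e') * ((1 + e) * c))%:E < y)%E].
  have mD : measurable D by exact: emeasurable_itv.
  have mB1 : measurable B1.
    by rewrite -[B1]setTI; exact: (emeasurable_fun_infty_o measurableT (@measurable_id _ _ setT)).
  have mB2 : measurable B2.
    by rewrite -[B2]setTI; exact: (emeasurable_fun_o_infty measurableT (@measurable_id _ _ setT)).
  have Dfin : D `<=` [set y | (y < +oo)%E].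
    by move=> y; rewrite /D /= in_itv /= => /andP[].
  have DP y : D y -> exists2 r, y = r%:E & x0 <= r.
    rewrite /D /= in_itv /=; case: y => [r| |] /andP[] //; rewrite lee_fin => h _; by exists r.
  have Pm (C : set (\bar R)) : measurable C ->
      (forall r, x0 <= r -> (Q (Xtc Rr L r (t - s) @^-1` C) <= (del / 3)%:E)%E) ->
      (P (Y s @^-1` D `&` Y (s + (t - s))%R @^-1` C) <= (del / 3)%:E)%E.
    move=> mC HC; apply: (markov_fixed_time HY (ltW s0) u0 (ltW d30) mC mD Dfin) => y /DP[r -> xr].
    by rewrite Xlaw1E measure_ge0 /=; exact: HC.
  have P1 : (P (Y s @^-1` D `&` Y (s + (t - s))%R @^-1` B1) <= (del / 3)%:E)%E.
    apply: Pm => // r; rewrite /x0 ge_max => /andP[X1r _].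
    have [/(_ lo') H _] := HX1 r (t - s) X1r u0; exact: H.
  have P2 : (P (Y s @^-1` D `&` Y (s + (t - s))%R @^-1` B2) <= (del / 3)%:E)%E.
    apply: Pm => // r; rewrite /x0 ge_max => /andP[_ X2r].
    have [_ /(_ hi') H] := HX2 r (t - s) X2r u0; exact: H.
  have Poo : P (Y s @^-1` [set +oo%E]) = 0%E.
    apply: (entrance_finite HY s0) => x u u'0.
    by rewrite Xlaw1E; exact: (Xtc_lt_pinfty HL gam0 Psi_slope Rc Rpos).
  rewrite (_ : s + (t - s) = t) in P1 P2; last by ring.
  have mpre r (C : set (\bar R)) : 0 <= r -> measurable C -> measurable (Y r @^-1` C).
    by move=> r0 mC; rewrite -[X in measurable X]setTI; exact: mY.
  have ms := mlt s x0 (ltW s0).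
  have moo := mpre s _ (ltW s0) (emeasurable_set1 +oo%E).
  have m1 : measurable (Y s @^-1` D `&` Y t @^-1` B1).
    by apply: measurableI; apply: mpre => //; exact: ltW.
  have m2 : measurable (Y s @^-1` D `&` Y t @^-1` B2).
    by apply: measurableI; apply: mpre => //; exact: ltW.
  have AE : A t = [set w | (Y t w < ((1 - eps) * c)%:E)%E] `|`
      [set w | (((1 + eps) * c)%:E < Y t w)%E].
    by apply: deviation_set => // w; apply: Y_ge0; exact: ltW.
  have mA : measurable (A t).
    by rewrite AE; apply: measurableU; [apply: mlt|apply: mgt]; exact: ltW.
  split=> //.
  have m3 := measurableU _ _ ms moo; have m4 := measurableU _ _ m3 m1.
  (* A deviation at [t] needs [Y s] too small, [Y s] infinite (a null event), or a low or high
     deviation from a finite large [Y s]: three probabilities of at most [del / 3]. *)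
  apply: (@le_trans _ _ (P ([set w | (Y s w < x0%:E)%E] `|` Y s @^-1` [set +oo%E] `|`
      (Y s @^-1` D `&` Y t @^-1` B1) `|` (Y s @^-1` D `&` Y t @^-1` B2)))).
    apply: le_measure; rewrite ?inE//; first exact: measurableU.
    rewrite AE => w Aw; case: (ltP (Y s w) x0%:E) => [h|xY]; first by left; left; left.
    case: (eqVneq (Y s w) +oo%E) => [h|nY]; first by left; left; right.
    have Dw : D (Y s w) by rewrite /D /= in_itv /= xY ltey.
    case: Aw => /= h; [left; right|right]; split => //.
      by rewrite /B1 /=; apply: (lt_le_trans h); rewrite lee_fin ler_pM2r.
    rewrite /B2 /=; apply: le_lt_trans h.
    by rewrite lee_fin mulrA ler_pM2r.
  rewrite del3 !EFinD; apply: (le_trans (measureU2 _ m4 m2)); apply: leeD => //.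
  apply: (le_trans (measureU2 _ m3 m1)); apply: leeD => //.
  apply: (le_trans (measureU2 _ ms moo)).
  by rewrite [X in (_ + X)%E](_ : _ = 0%E) ?adde0.
apply/fine_cvgP; split.
  have [B B0 HB] := key 1 (introT andP (conj ltr01 (lexx 1))).
  near=> t; have ht : 0 < t <= ph B.
    apply/andP; split; near: t; first exact: nbhs_right_gt.
    by apply: nbhs_right_ltW; exact: (phi_gt0 gam0 Rc Rpos tail_fin).
  have [mA PA] := HB t ht.
  by rewrite ge0_fin_numE ?measure_ge0// (le_lt_trans PA) ?ltry.
apply/cvgrPdist_le => del del0.
pose del' := Num.min del 1.
have d1 : 0 < del' <= 1 by rewrite lt_min del0 ltr01 ge_min lexx orbT.
have [B B0 HB] := key del' d1.
near=> t; have ht : 0 < t <= ph B.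
  apply/andP; split; near: t; first exact: nbhs_right_gt.
  by apply: nbhs_right_ltW; exact: (phi_gt0 gam0 Rc Rpos tail_fin).
have [mA PA] := HB t ht.
rewrite /= sub0r normrN ger0_norm ?fine_ge0//.
apply: (@le_trans _ _ del'); last by rewrite ge_min lexx.
by rewrite -lee_fin fineK// ge0_fin_numE ?measure_ge0// (le_lt_trans PA) ?ltry.
Unshelve. all: by end_near.
Qed.
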